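(* Let $\mathcal{M}$ be a closed subspace of $L^2(\mathbb{R})$. If $I$ is an inner function on $\mathbb{R}$ and $e^{i\lambda x}I\mathcal{M}\subseteq\mathcal{M}$ for all $\lambda\ge 0$, then either there exists a measurable subset $E$ of $\mathbb{R}$ such that $\mathcal{M}=\chi_E L^2(\mathbb{R})$, or $$\mathcal{M}=q\left(W\oplus IH^2(\mathbb{R})\right)$$ for some measurable function $q$ on $\mathbb{R}$ with $|q(x)|=1$ almost everywhere and some subspace $W\subseteq H^2(\mathbb{R})\ominus IH^2(\mathbb{R})$.
   Context: $H^2(\mathbb{R})$ is the closed subspace of $L^2(\mathbb{R})$ consisting of the functions $f$ whose Fourier transform $F(\lambda)=\int_{-\infty}^{\infty}f(x)e^{-i\lambda x}\,dx$ vanishes for almost every $\lambda<0$. An inner function on $\mathbb{R}$ is a function $I\in H^\infty(\mathbb{R})$ (the boundary values on $\mathbb{R}$ of bounded analytic functions on the upper half-plane; equivalently, $I\in L^\infty(\mathbb{R})$ with $I H^2(\mathbb{R})\subseteq H^2(\mathbb{R})$) such that $|I(x)|=1$ almost everywhere. $\chi_E$ is the indicator function of $E$, and $\oplus,\ominus$ denote orthogonal direct sum and orthogonal complement in $L^2(\mathbb{R})$. *)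

(* Defs.v *)
From HB Require Import structures.
From mathcomp Require Import all_boot all_order all_algebra.
From mathcomp Require Import all_classical all_reals all_analysis.
From mathcomp Require Export complex.

Set Implicit Arguments.
Unset Strict Implicit.
Unset Printing Implicit Defensive.

Import Order.TTheory GRing.Theory Num.Theory.
Import numFieldNormedType.Exports.

Local Open Scope classical_set_scope.
Local Open Scope ring_scope.
Local Open Scope complex_scope.

(* Elements of L^p(R) are represented by complex-valued Borel functions.      *)
(* Subspaces of L^2(R) are sets of such representatives that are saturated    *)
(* under almost-everywhere equality, so that Leibniz equality of saturated    *)
(* sets is equality of subspaces.                                             *)

Section HardyLine.
Context {R : realType}.

Notation mu := (@lebesgue_measure R).
Implicit Types (f g q w h I F : R -> R[i]) (A B M W : set (R -> R[i])).

Definition cmeasurable f : Prop :=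
  measurable_fun [set: R] (fun x => complex.Re (f x)) /\
  measurable_fun [set: R] (fun x => complex.Im (f x)).

Definition cintegral (D : set R) f : R[i] :=
  (\int[mu]_(x in D) complex.Re (f x)) +i* (\int[mu]_(x in D) complex.Im (f x)).

Definition Lpnorm (p : \bar R) f : \bar R :=
  ('N[mu]_p[EFin \o (fun x => ComplexField.Normc.normc (f x))])%E.

Definition Lp (p : \bar R) : set (R -> R[i]) :=
  [set f | cmeasurable f /\ (Lpnorm p f < +oo)%E].

Definition L2 : set (R -> R[i]) := Lp 2%:E.

Definition unimodular q : Prop := {ae mu, forall x, `|q x| = 1}.

Definition cinner f g : R[i] := cintegral [set: R] (fun x => f x * conjc (g x)).

Definition expi (t : R) : R[i] := cos t +i* sin t.

Definition truncated_fourier (n : nat) f (l : R) : R[i] :=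
  cintegral `[- n%:R, n%:R] (fun x => f x * expi (- (l * x))).

(* The integral defining the Fourier transform need not converge absolutely   *)
(* for f in L^2; it is understood as the limit in L^2 of the truncated        *)
(* integrals (Plancherel). F is then determined up to a null set.             *)
Definition is_fourier f F : Prop :=
  L2 F /\ (fun n => Lpnorm 2%:E (truncated_fourier n f \- F)) @ \oo --> 0%E.

Definition H2 : set (R -> R[i]) :=
  [set f | L2 f /\
    exists2 F, is_fourier f F & {ae mu, forall l, l < 0 -> F l = 0}].

(* Boundary values of bounded analytic functions on the upper half-plane,     *)
(* described as the bounded multipliers of H^2.                               *)
Definition Hinfty : set (R -> R[i]) :=
  [set I | Lp +oo%E I /\ forall f, H2 f -> H2 (I \* f)].

Definition inner_function I : Prop := Hinfty I /\ unimodular I.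

(* q A *)
Definition mulset q A : set (R -> R[i]) :=
  [set f | L2 f /\ exists2 g, A g & {ae mu, forall x, f x = q x * g x}].

(* A + B; this is A (+) B when A and B are orthogonal *)
Definition addset A B : set (R -> R[i]) :=
  [set f | L2 f /\
    exists g h, [/\ A g, B h & {ae mu, forall x, f x = g x + h x}]].

(* A (-) B *)
Definition ominus A B : set (R -> R[i]) :=
  [set f | A f /\ forall g, B g -> cinner f g = 0].

Definition L2_subspace M : Prop :=
  [/\ M `<=` L2, M (fun=> 0),
      (forall (a : R[i]) f g, M f -> M g -> M (fun x => a * f x + g x)) &
      (forall f g, M f -> L2 g -> {ae mu, forall x, f x = g x} -> M g)].

(* the closure of M in the L^2 norm is contained in M *)
Definition L2_closed_subspace M : Prop :=
  L2_subspace M /\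
  forall f, L2 f ->
    (forall e : R, 0 < e -> exists2 g, M g & (Lpnorm 2%:E (f \- g)%R < e%:E)%E) ->
    M f.

End HardyLine.

(* Main.v *)
(* Let N be the closed span of the functions exp(ilx) I m with l >= 0 and m in M.
   It is invariant under all exp(ilx), l >= 0, and I M <= N <= M. Helson's theorem
   leaves two cases for N. If N = chi_E L^2, then I M <= chi_E L^2 forces
   M = chi_E L^2. If N = q' H^2 with q' unimodular, then q = conj(I) q' gives
   q I H^2 = N <= M <= q H^2, and W is what remains of conj(q) M in the orthogonal
   complement of I H^2.

   Helson's theorem is obtained from the functions u(x) = 1 / (x + w), Im w > 0,
   and the Blaschke factors b(x) = (x + conj w) / (x + w). By the multiplication
   formula for the Fourier transform, f in L^2 lies in H^2 iff the integral of
   f(x) exp(ilx) u(x) vanishes for all l >= 0. If N is stable under multiplication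
   by every conj(u), then uniqueness for Poisson integrals gives f conj(g) = 0 for f
   in N and g orthogonal to N, whence N = chi_E L^2. Otherwise conj(b) N is not
   contained in N for some w, and there is psi <> 0 orthogonal to N with b psi in N.
   Then |psi|^2 = c |u|^2, so b psi = sqrt(c) q u with q unimodular, and N = q H^2. *)

Require Import Defs.
From mathcomp Require Import all_boot all_order all_algebra.
From mathcomp Require Import all_classical all_reals all_analysis complex.
From mathcomp Require Import measurable_realfun.
From mathcomp Require Import ring lra.

Import Order.TTheory GRing.Theory Num.Theory.
Import numFieldNormedType.Exports.

Set Implicit Arguments.
Unset Strict Implicit.
Unset Printing Implicit Defensive.

Local Open Scope classical_set_scope.
Local Open Scope ring_scope.
Local Open Scope complex_scope.

Local Notation Re := (@complex.Re _).
Local Notation Im := (@complex.Im _).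
Local Notation normc := ComplexField.Normc.normc.
Local Notation mu := (@lebesgue_measure _).
Local Notation CI := (cintegral setT).

(** * Complex-valued integrals *)

Section ComplexIntegral.
Context {R : realType}.
Implicit Types (f g : R -> R[i]) (z w : R[i]).

(** The invariance hypothesis concerns only the products of the exponentials with [I], so [M] itself
    need not be shift invariant; [N] is, because frequencies add up, and l = 0 gives the inclusion
    of I M. The transform in the definition of [H2] is a limit of truncations, known up to null
    sets. The functions exp(ilx) u(x) are, up to constants, transforms of exponentials carried by
    (-oo, -l], so pairing with them reads off negative frequencies through absolutely convergent
    integrals. This rests on the boundedness of the Fourier transform on L^2, obtained from a damped
    double integral and a Schur test. Analyticity enters through Fubini: u(x) is a weighted average
    of exp(itx) over t >= 0, so multiplying an integrable function by u preserves the vanishing of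
    its nonnegative frequencies, while a pole in the other half-plane costs one scalar condition.
    Statements about f in N and g orthogonal to N thus become statements about the single integrable
    function f conj(g). A real function without nonnegative frequencies has none at all, by
    conjugation; this is what pins down |psi|. *)

Definition sqn z : R := Re z ^+ 2 + Im z ^+ 2.

Lemma sqn_ge0 z : 0 <= sqn z.
Proof. by rewrite addr_ge0 ?sqr_ge0. Qed.

Lemma normcE z : normc z = Num.sqrt (sqn z).
Proof. by case: z. Qed.

Lemma normc_ge0 z : 0 <= normc z.
Proof. by rewrite normcE sqrtr_ge0. Qed.

Lemma sqr_normcE z : normc z ^+ 2 = sqn z.
Proof. by rewrite normcE sqr_sqrtr ?sqn_ge0. Qed.

Lemma normrE z : `|z| = (normc z)%:C.
Proof. by []. Qed.

Lemma sqnM z w : sqn (z * w) = sqn z * sqn w.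
Proof. by case: z w => a b [c d]; rewrite /sqn /=; ring. Qed.

Lemma sqn_conj z : sqn (conjc z) = sqn z.
Proof. by case: z => a b; rewrite /sqn /=; ring. Qed.

Lemma normc_conj z : normc (conjc z) = normc z.
Proof. by rewrite !normcE sqn_conj. Qed.

Lemma mulJ_sqn z : z * conjc z = (sqn z)%:C.
Proof. by case: z => a b; rewrite /sqn; simpc; congr (_ +i* _); ring. Qed.

Lemma sqn_eq0 z : (sqn z == 0) = (z == 0).
Proof.
by case: z => a b; rewrite /sqn /= paddr_eq0 ?sqr_ge0// !sqrf_eq0 eq_complex.
Qed.

Lemma normr_Re z : `|Re z| <= normc z.
Proof. by rewrite normcE -sqrtr_sqr ler_wsqrtr// lerDl sqr_ge0. Qed.

Lemma normr_Im z : `|Im z| <= normc z.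
Proof. by rewrite normcE -sqrtr_sqr ler_wsqrtr// lerDr sqr_ge0. Qed.

Lemma normc_le_ReIm z : normc z <= `|Re z| + `|Im z|.
Proof.
rewrite normcE -(@ger0_norm _ (`|Re z| + `|Im z|)) ?addr_ge0// -sqrtr_sqr.
rewrite ler_wsqrtr// sqrrD !real_normK ?num_real// /sqn.
by rewrite addrAC lerDl mulrn_wge0 ?mulr_ge0.
Qed.

Lemma normc_real (a : R) : normc a%:C = `|a|.
Proof. by rewrite normcE /sqn /= expr0n addr0 sqrtr_sqr. Qed.

Lemma normc_expi (t : R) : normc (expi t) = 1.
Proof. by rewrite normcE /sqn /= cos2Dsin2 sqrtr1. Qed.

Lemma sqn_expi (t : R) : sqn (expi t) = 1.
Proof. by rewrite /sqn /= cos2Dsin2. Qed.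

Lemma expiD (s t : R) : expi (s + t) = expi s * expi t.
Proof. by rewrite /expi cosD sinD; simpc; congr (_ +i* _); ring. Qed.

Lemma expi0 : expi (0 : R) = 1.
Proof. by rewrite /expi cos0 sin0. Qed.

Lemma expiN (t : R) : expi (- t) = conjc (expi t).
Proof. by rewrite /expi cosN sinN. Qed.

Lemma cReM z w : Re (z * w) = Re z * Re w - Im z * Im w.
Proof. by case: z w => a b []. Qed.

Lemma cImM z w : Im (z * w) = Re z * Im w + Im z * Re w.
Proof. by case: z w => a b []. Qed.

Lemma conjcM z w : conjc (z * w) = conjc z * conjc w.
Proof. exact: rmorphM. Qed.

Lemma conjcD z w : conjc (z + w) = conjc z + conjc w.
Proof. exact: rmorphD. Qed.

Lemma conjcN z : conjc (- z) = - conjc z.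
Proof. exact: rmorphN. Qed.

Lemma conjcB z w : conjc (z - w) = conjc z - conjc w.
Proof. exact: rmorphB. Qed.

Lemma cReD z w : Re (z + w) = Re z + Re w.
Proof. by case: z w => a b []. Qed.

Lemma cImD z w : Im (z + w) = Im z + Im w.
Proof. by case: z w => a b []. Qed.

Lemma cReN z : Re (- z) = - Re z.
Proof. by case: z. Qed.

Lemma cImN z : Im (- z) = - Im z.
Proof. by case: z. Qed.

Lemma cReJ z : Re (conjc z) = Re z.
Proof. by case: z. Qed.

Lemma cImJ z : Im (conjc z) = - Im z.
Proof. by case: z. Qed.

Lemma Re_realM (a : R) z : Re (a%:C * z) = a * Re z.
Proof. by rewrite cReM /= mul0r subr0. Qed.

Lemma Im_realM (a : R) z : Im (a%:C * z) = a * Im z.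
Proof. by rewrite cImM /= mul0r addr0. Qed.

Lemma complex_eqP z w : Re z = Re w -> Im z = Im w -> z = w.
Proof. by case: z w => a b [c d] /= -> ->. Qed.

Lemma aeS (P Q : R -> Prop) : {ae mu, forall x, P x} -> (forall x, P x -> Q x) ->
  {ae mu, forall x, Q x}.
Proof.
by move=> aeP PQ; apply: filterS aeP => //; exact: (ae_filter_ringOfSetsType mu).
Qed.

Lemma aeS2 (P Q S : R -> Prop) : {ae mu, forall x, P x} -> {ae mu, forall x, Q x} ->
  (forall x, P x -> Q x -> S x) -> {ae mu, forall x, S x}.
Proof.
move=> aeP aeQ PQ; apply: filterS2 aeP aeQ => //; exact: (ae_filter_ringOfSetsType mu).
Qed.

Lemma aeW (P : R -> Prop) : (forall x, P x) -> {ae mu, forall x, P x}.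
Proof. by move=> Px; apply: filterE => //; exact: (ae_filter_ringOfSetsType mu). Qed.

Lemma ae_integrable (f g : R -> \bar R) : mu.-integrable setT f ->
  measurable_fun setT g -> {ae mu, forall x, f x = g x} -> mu.-integrable setT g.
Proof.
move=> /integrableP[mf foo] mg fg; apply/integrableP; split => //.
have -> // : (\int[mu]_x `|g x| = \int[mu]_x `|f x|)%E.
apply: ae_eq_integral => //; [exact: measurableT_comp|exact: measurableT_comp|].
by apply: (aeS fg) => x -> _.
Qed.

Lemma cmeasurable_cst z : cmeasurable (fun _ : R => z).
Proof. by split; exact: measurable_cst. Qed.

Lemma cmeasurableM f g : cmeasurable f -> cmeasurable g ->
  cmeasurable (fun x => f x * g x).
Proof.
move=> [fr fi] [gr gi]; split.
- by under eq_fun do rewrite cReM; apply: measurable_funB; exact: measurable_funM.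
- by under eq_fun do rewrite cImM; apply: measurable_funD; exact: measurable_funM.
Qed.

Lemma cmeasurableD f g : cmeasurable f -> cmeasurable g ->
  cmeasurable (fun x => f x + g x).
Proof.
move=> [fr fi] [gr gi]; split.
- by under eq_fun do rewrite cReD; exact: measurable_funD.
- by under eq_fun do rewrite cImD; exact: measurable_funD.
Qed.

Lemma cmeasurable_conj f : cmeasurable f -> cmeasurable (fun x => conjc (f x)).
Proof.
move=> [fr fi]; split.
- by under eq_fun do rewrite cReJ.
- by under eq_fun do rewrite cImJ; exact: measurableT_comp.
Qed.

Lemma cmeasurableN f : cmeasurable f -> cmeasurable (fun x => - f x).
Proof.
move=> [fr fi]; split.
- by under eq_fun do rewrite cReN; exact: measurableT_comp.
- by under eq_fun do rewrite cImN; exact: measurableT_comp.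
Qed.

Lemma cmeasurableB f g : cmeasurable f -> cmeasurable g ->
  cmeasurable (fun x => f x - g x).
Proof. by move=> mf mg; apply: cmeasurableD => //; exact: cmeasurableN. Qed.

Lemma cmeasurable_real (a : R -> R) : measurable_fun setT a ->
  cmeasurable (fun x => (a x)%:C).
Proof. by move=> ma; split => //=; exact: measurable_cst. Qed.

Lemma cmeasurable_expi (a : R -> R) : measurable_fun setT a ->
  cmeasurable (fun x => expi (a x)).
Proof.
move=> ma; split => /=; apply: measurableT_comp => //; apply: continuous_measurable_fun.
- exact: continuous_cos.
- exact: continuous_sin.
Qed.

Lemma measurable_sqn f : cmeasurable f -> measurable_fun setT (fun x => sqn (f x)).
Proof. by move=> [fr fi]; apply: measurable_funD; exact: measurable_funX. Qed.

Lemma measurable_normc f : cmeasurable f -> measurable_fun setT (fun x => normc (f x)).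
Proof.
move=> mf; under eq_fun do rewrite normcE.
apply: (measurableT_comp (f := @Num.sqrt R)); last exact: measurable_sqn.
by apply: continuous_measurable_fun; exact: sqrt_continuous.
Qed.

(** * Integrability and linearity of the integral *)

Definition rinteg (a : R -> R) : Prop := mu.-integrable setT (EFin \o a).

Lemma rintegD (a b : R -> R) : rinteg a -> rinteg b -> rinteg (fun x => a x + b x).
Proof. by move=> ia ib; exact: (integrableD measurableT ia ib). Qed.

Lemma rintegZ (c : R) (a : R -> R) : rinteg a -> rinteg (fun x => c * a x).
Proof. by move=> ia; exact: (integrableZl measurableT c ia). Qed.

Lemma rinteg_norm (a : R -> R) : rinteg a -> rinteg (fun x => `|a x|).
Proof. by move=> ia; exact: (integrable_norm ia). Qed.

Lemma rinteg_le (a b : R -> R) : measurable_fun setT a -> rinteg b ->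
  (forall x, `|a x| <= b x) -> rinteg a.
Proof.
move=> ma ib ab; apply: le_integrable ib => //; first exact/measurable_EFinP.
by move=> x _ /=; rewrite lee_fin (le_trans (ab x))// ler_norm.
Qed.

Lemma rinteg_meas (a : R -> R) : rinteg a -> measurable_fun setT a.
Proof. by move=> /measurable_int/measurable_EFinP. Qed.

Definition cinteg f : Prop :=
  rinteg (fun x => Re (f x)) /\
  rinteg (fun x => Im (f x)).

Lemma cinteg_meas f : cinteg f -> cmeasurable f.
Proof.
by move=> [/measurable_int/measurable_EFinP fr /measurable_int/measurable_EFinP fi].
Qed.

Lemma cinteg_dom f (g : R -> R) : cmeasurable f -> rinteg g ->
  (forall x, normc (f x) <= g x) -> cinteg f.
Proof.
move=> [fr fi] ig fg; split; (apply: le_integrable ig => //;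
  [exact/measurable_EFinP|move=> x _ /=; rewrite lee_fin]).
- apply: le_trans (normr_Re _) _; apply: le_trans (fg x) _; exact: ler_norm.
- apply: le_trans (normr_Im _) _; apply: le_trans (fg x) _; exact: ler_norm.
Qed.

Lemma cinteg_norm f : cinteg f -> rinteg (fun x => normc (f x)).
Proof.
move=> iF; have [fr fi] := iF.
have ig : rinteg (fun x => `|Re (f x)| + `|Im (f x)|).
  by apply: rintegD; exact: rinteg_norm.
apply: rinteg_le ig _; first by apply: measurable_normc; exact: cinteg_meas.
by move=> x; rewrite ger0_norm ?normc_ge0// normc_le_ReIm.
Qed.

Lemma cinteg_mulb f g (C : R) : cinteg f -> cmeasurable g ->
  (forall x, normc (g x) <= C) -> cinteg (fun x => f x * g x).
Proof.
move=> iF mg gC.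
have ig : rinteg (fun x => C * normc (f x)).
  by apply: rintegZ; exact: cinteg_norm.
apply: cinteg_dom ig _; first by apply: cmeasurableM => //; exact: cinteg_meas.
by move=> x; rewrite ComplexField.Normc.normcM mulrC ler_wpM2r ?normc_ge0.
Qed.

Lemma cintegD f g : cinteg f -> cinteg g -> cinteg (fun x => f x + g x).
Proof.
move=> [fr fi] [gr gi]; split.
- by under eq_fun do rewrite cReD; exact: rintegD.
- by under eq_fun do rewrite cImD; exact: rintegD.
Qed.

Lemma cintegZ z f : cinteg f -> cinteg (fun x => z * f x).
Proof.
move=> iF; under eq_fun do rewrite mulrC.
by apply: (@cinteg_mulb _ _ (normc z)) => //; exact: cmeasurable_cst.
Qed.

Lemma cinteg_conj f : cinteg f -> cinteg (fun x => conjc (f x)).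
Proof.
move=> iF; apply: (cinteg_dom _ (cinteg_norm iF)).
  by apply: cmeasurable_conj; exact: cinteg_meas.
by move=> x; rewrite normc_conj.
Qed.

Lemma CID f g : cinteg f -> cinteg g -> CI (fun x => f x + g x) = CI f + CI g.
Proof.
move=> [fr fi] [gr gi]; rewrite /cintegral.
under eq_Rintegral do rewrite cReD; under [X in _ +i* X]eq_Rintegral do rewrite cImD.
by rewrite !RintegralD//; simpc.
Qed.

Lemma CIZ z f : cinteg f -> CI (fun x => z * f x) = z * CI f.
Proof.
move=> [fr fi]; case: z => a b; rewrite /cintegral.
under eq_Rintegral do rewrite cReM /=; under [X in _ +i* X]eq_Rintegral do rewrite cImM /=.
have iZ (c : R) (h : R -> R) : mu.-integrable setT (EFin \o h) ->
    rinteg (fun x => c * h x).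
  by move=> ih; exact: (integrableZl _ c ih).
by rewrite RintegralB ?RintegralD ?RintegralZl//; (try exact: iZ); simpc.
Qed.

Lemma cintegN f : cinteg f -> cinteg (fun x => - f x).
Proof. by move=> iF; under eq_fun do rewrite -mulN1r; exact: cintegZ. Qed.

Lemma CIN f : cinteg f -> CI (fun x => - f x) = - CI f.
Proof. by move=> iF; under eq_fun do rewrite -mulN1r; rewrite CIZ// mulN1r. Qed.

Lemma cintegB f g : cinteg f -> cinteg g -> cinteg (fun x => f x - g x).
Proof. by move=> iF ig; apply: cintegD => //; exact: cintegN. Qed.

Lemma CIB f g : cinteg f -> cinteg g -> CI (fun x => f x - g x) = CI f - CI g.
Proof. by move=> iF ig; rewrite CID ?CIN//; exact: cintegN. Qed.

Lemma CI_conj f : cinteg f -> CI (fun x => conjc (f x)) = conjc (CI f).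
Proof.
move=> [fr fi]; rewrite /cintegral /=.
under eq_Rintegral do rewrite cReJ; congr (_ +i* _).
under eq_Rintegral do rewrite cImJ -mulN1r.
by rewrite RintegralZl// mulN1r.
Qed.

Lemma CI0 : CI (fun _ : R => 0) = 0.
Proof. by rewrite /cintegral /Rintegral /= integral0. Qed.

Lemma CI_real (a : R -> R) : CI (fun x => (a x)%:C) = (\int[mu]_x a x)%:C.
Proof. by rewrite /cintegral /= {2}/Rintegral integral0. Qed.

Lemma cinteg_real (a : R -> R) : rinteg a -> cinteg (fun x => (a x)%:C).
Proof. by move=> ia; split => //=; exact: integrable0. Qed.

Lemma CI_ae f g : cmeasurable f -> cmeasurable g ->
  {ae mu, forall x, f x = g x} -> CI f = CI g.
Proof.
move=> [fr fi] [gr gi] fg; rewrite /cintegral /Rintegral.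
congr (fine _ +i* fine _); apply: ae_eq_integral => //.
- exact/measurable_EFinP.
- exact/measurable_EFinP.
- by apply: (aeS fg) => x -> _.
- exact/measurable_EFinP.
- exact/measurable_EFinP.
- by apply: (aeS fg) => x -> _.
Qed.

Lemma cinteg_ae f g : cinteg f -> cmeasurable g ->
  {ae mu, forall x, f x = g x} -> cinteg g.
Proof.
move=> iF [gr gi] fg; have [fr fi] := iF.
split.
- apply: (ae_integrable fr); first exact/measurable_EFinP.
  by apply: (aeS fg) => x /= ->.
- apply: (ae_integrable fi); first exact/measurable_EFinP.
  by apply: (aeS fg) => x /= ->.
Qed.

End ComplexIntegral.

(** * Fubini for complex-valued integrands *)

Section ComplexFubini.
Context {R : realType}.
Implicit Types (f g : R -> R[i]).

Lemma rinteg_dominated (a_ : nat -> R -> R) (a g : R -> R) :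
  (forall n, measurable_fun setT (a_ n)) -> measurable_fun setT a -> rinteg g ->
  {ae mu, forall x, a_ n x @[n --> \oo] --> a x} ->
  (forall n x, `|a_ n x| <= g x) ->
  (\int[mu]_x a_ n x) @[n --> \oo] --> \int[mu]_x a x.
Proof.
move=> ma_ ma ig aa ag.
have [|||||ia _ cv] := @dominated_convergence _ _ R mu setT measurableT (fun n => EFin \o a_ n) (EFin \o a) (EFin \o g).
- by move=> n; apply/measurable_EFinP; exact: ma_.
- exact/measurable_EFinP.
- by apply: (aeS aa) => x ax _; apply: cvg_EFin => //; apply: nearW.
- exact: ig.
- by apply: aeW => x n _ /=; rewrite lee_fin.
rewrite /Rintegral.
apply: fine_cvg; rewrite fineK; first exact: cv.
by move: ia => /integrable_fin_num; apply.
Qed.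

Section real_fubini.
Variables (G : R * R -> R) (a b : R -> R).
Hypothesis mG : measurable_fun setT G.
Hypotheses (ia : rinteg a) (ib : rinteg b).
Hypothesis Gab : forall p, `|G p| <= a p.1 * b p.2.

Lemma sec1_meas x : measurable_fun setT (fun y => G (x, y)).
Proof. by apply: measurableT_comp mG _; exact: pair1_measurable. Qed.

Lemma sec2_meas y : measurable_fun setT (fun x => G (x, y)).
Proof. by apply: measurableT_comp mG _; exact: pair2_measurable. Qed.

(** The domination holds at every point, so every section is integrable, and not only almost every
    one; the iterated real-valued integrals are then meaningful everywhere. *)
Lemma sec1_rinteg x : rinteg (fun y => G (x, y)).
Proof.
apply: (rinteg_le (sec1_meas x) (rintegZ (a x) ib)) => y; exact: (Gab (x, y)).
Qed.

Lemma sec2_rinteg y : rinteg (fun x => G (x, y)).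
Proof.
apply: (rinteg_le (sec2_meas y) (rintegZ (b y) ia)) => x; rewrite mulrC; exact: (Gab (x, y)).
Qed.

Lemma prod_integrable : (mu \x mu)%E.-integrable setT (EFin \o G).
Proof.
apply/integrable12ltyP; first exact/measurable_EFinP.
(* The domination makes only the product a(x) b(y) nonnegative, not the two factors, hence the
   absolute values. *)
pose c := \int[mu]_y `|b y|.
have ic := rinteg_norm ib.
apply: (@le_lt_trans _ _ (\int[mu]_x (`|a x| * c)%:E)%E); last first.
  have := rintegZ c (rinteg_norm ia) => /integrable_fin_num.
  under eq_integral do rewrite /= mulrC.
  by move=> h; rewrite ltey_eq h.
apply: ge0_le_integral => //.
- by move=> x _; exact: integral_ge0.
- have mG' : measurable_fun setT (abse \o (EFin \o G)).
    by apply: measurableT_comp => //; exact/measurable_EFinP.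
  have h := @measurable_fun_fubini_tonelli_F _ _ _ _ R mu _ mG' (fun p => abse_ge0 _).
  exact: h.
- apply/measurable_EFinP; apply: measurable_funM => //; apply: measurableT_comp => //.
  exact: rinteg_meas.
move=> x _; rewrite /c EFinM /Rintegral fineK; last exact: integrable_fin_num.
rewrite -ge0_integralZl//; last first.
  by apply/measurable_EFinP; exact: (rinteg_meas ic).
apply: ge0_le_integral => //.
- by apply: measurableT_comp => //; apply/measurable_EFinP; exact: sec1_meas.
- by apply: emeasurable_funM => //; apply/measurable_EFinP; exact: (rinteg_meas ic).
- move=> y _; rewrite /= -EFinM lee_fin (le_trans (Gab (x, y)))//= -normrM ler_norm//.
Qed.

Let F1 x : (\int[mu]_y (G (x, y))%:E)%E = (\int[mu]_y G (x, y))%:E.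
Proof. by rewrite /Rintegral fineK//; exact: (integrable_fin_num measurableT (sec1_rinteg x)). Qed.

Let F2 y : (\int[mu]_x (G (x, y))%:E)%E = (\int[mu]_x G (x, y))%:E.
Proof. by rewrite /Rintegral fineK//; exact: (integrable_fin_num measurableT (sec2_rinteg y)). Qed.

Lemma rfubini : \int[mu]_x (\int[mu]_y G (x, y)) = \int[mu]_y (\int[mu]_x G (x, y)).
Proof.
rewrite /Rintegral; congr fine.
under eq_integral do rewrite -F1; under [RHS]eq_integral do rewrite -F2.
exact: (Fubini prod_integrable).
Qed.

Lemma rfubini_integ : rinteg (fun x => \int[mu]_y G (x, y)).
Proof.
have := integrable_fubini_F prod_integrable.
rewrite /fubini_F; under eq_fun do rewrite /= F1.
by [].
Qed.

End real_fubini.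

Section complex_fubini.
Variables (G : R * R -> R[i]) (a b : R -> R).
Hypothesis mGr : measurable_fun setT (fun p => Re (G p)).
Hypothesis mGi : measurable_fun setT (fun p => Im (G p)).
Hypotheses (ia : rinteg a) (ib : rinteg b).
Hypothesis Gab : forall p, normc (G p) <= a p.1 * b p.2.

Let Gr p : `|Re (G p)| <= a p.1 * b p.2.
Proof. exact: le_trans (normr_Re _) (Gab p). Qed.
Let Gi p : `|Im (G p)| <= a p.1 * b p.2.
Proof. exact: le_trans (normr_Im _) (Gab p). Qed.

Lemma cfubini0 : CI (fun x => CI (fun y => G (x, y))) = CI (fun y => CI (fun x => G (x, y))).
Proof.
apply: complex_eqP.
- exact: (rfubini mGr ia ib Gr).
- exact: (rfubini mGi ia ib Gi).
Qed.

Lemma cfubini0_integ : cinteg (fun x => CI (fun y => G (x, y))).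
Proof. by split; [exact: (rfubini_integ mGr ia ib Gr)|exact: (rfubini_integ mGi ia ib Gi)]. Qed.

End complex_fubini.

Section product_fubini.
Variables (A B : R -> R[i]) (U : R * R -> R[i]) (C : R).
Hypotheses (iA : cinteg A) (iB : cinteg B).
Hypothesis mUr : measurable_fun setT (fun p => Re (U p)).
Hypothesis mUi : measurable_fun setT (fun p => Im (U p)).
Hypothesis UC : forall p, normc (U p) <= C.

Let G p := A p.1 * B p.2 * U p.

Let mA1 : measurable_fun setT (fun p : R * R => Re (A p.1)).
Proof. by apply: (measurableT_comp (cinteg_meas iA).1); exact: measurable_fst. Qed.
Let mA2 : measurable_fun setT (fun p : R * R => Im (A p.1)).
Proof. by apply: (measurableT_comp (cinteg_meas iA).2); exact: measurable_fst. Qed.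
Let mB1 : measurable_fun setT (fun p : R * R => Re (B p.2)).
Proof. by apply: (measurableT_comp (cinteg_meas iB).1); exact: measurable_snd. Qed.
Let mB2 : measurable_fun setT (fun p : R * R => Im (B p.2)).
Proof. by apply: (measurableT_comp (cinteg_meas iB).2); exact: measurable_snd. Qed.

Let mGr : measurable_fun setT (fun p => Re (G p)).
Proof.
have E p : Re (G p) = (Re (A p.1) * Re (B p.2) - Im (A p.1) * Im (B p.2)) * Re (U p) -
    (Re (A p.1) * Im (B p.2) + Im (A p.1) * Re (B p.2)) * Im (U p).
  by rewrite /G cReM cReM cImM.
under eq_fun do rewrite E.
by apply: measurable_funB; apply: measurable_funM => //;
  [apply: measurable_funB|apply: measurable_funD]; exact: measurable_funM.
Qed.

Let mGi : measurable_fun setT (fun p => Im (G p)).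
Proof.
have E p : Im (G p) = (Re (A p.1) * Re (B p.2) - Im (A p.1) * Im (B p.2)) * Im (U p) +
    (Re (A p.1) * Im (B p.2) + Im (A p.1) * Re (B p.2)) * Re (U p).
  by rewrite /G cImM cReM cImM.
under eq_fun do rewrite E.
by apply: measurable_funD; apply: measurable_funM => //;
  [apply: measurable_funB|apply: measurable_funD]; exact: measurable_funM.
Qed.

Let Gab p : normc (G p) <= (fun x => C * normc (A x)) p.1 * (fun y => normc (B y)) p.2.
Proof.
rewrite /G !ComplexField.Normc.normcM /= -(mulrA C) mulrC ler_wpM2r//.
by rewrite mulr_ge0 ?normc_ge0.
Qed.

Let mU1 x : cmeasurable (fun y => U (x, y)).
Proof.
split; [apply: measurableT_comp mUr _|apply: measurableT_comp mUi _]; exact: pair1_measurable.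
Qed.

Let mU2 y : cmeasurable (fun x => U (x, y)).
Proof.
split; [apply: measurableT_comp mUr _|apply: measurableT_comp mUi _]; exact: pair2_measurable.
Qed.

Let sec1 x : CI (fun y => G (x, y)) = A x * CI (fun y => B y * U (x, y)).
Proof.
rewrite -CIZ; first by congr CI; apply/funext => y; rewrite /G mulrA.
by apply: (@cinteg_mulb _ _ _ C).
Qed.

Let sec2 y : CI (fun x => G (x, y)) = B y * CI (fun x => A x * U (x, y)).
Proof.
rewrite -CIZ; first by congr CI; apply/funext => x; rewrite /G /= (mulrC (A x)) mulrA.
by apply: (@cinteg_mulb _ _ _ C).
Qed.

(** The interchanges below have this shape: two integrable factors and a bounded kernel, which is
    either an oscillating exponential or a Poisson kernel. *)
Lemma cfubini :
  CI (fun x => A x * CI (fun y => B y * U (x, y))) =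
  CI (fun y => B y * CI (fun x => A x * U (x, y))).
Proof.
under [in LHS]eq_fun do rewrite -sec1; under [in RHS]eq_fun do rewrite -sec2.
exact: (cfubini0 mGr mGi (rintegZ C (cinteg_norm iA)) (cinteg_norm iB) Gab).
Qed.

(** Besides integrability, this is the source of measurability for functions defined by an integral
    with a parameter. *)
Lemma cfubini_integ : cinteg (fun x => A x * CI (fun y => B y * U (x, y))).
Proof.
under eq_fun do rewrite -sec1.
exact: (cfubini0_integ mGr mGi (rintegZ C (cinteg_norm iA)) (cinteg_norm iB) Gab).
Qed.

End product_fubini.

End ComplexFubini.

(** * The L^2 inner product *)

Section L2.
Context {R : realType}.
Implicit Types (f g h : R -> R[i]) (a b : R[i]).

(** The squared L^2 norm as a real number. A divergent integral is sent to 0 by [fine], so estimates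
    on [nrm2] carry information only together with [L2]. *)
Definition nrm2 f : R := \int[mu]_x sqn (f x).

Lemma nrm2_ge0 f : 0 <= nrm2 f.
Proof. by apply: Rintegral_ge0 => x _; exact: sqn_ge0. Qed.

Lemma Lpnorm2E f : Lpnorm 2%:E f = ((\int[mu]_x (sqn (f x))%:E) `^ 2^-1)%E.
Proof.
rewrite /Lpnorm unlock; congr (_ `^ _)%E; apply: eq_integral => x _ /=.
by rewrite ger0_norm ?normc_ge0// powR_mulrn ?normc_ge0// sqr_normcE.
Qed.

Lemma L2P f : L2 f <-> cmeasurable f /\ rinteg (fun x => sqn (f x)).
Proof.
split=> [[mf]|[mf /integrableP[ms]]].
- rewrite Lpnorm2E => foo; split => //; apply/integrableP; split.
    by apply/measurable_EFinP; exact: measurable_sqn.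
  under eq_integral do rewrite /= ger0_norm ?sqn_ge0//.
  rewrite ltNge leye_eq; apply: contraTN foo => /eqP ->.
  by rewrite poweRyr.
- under eq_integral do rewrite /= ger0_norm ?sqn_ge0//.
  move=> foo; split => //; rewrite Lpnorm2E.
  by rewrite poweR_lty.
Qed.

Lemma L2_meas f : L2 f -> cmeasurable f.
Proof. by case. Qed.

Lemma L2_sqn f : L2 f -> rinteg (fun x => sqn (f x)).
Proof. by move=> /L2P[]. Qed.

Lemma nrm2E f : L2 f -> (\int[mu]_x (sqn (f x))%:E)%E = (nrm2 f)%:E.
Proof.
by move=> /L2_sqn sf; rewrite /nrm2 /Rintegral fineK//; exact: (integrable_fin_num measurableT sf).
Qed.

Lemma Lpnorm_nrm2 f : L2 f -> Lpnorm 2%:E f = (Num.sqrt (nrm2 f))%:E.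
Proof. by move=> L2f; rewrite Lpnorm2E nrm2E// poweR_EFin powR12_sqrt ?nrm2_ge0. Qed.

Lemma L2_dom f g (C : R) : cmeasurable f -> L2 g ->
  {ae mu, forall x, sqn (f x) <= C * sqn (g x)} -> L2 f.
Proof.
move=> mf L2g fg; apply/L2P; split => //.
apply/integrableP; split; first by apply/measurable_EFinP; exact: measurable_sqn.
have /integrableP[mg goo] := rintegZ C (L2_sqn L2g).
apply: le_lt_trans goo; apply: ae_ge0_le_integral => //.
- by apply: measurableT_comp => //; apply/measurable_EFinP; exact: measurable_sqn.
- by apply: measurableT_comp.
apply: (aeS fg) => x h _ /=; rewrite lee_fin ger0_norm ?sqn_ge0// (le_trans h)//.
exact: ler_norm.
Qed.

Lemma sqnD_le (z w : R[i]) : sqn (z + w) <= 2 * (sqn z + sqn w).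
Proof.
case: z w => a b [c d]; rewrite /sqn /=.
have := sqr_ge0 (a - c); have := sqr_ge0 (b - d); nra.
Qed.

Lemma L2_0 : L2 (fun _ : R => 0).
Proof.
apply/L2P; split; first exact: cmeasurable_cst.
by rewrite (_ : (fun x => _) = (fun=> 0)) ?/rinteg; [exact: integrable0|
  apply/funext => x; rewrite /sqn /= expr0n addr0].
Qed.

Lemma L2_mulb f g (C : R) : L2 f -> cmeasurable g ->
  {ae mu, forall x, sqn (g x) <= C} -> L2 (fun x => g x * f x).
Proof.
move=> L2f mg gC; apply: (L2_dom (C := C) (g := f)) => //.
  by apply: cmeasurableM => //; exact: L2_meas.
by apply: (aeS gC) => x h; rewrite sqnM ler_wpM2r ?sqn_ge0.
Qed.

Lemma L2Z a f : L2 f -> L2 (fun x => a * f x).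
Proof.
move=> L2f.
by apply: (L2_mulb (C := sqn a) L2f (cmeasurable_cst a)); exact: aeW.
Qed.

Lemma L2D f g : L2 f -> L2 g -> L2 (fun x => f x + g x).
Proof.
move=> L2f L2g; apply/L2P; split.
  by apply: cmeasurableD; exact: L2_meas.
apply: (@rinteg_le _ _ (fun x => 2 * (sqn (f x) + sqn (g x)))).
- by apply: measurable_sqn; apply: cmeasurableD; exact: L2_meas.
- by apply: rintegZ; apply: rintegD; exact: L2_sqn.
- by move=> x; rewrite ger0_norm ?sqn_ge0// sqnD_le.
Qed.

Lemma L2N f : L2 f -> L2 (fun x => - f x).
Proof. by move=> L2f; under eq_fun do rewrite -mulN1r; exact: L2Z. Qed.

Lemma L2B f g : L2 f -> L2 g -> L2 (fun x => f x - g x).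
Proof. by move=> L2f L2g; apply: L2D => //; exact: L2N. Qed.

Lemma L2_conj f : L2 f -> L2 (fun x => conjc (f x)).
Proof.
move=> L2f; apply: (L2_dom (C := 1) (g := f)) => //.
  by apply: cmeasurable_conj; exact: L2_meas.
by apply: aeW => x; rewrite sqn_conj mul1r.
Qed.

Lemma L2M_cinteg f g : L2 f -> L2 g -> cinteg (fun x => f x * g x).
Proof.
move=> L2f L2g; apply: (cinteg_dom (g := fun x => sqn (f x) + sqn (g x))).
- by apply: cmeasurableM; exact: L2_meas.
- by apply: rintegD; exact: L2_sqn.
move=> x; rewrite ComplexField.Normc.normcM -!sqr_normcE.
have := sqr_ge0 (normc (f x) - normc (g x)).
have := normc_ge0 (f x); have := normc_ge0 (g x); nra.
Qed.

Lemma cinner_cinteg f g : L2 f -> L2 g -> cinteg (fun x => f x * conjc (g x)).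
Proof. by move=> L2f L2g; apply: L2M_cinteg => //; exact: L2_conj. Qed.

Lemma cinner_lin a f g h : L2 f -> L2 g -> L2 h ->
  cinner (fun x => a * f x + g x) h = a * cinner f h + cinner g h.
Proof.
move=> L2f L2g L2h; rewrite /cinner.
under eq_fun do rewrite mulrDl -mulrA.
by rewrite CID ?CIZ//; [exact: cinner_cinteg|apply: cintegZ; exact: cinner_cinteg|exact: cinner_cinteg].
Qed.

Lemma cinnerB f g h : L2 f -> L2 g -> L2 h ->
  cinner (fun x => f x - g x) h = cinner f h - cinner g h.
Proof.
move=> L2f L2g L2h; rewrite /cinner; under eq_fun do rewrite mulrBl.
by rewrite CIB//; exact: cinner_cinteg.
Qed.

Lemma cinnerC f g : L2 f -> L2 g -> cinner g f = conjc (cinner f g).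
Proof.
move=> L2f L2g; rewrite /cinner -CI_conj; last exact: cinner_cinteg.
by congr CI; apply/funext => x; rewrite rmorphM /= conjcK mulrC.
Qed.

Lemma cinner_nrm2 f : cinner f f = (nrm2 f)%:C.
Proof. by rewrite /cinner; under eq_fun do rewrite mulJ_sqn; rewrite CI_real. Qed.

(** The common source of the Hilbert space inequalities: Cauchy-Schwarz, the weighted triangle
    inequality and the variation around a minimiser differ only in the choice of a and b. *)
Lemma nrm2_lin a b f g : L2 f -> L2 g ->
  nrm2 (fun x => a * f x + b * g x) =
  sqn a * nrm2 f + sqn b * nrm2 g + 2 * Re (a * conjc b * cinner f g).
Proof.
move=> L2f L2g; have L2l : L2 (fun x => a * f x + b * g x) by apply: L2D; exact: L2Z.
apply: (@complexI R); rewrite -cinner_nrm2 cinner_lin//; last exact: L2Z.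
rewrite (cinnerC (f := fun x => a * f x + b * g x) (g := f))//.
rewrite (cinnerC (f := fun x => a * f x + b * g x) (g := fun x => b * g x))//; last exact: L2Z.
rewrite !cinner_lin//; last 3 first.
- exact: L2Z.
- exact: L2Z.
- exact: L2Z.
have eZ u v : L2 u -> L2 v -> cinner (fun x => b * u x) v = b * cinner u v.
  move=> L2u L2v; rewrite /cinner; under eq_fun do rewrite -mulrA.
  by rewrite CIZ//; exact: cinner_cinteg.
have eZr u v : L2 u -> L2 v -> cinner u (fun x => b * v x) = conjc b * cinner u v.
  move=> L2u L2v; rewrite (cinnerC (f := fun x => b * v x))//; last exact: L2Z.
  by rewrite eZ// (cinnerC L2u L2v) conjcM conjcK.
rewrite !eZ ?eZr//; last exact: L2Z.
rewrite !cinner_nrm2 (cinnerC L2f L2g).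
case: (a) (b) (cinner f g) => [a1 a2] [b1 b2] [c1 c2]; rewrite /sqn; simpc.
by apply: complex_eqP => /=; ring.
Qed.

Lemma nrm2D f g : L2 f -> L2 g ->
  nrm2 (fun x => f x + g x) = nrm2 f + nrm2 g + 2 * Re (cinner f g).
Proof.
move=> L2f L2g; have := nrm2_lin 1 1 L2f L2g.
by under eq_fun do rewrite !mul1r; rewrite rmorph1 !mul1r /sqn /= expr1n expr0n addr0 !mul1r.
Qed.

Lemma nrm2Z a f : L2 f -> nrm2 (fun x => a * f x) = sqn a * nrm2 f.
Proof.
move=> L2f; rewrite /nrm2; under eq_Rintegral do rewrite sqnM.
by rewrite RintegralZl//; exact: L2_sqn.
Qed.

Lemma nrm2N f : nrm2 (fun x => - f x) = nrm2 f.
Proof. by rewrite /nrm2; apply: eq_Rintegral => x _; rewrite -mulN1r sqnM /sqn /= oppr0 expr0n addr0 sqrrN expr1n mul1r. Qed.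

Lemma nrm2_eq0 f : L2 f -> nrm2 f = 0 -> {ae mu, forall x, f x = 0}.
Proof.
move=> L2f f0; have := nrm2E L2f; rewrite f0 => i0.
have ms : measurable_fun setT (EFin \o (fun x => sqn (f x))).
  by apply/measurable_EFinP; apply: measurable_sqn; exact: L2_meas.
have : (\int[mu]_x `|(EFin \o (fun x => sqn (f x))) x| = 0)%E.
  by rewrite -[RHS]i0; apply: eq_integral => x _ /=; rewrite ger0_norm ?sqn_ge0.
move=> /(ae_eq_integral_abs mu measurableT ms) h.
apply: (aeS h) => x /(_ I) /= [] /eqP.
by rewrite sqn_eq0 => /eqP.
Qed.

Lemma cauchy_schwarz f g : L2 f -> L2 g -> sqn (cinner f g) <= nrm2 f * nrm2 g.
Proof.
move=> L2f L2g; set c := cinner f g; set N := nrm2 g.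
have [N0|N0] := eqVneq N 0.
  have g0 := nrm2_eq0 L2g N0.
  suff -> : c = 0 by rewrite /sqn /= expr0n addr0 N0 mulr0.
  rewrite -(CI0 (R := R)); apply: CI_ae; last by apply: (aeS g0) => x ->; rewrite conjc0 mulr0.
  - by apply: cinteg_meas; exact: cinner_cinteg.
  - exact: cmeasurable_cst.
have Npos : 0 < N by rewrite lt_neqAle eq_sym N0 nrm2_ge0.
(* Up to the factor N this is the residual of f after projection onto the line of g; its squared
   norm is N times the difference to be shown nonnegative. *)
have := nrm2_ge0 (fun x => N%:C * f x + (- c) * g x).
rewrite nrm2_lin// -/c -/N.
case: (c) => c1 c2; rewrite /sqn /= => h.
have {}h : 0 <= N * (nrm2 f * N - (c1 ^+ 2 + c2 ^+ 2)).
  by move: h; congr (0 <= _); ring.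
by move: h; rewrite pmulr_rge0// subr_ge0.
Qed.

End L2.

(** * Completeness and orthogonal projections *)

Section Completeness.
Context {R : realType}.
Implicit Types (f g h : R -> R[i]) (a b : R[i]).

Lemma ge0_le_limn_einf (u : (\bar R)^nat) (c : \bar R) (N : nat) :
  (forall n, (N <= n)%N -> (u n <= c)%E) -> (limn_einf u <= c)%E.
Proof.
move=> uc; rewrite limn_einf_lim; apply: lime_le; first exact: is_cvg_einfs.
near=> n; apply: (@le_trans _ _ (u (maxn n N))).
  by apply: ereal_inf_lbound; exists (maxn n N) => //=; exact: leq_maxl.
by apply: uc; exact: leq_maxr.
Unshelve. all: by end_near. Qed.

Lemma cvg_sumr_geometric (u : R^nat) (C : R) :
  (forall k, `|u k| <= C * 2^-1 ^+ k) -> cvgn (series u).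
Proof.
move=> uC; apply: normed_cvg.
apply: (@series_le_cvg _ _ (geometric C 2^-1)).
- by move=> k; exact: normr_ge0.
- by move=> k; exact: le_trans (normr_ge0 _) (uC k).
- by move=> k; exact: uC.
- by apply: is_cvg_geometric_series; rewrite ger0_norm ?invr_ge0// invf_lt1// ltr1n.
Qed.

Lemma cvg_seq_geometric (v : R^nat) (C : R) :
  (forall k, `|v k.+1 - v k| <= C * 2^-1 ^+ k) -> cvgn v.
Proof.
move=> vC; have cs := cvg_sumr_geometric vC.
have -> : v = (fun n => series (fun k => v k.+1 - v k) n + v 0%N).
  apply/funext => n; rewrite /series /= telescope_sumr//; ring.
by apply: is_cvgD => //; exact: is_cvg_cst.
Qed.

(* The squared increments are summed with weights [4 ^ k]: the sum is integrable,
   so almost everywhere the increments decay geometrically. *)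
Lemma ae_cvg_fast (g : nat -> R -> R[i]) : (forall k, L2 (g k)) ->
  (forall k, nrm2 (fun x => g k.+1 x - g k x) <= 8^-1 ^+ k) ->
  {ae mu, forall x, cvgn (fun k => Re (g k x)) /\ cvgn (fun k => Im (g k x))}.
Proof.
move=> L2g gk.
pose d k x := 4 ^+ k * sqn (g k.+1 x - g k x) : R.
have d0 k x : 0 <= d k x by rewrite mulr_ge0 ?exprn_ge0 ?sqn_ge0.
have L2d k : L2 (fun x => g k.+1 x - g k x) by exact: L2B.
have md k : measurable_fun setT (EFin \o d k).
  apply/measurable_EFinP; apply: measurable_funM; first exact: measurable_cst.
  by apply: measurable_sqn; exact: L2_meas.
have id k : (\int[mu]_x (d k x)%:E <= (2^-1 ^+ k)%:E)%E.
  under eq_integral do rewrite /d EFinM.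
  rewrite ge0_integralZl//; last first.
  - by move=> x _; rewrite lee_fin sqn_ge0.
  - by apply/measurable_EFinP; apply: measurable_sqn; exact: L2_meas.
  rewrite nrm2E// -EFinM lee_fin; apply: (le_trans (ler_wpM2l _ (gk k))).
    by rewrite exprn_ge0.
  by rewrite -exprMn (_ : 4 * 8^-1 = 2^-1 :> R)//; field.
pose S x := (\sum_(k <oo) (d k x)%:E)%E.
have S0 x : (0 <= S x)%E by apply: nneseries_ge0 => k _ _; rewrite lee_fin.
have mS : measurable_fun setT S.
  by apply: ge0_emeasurable_sum => [k x _ _|k _]; [rewrite lee_fin|exact: md].
have iS : (\int[mu]_x S x < +oo)%E.
  rewrite integral_nneseries//; last by move=> k x _; rewrite lee_fin.
  apply: (@le_lt_trans _ _ (\sum_(k <oo) ((2^-1 ^+ k)%:E : \bar R))%E).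
    by apply: lee_nneseries => // k _ _; apply: integral_ge0 => x _; rewrite lee_fin.
  have cg : cvgn (series (geometric (1 : R) 2^-1)).
    by apply: is_cvg_geometric_series; rewrite ger0_norm ?invr_ge0// invf_lt1// ltr1n.
  have -> : (\sum_(k <oo) ((2^-1 ^+ k)%:E : \bar R))%E = (limn (series (geometric (1 : R) 2^-1)))%:E.
    rewrite -EFin_lim//; congr (limn _); apply/funext => n /=.
    by rewrite sumEFin /series /=; congr EFin; apply: eq_bigr => k _; rewrite mul1r.
  by rewrite ltry.
have Sfin : {ae mu, forall x, S x \is a fin_num}.
  have iSS : mu.-integrable setT S.
    apply/integrableP; split => //.
    by under eq_integral do rewrite gee0_abs//.
  by apply: (aeS (integrable_ae measurableT iSS)) => x; apply.
apply: (aeS Sfin) => x Sx.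
pose s := fine (S x).
have ds k : d k x <= s.
  rewrite -lee_fin fineK//.
  rewrite -[leLHS]/((fun k => (d k x)%:E) k).
  rewrite /S (nneseries_split 0%N k.+1)//; last by move=> i _; rewrite lee_fin.
  rewrite add0n big_nat_recr//= -[leLHS]add0e -addeA.
  apply: leeD; first by apply: sume_ge0 => i _; rewrite lee_fin.
  by rewrite leeDl// nneseries_ge0// => i _ _; rewrite lee_fin.
have s0 : 0 <= s by exact: fine_ge0.
have nd k : normc (g k.+1 x - g k x) <= Num.sqrt s * 2^-1 ^+ k.
  rewrite -(@ler_pXn2r _ 2)//; last 2 first.
  - by rewrite nnegrE normc_ge0.
  - by rewrite nnegrE mulr_ge0 ?sqrtr_ge0// exprn_ge0// invr_ge0.
  rewrite sqr_normcE exprMn sqr_sqrtr// -exprM mulnC exprM.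
  rewrite (_ : 2^-1 ^+ 2 = 4^-1 :> R); last by field.
  by rewrite exprVn ler_pdivlMr ?exprn_gt0// mulrC; exact: ds.
split; apply: (cvg_seq_geometric (C := Num.sqrt s)) => k; apply: le_trans (nd k).
- by rewrite -cReN -cReD; exact: normr_Re.
- by rewrite -cImN -cImD; exact: normr_Im.
Qed.

(** Riesz-Fischer: a subsequence with increments of squared norm at most 8^-k converges almost
    everywhere, and Fatou's lemma turns the pointwise limit into a limit in norm of the whole
    sequence. *)
Lemma L2_complete (u : nat -> R -> R[i]) : (forall n, L2 (u n)) ->
  (forall e : R, 0 < e -> exists N, forall m n, (N <= m)%N -> (N <= n)%N ->
     nrm2 (fun x => u m x - u n x) <= e) ->
  exists2 f, L2 f & forall e : R, 0 < e -> exists N, forall n, (N <= n)%N ->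
     nrm2 (fun x => u n x - f x) <= e.
Proof.
move=> L2u cau.
have /choice[N0 N0P] : forall k, exists N, forall m n, (N <= m)%N -> (N <= n)%N ->
     nrm2 (fun x => u m x - u n x) <= 8^-1 ^+ k.
  by move=> k; apply: cau; rewrite exprn_gt0.
(* The partial sums make the indices monotone and at least N0 k; the extra k makes them
   unbounded. *)
pose N k := (\sum_(i < k.+1) N0 i + k)%N.
have N0N k : (N0 k <= N k)%N by rewrite /N big_ord_recr /= -addnA addnCA leq_addr.
have NS k : (N k <= N k.+1)%N by rewrite /N [in leqRHS]big_ord_recr /=; apply: leq_add; [exact: leq_addr|exact: leqnSn].
pose g k := u (N k).
have L2g k : L2 (g k) by exact: L2u.
have gk k : nrm2 (fun x => g k.+1 x - g k x) <= 8^-1 ^+ k.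
  by apply: N0P => //; exact: leq_trans (NS k).
have cvg_g := ae_cvg_fast L2g gk.
(* The upper limit is measurable and defined everywhere, and it agrees with the limit wherever that
   exists. *)
pose f x := (fine (limn_esup (fun k => (Re (g k x))%:E))) +i* (fine (limn_esup (fun k => (Im (g k x))%:E))).
have mf : cmeasurable f.
  split => /=; (apply: measurableT_comp => //; apply: measurable_fun_limn_esup => k;
    apply/measurable_EFinP); [exact: (L2_meas (L2g k)).1|exact: (L2_meas (L2g k)).2].
have gf : {ae mu, forall x, Re (g k x) @[k --> \oo] --> Re (f x) /\ Im (g k x) @[k --> \oo] --> Im (f x)}.
  apply: (aeS cvg_g) => x [cr ci].
  have H (v : R^nat) : cvgn v -> v @ \oo --> fine (limn_esup (EFin \o v)).
    move=> cv; have cve : (EFin \o v) @ \oo --> (limn v)%:E.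
      by apply: cvg_EFin; [exact: nearW|exact: cv].
    by rewrite (cvg_limn_einf_sup cve).2.
  by split; exact: H.
(* Fatou's lemma along the subsequence, with u n kept fixed. *)
have key n e (M : nat) : (forall k, (M <= k)%N -> nrm2 (fun x => g k x - u n x) <= e) ->
    (\int[mu]_x (sqn (f x - u n x))%:E <= e%:E)%E.
  move=> He.
  have msq k : measurable_fun setT (fun x => (sqn (g k x - u n x))%:E).
    by apply/measurable_EFinP; apply: measurable_sqn; apply: cmeasurableB; exact: L2_meas.
  have mfu : measurable_fun setT (fun x => (sqn (f x - u n x))%:E).
    by apply/measurable_EFinP; apply: measurable_sqn; apply: cmeasurableB => //; exact: L2_meas.
  have -> : (\int[mu]_x (sqn (f x - u n x))%:E = \int[mu]_x limn_einf (fun k => (sqn (g k x - u n x))%:E))%E.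
    apply: ae_eq_integral => //.
      rewrite /limn_einf; apply: measurableT_comp => //; apply: measurable_fun_limn_esup => k.
      by apply: measurableT_comp (msq k).
    apply: (aeS gf) => x [cr ci] _; apply/esym.
    have cv : (fun k => (sqn (g k x - u n x))%:E) @ \oo --> (sqn (f x - u n x))%:E.
      apply: cvg_EFin; first exact: nearW.
      rewrite /sqn !cReD !cReN !cImD !cImN.
      rewrite [X in X @ _](_ : _ = fun k => (Re (g k x) - Re (u n x)) ^+ 2 + (Im (g k x) - Im (u n x)) ^+ 2); last first.
        by apply/funext => k /=; rewrite cReD cReN cImD cImN.
      by apply: cvgD; (under eq_fun do rewrite expr2); rewrite expr2; apply: cvgM; apply: cvgB => //; exact: cvg_cst.
    by rewrite (cvg_limn_einf_sup cv).1.
  apply: le_trans (fatou _ _ _ _) _ => //.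
    by move=> k x _; rewrite lee_fin sqn_ge0.
  apply: (ge0_le_limn_einf (N := M)) => k /He.
  by rewrite nrm2E ?lee_fin//; exact: L2B.
have kN k : (k <= N k)%N by rewrite leq_addl.
have key2 n e M : (M <= n)%N -> (forall m n, (M <= m)%N -> (M <= n)%N -> nrm2 (fun x => u m x - u n x) <= e) ->
    (\int[mu]_x (sqn (f x - u n x))%:E <= e%:E)%E.
  move=> Mn HM; apply: (key n e M) => k Mk; apply: HM => //.
  exact: leq_trans (kN k).
have L2fu n e M : (M <= n)%N -> (forall m n, (M <= m)%N -> (M <= n)%N -> nrm2 (fun x => u m x - u n x) <= e) ->
    L2 (fun x => f x - u n x).
  move=> Mn HM; have mfu : cmeasurable (fun x => f x - u n x) by apply: cmeasurableB => //; exact: L2_meas.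
  apply/L2P; split => //; apply/integrableP; split.
    by apply/measurable_EFinP; exact: measurable_sqn.
  under eq_integral do rewrite /= ger0_norm ?sqn_ge0//.
  by apply: le_lt_trans (key2 _ _ _ Mn HM) _; rewrite ltry.
have L2f : L2 f.
  have [M HM] := cau 1 ltr01.
  have := L2D (L2fu _ _ _ (leqnn M) HM) (L2u M).
  by under eq_fun do rewrite subrK.
exists f => // e e0; have [M HM] := cau e e0.
exists M => n Mn; have := key2 _ _ _ Mn HM.
rewrite nrm2E ?lee_fin; last exact: L2fu Mn HM.
have -> : (fun x => u n x - f x) = (fun x => - (f x - u n x)) by apply/funext => x; rewrite opprB.
by rewrite nrm2N.
Qed.

(** Follows from the positivity of the squared norm of r f - r^-1 g with r = sqrt t. A small t keeps
    the coefficient of the first term close to 1, which a plain factor 2 would not do in the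
    minimisation argument of [L2_projection]. *)
Lemma nrm2D_le (t : R) f g : 0 < t -> L2 f -> L2 g ->
  nrm2 (fun x => f x + g x) <= (1 + t) * nrm2 f + (1 + t^-1) * nrm2 g.
Proof.
move=> t0 L2f L2g; rewrite nrm2D//.
pose r := Num.sqrt t.
have r0 : 0 < r by rewrite sqrtr_gt0.
have := nrm2_ge0 (fun x => r%:C * f x + (- r^-1%:C) * g x).
rewrite nrm2_lin// => h; rewrite -subr_ge0; move: h.
have -> : sqn r%:C = t by rewrite /sqn /= expr0n addr0 sqr_sqrtr ?ltW.
have -> : sqn (- r^-1%:C) = t^-1.
  by rewrite /sqn /= oppr0 expr0n addr0 sqrrN exprVn sqr_sqrtr ?ltW.
have -> : Re (r%:C * conjc (- r^-1%:C) * cinner f g) = - Re (cinner f g).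
  by case: (cinner f g) => c1 c2 /=; field; rewrite gt_eqF.
by congr (0 <= _); ring.
Qed.

Lemma parallelogram f g : L2 f -> L2 g ->
  nrm2 (fun x => f x - g x) = 2 * nrm2 f + 2 * nrm2 g - nrm2 (fun x => f x + g x).
Proof.
move=> L2f L2g; rewrite (nrm2D L2f L2g) (nrm2D L2f (L2N L2g)) nrm2N.
have -> : cinner f (fun x => - g x) = - cinner f g.
  rewrite /cinner -CIN; last exact: cinner_cinteg.
  by congr CI; apply/funext => x; rewrite conjcN mulrN.
by rewrite cReN; ring.
Qed.

(** * Orthogonal complements and projections *)

Definition perp (A : set (R -> R[i])) : set (R -> R[i]) :=
  [set f | L2 f /\ forall g, A g -> cinner f g = 0].

Lemma closed_subspaceP (M : set (R -> R[i])) : L2_subspace M ->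
  (forall f, L2 f -> (forall e : R, 0 < e -> exists2 g, M g & nrm2 (fun x => f x - g x) <= e) -> M f) ->
  L2_closed_subspace M.
Proof.
move=> sM cM; split => // f L2f Hf; apply: cM => // e e0.
have [|g Mg fg] := Hf (Num.sqrt e); first by rewrite sqrtr_gt0.
have L2g : L2 g by case: sM => + _ _ _; exact.
exists g => //; have L2d := L2B L2f L2g.
move: fg; rewrite Lpnorm_nrm2// lte_fin ltr_sqrt// => /ltW //.
Qed.

Lemma closed_subspace_lim (M : set (R -> R[i])) f : L2_closed_subspace M -> L2 f ->
  (forall e : R, 0 < e -> exists2 g, M g & nrm2 (fun x => f x - g x) <= e) -> M f.
Proof.
move=> [[ML2 _ _ _] cM] L2f Hf; apply: cM => // e e0.
have [|g Mg fg] := Hf (e ^+ 2 / 2); first by rewrite divr_gt0 ?exprn_gt0.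
exists g => //; have L2d := L2B L2f (ML2 _ Mg).
rewrite (_ : e = Num.sqrt (e ^+ 2)); last by rewrite sqrtr_sqr gtr0_norm.
rewrite (Lpnorm_nrm2 L2d) lte_fin ltr_sqrt ?exprn_gt0//.
apply: le_lt_trans fg _; rewrite ltr_pdivrMr// ltr_pMr ?exprn_gt0// ltr1n//.
Qed.

Lemma perp_closed (A : set (R -> R[i])) : A `<=` L2 -> L2_closed_subspace (perp A).
Proof.
move=> AL2; apply: closed_subspaceP.
  split.
  - by move=> f [].
  - split; first exact: L2_0.
    by move=> g _; rewrite /cinner; under eq_fun do rewrite mul0r; exact: CI0.
  - move=> a f g [L2f fA] [L2g gA]; split; first by apply: L2D => //; exact: L2Z.
    by move=> h Ah; rewrite cinner_lin ?fA ?gA ?mulr0 ?addr0//; exact: AL2.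
  - move=> f g [L2f fA] L2g fg; split => // h Ah; rewrite -(fA h Ah); apply: CI_ae.
    + by apply: cinteg_meas; apply: cinner_cinteg => //; exact: AL2.
    + by apply: cinteg_meas; apply: cinner_cinteg => //; exact: AL2.
    + by apply: (aeS fg) => x ->.
move=> f L2f Hf; split => // h Ah; have L2h := AL2 _ Ah.
apply/eqP; rewrite -sqn_eq0 eq_le sqn_ge0 andbT; apply/ler_addgt0Pr => e e0.
rewrite add0r.
(* Cauchy-Schwarz multiplies this tolerance by [nrm2 h], which leaves at most e; the added 1 avoids
   a zero denominator. *)
have [|g [L2g gA] fg] := Hf (e / (1 + nrm2 h)).
  by rewrite divr_gt0// ltr_pwDl// nrm2_ge0.
have -> : cinner f h = cinner (fun x => f x - g x) h by rewrite cinnerB// gA// subr0.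
apply: le_trans (cauchy_schwarz (L2B L2f L2g) L2h) _.
apply: le_trans (ler_wpM2r (nrm2_ge0 _) fg) _.
rewrite mulrAC ler_pdivrMr ?ltr_pwDl ?nrm2_ge0// ler_pM2l// lerDr ler01//.
Qed.

(** A minimising sequence is Cauchy by the parallelogram identity, because midpoints stay in [M];
    the minimality of its limit forces orthogonality. *)
Lemma L2_projection (M : set (R -> R[i])) f : L2_closed_subspace M -> L2 f ->
  exists2 m, M m & perp M (fun x => f x - m x).
Proof.
move=> cM L2f; have [[ML2 M0 Mlin Mae] _] := cM.
pose D := [set nrm2 (fun x => f x - m x) | m in M].
have D0 : D !=set0 by exists (nrm2 (fun x => f x - 0)); exists (fun=> 0).
have lD : lbound D 0 by move=> _ [m Mm <-]; exact: nrm2_ge0.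
have hD : has_inf D by split => //; exists 0.
pose d := inf D.
have dle m : M m -> d <= nrm2 (fun x => f x - m x).
  by move=> Mm; apply: ge_inf; [exists 0|exists m].
have /choice[m mP] : forall n : nat, exists m, M m /\ nrm2 (fun x => f x - m x) <= d + n.+1%:R^-1.
  move=> n; have [|_ [m Mm <-] h] := @inf_adherent _ D n.+1%:R^-1 _ hD; first by rewrite invr_gt0.
  by exists m; split => //; exact: ltW.
have L2fm n : L2 (fun x => f x - m n x) by apply: L2B => //; apply: ML2; exact: (mP n).1.
have [m0 L2m0 Hm0] : exists2 g, L2 g & forall e : R, 0 < e -> exists N, forall n, (N <= n)%N ->
     nrm2 (fun x => m n x - g x) <= e.
  apply: L2_complete; first by move=> n; apply: ML2; exact: (mP n).1.
  move=> e e0.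
  (* The parallelogram identity bounds the squared distance of two terms by 2 (d + 1/(n+1)) + 2 (d +
     1/(k+1)) - 4 d, hence by 4/(N+1). *)
  have [N HN] : exists N : nat, 4 * N.+1%:R^-1 <= e.
    exists (Num.truncn (4 / e)).
    rewrite ler_pdivrMr// mulrC -ler_pdivrMr//.
    by apply: ltW; exact: truncnS_gt.
  exists N => k n Nk Nn.
  have -> : (fun x => m k x - m n x) = (fun x => (f x - m n x) - (f x - m k x)).
    by apply/funext => x; ring.
  rewrite parallelogram//.
  have -> : nrm2 (fun x => f x - m n x + (f x - m k x)) =
      4 * nrm2 (fun x => f x - (2^-1 * m n x + 2^-1 * m k x)).
    have -> : 4 = sqn (2 : R[i]) :> R by rewrite /sqn /=; ring.
    rewrite -nrm2Z; last first.
      by apply: L2B => //; apply: L2D; apply: L2Z; apply: ML2; [exact: (mP n).1|exact: (mP k).1].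
    by congr nrm2; apply/funext => x; field.
  have Mmid : M (fun x => 2^-1 * m n x + 2^-1 * m k x).
    apply: (Mlin 2^-1); first exact: (mP n).1.
    have := Mlin 2^-1 _ _ (mP k).1 M0.
    by under eq_fun do rewrite addr0.
  have := dle _ Mmid; have := (mP n).2; have := (mP k).2.
  have nN : n.+1%:R^-1 <= N.+1%:R^-1 :> R by rewrite lef_pV2 ?posrE// ler_nat.
  have kN : k.+1%:R^-1 <= N.+1%:R^-1 :> R by rewrite lef_pV2 ?posrE// ler_nat.
  move: nN kN HN.
  move: (n.+1%:R^-1) (k.+1%:R^-1) (N.+1%:R^-1) (nrm2 _) (nrm2 _) (nrm2 _) => r1 r2 r3 r4 r5 r6.
  lra.
have Mm0 : M m0.
  apply: (closed_subspace_lim cM) => // e /Hm0[N HN]; exists (m N); first exact: (mP N).1.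
  have -> : (fun x => m0 x - m N x) = (fun x => - (m N x - m0 x)) by apply/funext => x; rewrite opprB.
  by rewrite nrm2N; exact: HN.
have fm0 : nrm2 (fun x => f x - m0 x) <= d.
  apply/ler_addgt0Pr => e e0.
  have d0 : 0 <= d by apply: lb_le_inf.
  (* Three errors are each kept below e / 4: t d, then (1 + t)/(n+1), then (1 + 1/t) times the
     squared distance from m n to m0. Adding 1 to d covers the case d = 0. *)
  pose t := e / (4 * (d + 1)).
  have t0 : 0 < t by rewrite divr_gt0// mulr_gt0// ltr_wpDl.
  pose s := 1 + t^-1.
  have s0 : 0 < s by rewrite addr_gt0// invr_gt0.
  have [|N1 HN1] := Hm0 (e / (4 * s)); first by rewrite divr_gt0// mulr_gt0.
  pose N2 := Num.truncn (4 * (1 + t) / e).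
  pose n := maxn N1 N2.
  have -> : (fun x => f x - m0 x) = (fun x => (f x - m n x) + (m n x - m0 x)).
    by apply/funext => x; ring.
  apply: le_trans (nrm2D_le t0 (L2fm n) _) _.
    by apply: L2B => //; apply: ML2; exact: (mP n).1.
  have h1 : (1 + t^-1) * nrm2 (fun x => m n x - m0 x) <= e / 4.
    rewrite -/s mulrC -ler_pdivlMr// -mulrA -invfM; apply: HN1; exact: leq_maxl.
  have h2 : (1 + t) * n.+1%:R^-1 <= e / 4.
    rewrite ler_pdivrMr// -ler_pdivrMl ?divr_gt0//.
    have -> : (e / 4)^-1 * (1 + t) = 4 * (1 + t) / e by field; rewrite gt_eqF.
    apply: (@le_trans _ _ N2.+1%:R); first by apply: ltW; exact: truncnS_gt.
    by rewrite ler_nat ltnS leq_maxr.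
  have h3 : t * d <= e / 4.
    rewrite /t invfM mulrA -[leRHS]mulr1 -mulrA ler_pM2l ?divr_gt0//.
    by rewrite mulrC ler_pdivrMr ?mul1r ?lerDl// ltr_wpDl.
  have h4 := ler_wpM2l (ltW (addr_gt0 ltr01 t0)) (mP n).2.
  rewrite (mulrDr (1 + t) d) (mulrDl 1 t d) mul1r in h4.
  move: h1 h2 h3 h4.
  move: ((1 + t) * nrm2 _) ((1 + t^-1) * nrm2 _) ((1 + t) * n.+1%:R^-1) (t * d) => x1 x2 x3 x4.
  lra.
exists m0 => //; split; first exact: L2B.
move=> g Mg; have L2g := ML2 _ Mg.
pose F := fun x => f x - m0 x; have L2F : L2 F by exact: L2B.
set z := cinner _ g; apply/eqP; rewrite -sqn_eq0 eq_le sqn_ge0 andbT leNgt; apply/negP => z0.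
(* Moving m0 by t z g changes the squared distance to f by t |z|^2 (t |g|^2 - 2). This t makes t
   |g|^2 at most 1, so a nonzero z would beat the minimum. *)
pose t := (1 + nrm2 g)^-1.
have t0 : 0 < t by rewrite invr_gt0 ltr_pwDl// nrm2_ge0.
have tN : t * nrm2 g <= 1.
  by rewrite /t mulrC ler_pdivrMr ?mul1r ?lerDr// ltr_pwDl// nrm2_ge0.
have Mv : M (fun x => t%:C * z * g x + m0 x) by exact: Mlin.
have := dle _ Mv.
have -> : (fun x => f x - (t%:C * z * g x + m0 x)) = (fun x => 1 * F x + (- (t%:C * z)) * g x).
  by apply/funext => x; rewrite /F; ring.
rewrite nrm2_lin// -/z => h.
have e1 : sqn (1 : R[i]) = 1 by rewrite /sqn /=; ring.
have e2 : sqn (- (t%:C * z)) = t ^+ 2 * sqn z by case: (z) => z1 z2; rewrite /sqn /=; ring.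
have e3 : Re (1 * conjc (- (t%:C * z)) * z) = - t * sqn z.
  by case: (z) => z1 z2; rewrite /sqn /=; ring.
move: h; rewrite e1 e2 e3 mul1r => h.
have : 0 <= t * sqn z * (t * nrm2 g - 2) by move: h fm0; rewrite -/F; lra.
rewrite pmulr_rge0 ?mulr_gt0// subr_ge0; lra.
Qed.

(** The form in which membership in a closed subspace is established below: by testing against its
    orthogonal complement. *)
Lemma perpK (M : set (R -> R[i])) f : L2_closed_subspace M -> L2 f ->
  (forall g, perp M g -> cinner f g = 0) -> M f.
Proof.
move=> cM L2f fM; have [m Mm [L2d dM]] := L2_projection cM L2f.
have [[ML2 _ _ Mae] _] := cM; have L2m := ML2 _ Mm.
have : nrm2 (fun x => f x - m x) = 0.
  apply: (@complexI R); rewrite -cinner_nrm2 cinnerB//.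
  rewrite fM; last by split.
  by rewrite (cinnerC L2d L2m) dM// conjc0 subr0.
move=> /(nrm2_eq0 L2d) d0; apply: (Mae m) => //.
by apply: (aeS d0) => x /eqP; rewrite subr_eq0 => /eqP.
Qed.

End Completeness.

(** * Complex exponentials and resolvents *)

Section Exponentials.
Context {R : realType}.
Implicit Types (f g h : R -> R[i]) (z w : R[i]) (a b x t s : R).

Lemma FTC2_is_derive (F f : R -> R) a b : a <= b -> (forall x, is_derive x 1 F (f x)) ->
  continuous f -> \int[mu]_(x in `[a, b]) f x = F b - F a.
Proof.
move=> ab dF cf; move: ab; rewrite le_eqVlt => /predU1P[<-|ab].
  by rewrite subrr set_itv1 Rintegral_set1.
have cF : continuous F.
  by move=> x; apply: differentiable_continuous; apply/derivable1_diffP; case: (dF x).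
rewrite /Rintegral (continuous_FTC2 (F := F))//.
- exact: continuous_subspaceT.
- split; first by move=> x _; case: (dF x).
  + by apply: cvg_at_right_filter; exact: cF.
  + by apply: cvg_at_left_filter; exact: cF.
- by move=> x _; rewrite derive1E; case: (dF x).
Qed.

(** This is exp(itz), with the decay exp(-t Im z) separated from the oscillation; z in the upper
    half-plane means decay as t tends to +oo. *)
Definition cexp z t : R[i] := (expR (- (t * Im z)))%:C * expi (t * Re z).

Lemma cexpD z w t : cexp (z + w) t = cexp z t * cexp w t.
Proof.
rewrite /cexp cReD cImD !mulrDr opprD expRD expiD rmorphM /=; ring.
Qed.

Lemma cexp0 z : cexp z 0 = 1.
Proof. by rewrite /cexp !mul0r oppr0 expR0 expi0 mulr1. Qed.

Lemma cexp_real x t : cexp x%:C t = expi (t * x).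
Proof. by rewrite /cexp /= mulr0 oppr0 expR0 mul1r. Qed.

Lemma normc_cexp z t : normc (cexp z t) = expR (- (t * Im z)).
Proof.
by rewrite ComplexField.Normc.normcM normc_expi mulr1 normc_real ger0_norm ?expR_ge0.
Qed.

Lemma cexp_neq0 z t : cexp z t != 0.
Proof.
apply/eqP => /(congr1 (@ComplexField.Normc.normc R)); rewrite normc_cexp ComplexField.Normc.normc0 => /eqP.
by rewrite gt_eqF ?expR_gt0.
Qed.

Lemma cexp_oppt z t : cexp z (- t) = cexp (- z) t.
Proof. by rewrite /cexp cReN cImN !mulNr !mulrN. Qed.

Lemma Re_cexp z t : Re (cexp z t) = expR (- (t * Im z)) * cos (t * Re z).
Proof. by rewrite /cexp cReM /= mul0r subr0. Qed.

Lemma Im_cexp z t : Im (cexp z t) = expR (- (t * Im z)) * sin (t * Re z).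
Proof. by rewrite /cexp cImM /= mul0r addr0. Qed.

Lemma is_derive_Re_cexp z t :
  is_derive t 1 (fun t => Re (cexp z t)) (Re ('i * z * cexp z t)).
Proof.
have -> : (fun t => Re (cexp z t)) = (fun t => expR (- (t * Im z)) * cos (t * Re z)).
  by apply/funext => u; rewrite Re_cexp.
have -> : Re ('i * z * cexp z t) = - Im z * Re (cexp z t) - Re z * Im (cexp z t).
  by case: (cexp z t) (z) => [c d] [x y] /=; ring.
rewrite Re_cexp Im_cexp.
apply: is_derive_eq; rewrite /GRing.scale /=; ring.
Qed.

Lemma is_derive_Im_cexp z t :
  is_derive t 1 (fun t => Im (cexp z t)) (Im ('i * z * cexp z t)).
Proof.
have -> : (fun t => Im (cexp z t)) = (fun t => expR (- (t * Im z)) * sin (t * Re z)).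
  by apply/funext => u; rewrite Im_cexp.
have -> : Im ('i * z * cexp z t) = - Im z * Im (cexp z t) + Re z * Re (cexp z t).
  by case: (cexp z t) (z) => [c d] [x y] /=; ring.
rewrite Re_cexp Im_cexp.
apply: is_derive_eq; rewrite /GRing.scale /=; ring.
Qed.

Lemma continuous_Re_cexp z : continuous (fun t => Re (cexp z t)).
Proof.
by move=> t; apply: differentiable_continuous; apply/derivable1_diffP; case: (is_derive_Re_cexp z t).
Qed.

Lemma continuous_Im_cexp z : continuous (fun t => Im (cexp z t)).
Proof.
by move=> t; apply: differentiable_continuous; apply/derivable1_diffP; case: (is_derive_Im_cexp z t).
Qed.

Lemma cmeasurable_cexp z : cmeasurable (cexp z).
Proof.
split; apply: continuous_measurable_fun; [exact: continuous_Re_cexp|exact: continuous_Im_cexp].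
Qed.

Lemma cexp_int z a b : z != 0 -> a <= b ->
  cintegral `[a, b] (cexp z) = (cexp z b - cexp z a) / ('i * z).
Proof.
move=> z0 ab; rewrite /cintegral.
have iz0 : 'i * z != 0 by rewrite mulf_neq0// eq_complex /= oner_eq0 andbF.
set c := ('i * z)^-1.
have e1 : \int[mu]_(x in `[a, b]) Re (cexp z x) = Re (cexp z b * c) - Re (cexp z a * c).
  apply: (FTC2_is_derive (F := fun t => Re (cexp z t * c)) (f := fun x => Re (cexp z x)) ab).
    move=> t; rewrite (_ : (fun t => _) = (fun t => Re (cexp z t) * Re c - Im (cexp z t) * Im c)); last first.
      by apply/funext => u; rewrite cReM.
    have d1 := is_derive_Re_cexp z t; have d2 := is_derive_Im_cexp z t.
    apply: is_derive_eq.
    have -> : Re (cexp z t) = Re ('i * z * cexp z t * c) by rewrite /c mulrAC mulfV// mul1r.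
    rewrite [in RHS]cReM /GRing.scale /=; ring.
  exact: continuous_Re_cexp.
have e2 : \int[mu]_(x in `[a, b]) Im (cexp z x) = Im (cexp z b * c) - Im (cexp z a * c).
  apply: (FTC2_is_derive (F := fun t => Im (cexp z t * c)) (f := fun x => Im (cexp z x)) ab).
    move=> t; rewrite (_ : (fun t => _) = (fun t => Re (cexp z t) * Im c + Im (cexp z t) * Re c)); last first.
      by apply/funext => u; rewrite cImM.
    have d1 := is_derive_Re_cexp z t; have d2 := is_derive_Im_cexp z t.
    apply: is_derive_eq.
    have -> : Im (cexp z t) = Im ('i * z * cexp z t * c) by rewrite /c mulrAC mulfV// mul1r.
    rewrite [in RHS]cImM /GRing.scale /=; ring.
  exact: continuous_Im_cexp.
by rewrite e1 e2 -/c mulrBl; apply: complex_eqP; rewrite ?cReD ?cImD ?cReN ?cImN.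
Qed.

Lemma cintegral_mkcond (D : set R) f : cintegral D f = CI (fun x => (\1_D x)%:C * f x).
Proof.
rewrite /cintegral !(Rintegral_mkcond mu D); congr (_ +i* _); apply: eq_Rintegral => x _.
- by rewrite cReM /= mul0r subr0 patchE indicE; case: (x \in D); rewrite ?mul1r ?mul0r.
- by rewrite cImM /= mul0r addr0 patchE indicE; case: (x \in D); rewrite ?mul1r ?mul0r.
Qed.

Lemma rinteg_expR_ray (y a : R) : 0 < y -> rinteg (fun t => \1_(`[a, +oo[) t * expR (- (t * y))).
Proof.
move=> y0.
have dF t : is_derive t 1 (fun t : R => - y^-1 * expR (- (t * y))) (expR (- (t * y))).
  by apply: is_derive_eq; rewrite /GRing.scale /=; field; rewrite gt_eqF.
have cF : continuous (fun t : R => - y^-1 * expR (- (t * y))).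
  by move=> t; apply: differentiable_continuous; apply/derivable1_diffP; case: (dF t).
have cf : continuous (fun t : R => expR (- (t * y))).
  move=> t; apply: differentiable_continuous; apply/derivable1_diffP.
  by have : is_derive t 1 (fun t : R => expR (- (t * y))) (- y * expR (- (t * y))); [
    apply: is_derive_eq; rewrite /GRing.scale /=; ring|case].
have E : (\int[mu]_(x in `[a, +oo[) (expR (- (x * y)))%:E = 0%:E - (- y^-1 * expR (- (a * y)))%:E)%E.
  apply: (@ge0_continuous_FTC2y R _ (fun t : R => - y^-1 * expR (- (t * y)))).
  - by move=> x _; exact: expR_ge0.
  - exact: continuous_subspaceT.
  - rewrite -(mulr0 (- y^-1)); apply: cvgM; first exact: cvg_cst.
    have : (x * y) @[x --> +oo] --> +oo by apply: gt0_cvgMly => //; exact: cvg_id.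
    by move=> h; exact: (@cvg_comp _ _ _ (fun x => x * y) (fun x => expR (- x)) _ _ _ h (@cvgr_expR R)).
  - by move=> x _; case: (dF x).
  - by apply: cvg_at_right_filter; exact: cF.
  - by move=> x _; rewrite derive1E; case: (dF x).
apply/integrableP; split.
  apply/measurable_EFinP; apply: measurable_funM; first exact: measurable_indic.
  exact: continuous_measurable_fun.
rewrite (_ : (\int[mu]_x _ = \int[mu]_(x in `[a, +oo[) (expR (- (x * y)))%:E)%E); last first.
  rewrite [RHS]integral_mkcond; apply: eq_integral => t _ /=.
  rewrite ger0_norm ?mulr_ge0 ?expR_ge0// patchE indicE.
  by case: (t \in _); rewrite ?mul1r ?mul0r.
by rewrite E -EFinB ltry.
Qed.

Lemma cinteg_ray z a : 0 < Im z -> cinteg (fun t => (\1_(`[a, +oo[) t)%:C * cexp z t).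
Proof.
move=> z0; apply: (cinteg_dom (g := fun t => \1_(`[a, +oo[) t * expR (- (t * Im z)))).
- apply: cmeasurableM; last exact: cmeasurable_cexp.
  by apply: cmeasurable_real; exact: measurable_indic.
- exact: rinteg_expR_ray.
- by move=> t; rewrite ComplexField.Normc.normcM normc_cexp normc_real ger0_norm.
Qed.

(** Limits are taken coordinatewise, in keeping with [cintegral], so that each one reduces to two
    real limits. *)
Definition ccvg (z_ : nat -> R[i]) z :=
  (Re (z_ n) @[n --> \oo] --> Re z) /\ (Im (z_ n) @[n --> \oo] --> Im z).

Lemma ccvg_unique (z_ : nat -> R[i]) z w : ccvg z_ z -> ccvg z_ w -> z = w.
Proof.
move=> [zr zi] [wr wi]; apply: complex_eqP.
- exact: (cvg_unique _ zr wr).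
- exact: (cvg_unique _ zi wi).
Qed.

Lemma ccvg_cst z : ccvg (fun=> z) z.
Proof. by split; exact: cvg_cst. Qed.

Lemma ccvgD (z_ w_ : nat -> R[i]) z w : ccvg z_ z -> ccvg w_ w -> ccvg (fun n => z_ n + w_ n) (z + w).
Proof.
move=> [zr zi] [wr wi]; split.
- by rewrite cReD; under eq_fun do rewrite cReD; exact: cvgD.
- by rewrite cImD; under eq_fun do rewrite cImD; exact: cvgD.
Qed.

Lemma ccvgM (z_ w_ : nat -> R[i]) z w : ccvg z_ z -> ccvg w_ w -> ccvg (fun n => z_ n * w_ n) (z * w).
Proof.
move=> [zr zi] [wr wi]; split.
- by rewrite cReM; under eq_fun do rewrite cReM; apply: cvgB; exact: cvgM.
- by rewrite cImM; under eq_fun do rewrite cImM; apply: cvgD; exact: cvgM.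
Qed.

Lemma ccvg_real (a_ : R^nat) a : a_ @ \oo --> a -> ccvg (fun n => (a_ n)%:C) a%:C.
Proof. by move=> h; split => //=; exact: cvg_cst. Qed.

Lemma ccvg_normc0 (z_ : nat -> R[i]) : normc (z_ n) @[n --> \oo] --> (0 : R) -> ccvg z_ 0.
Proof.
move=> z0; split; apply/norm_cvg0P; apply: (squeeze_cvgr _ (cvg_cst 0) z0); apply: nearW => n /=.
- by rewrite normr_ge0 normr_Re.
- by rewrite normr_ge0 normr_Im.
Qed.

Lemma CI_dominated (f_ : nat -> R -> R[i]) f (g : R -> R) :
  (forall n, cmeasurable (f_ n)) -> cmeasurable f -> rinteg g ->
  {ae mu, forall x, ccvg (fun n => f_ n x) (f x)} ->
  (forall n x, normc (f_ n x) <= g x) ->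
  ccvg (fun n => CI (f_ n)) (CI f).
Proof.
move=> mf_ mf ig ff fg; split.
- apply: (rinteg_dominated (g := g)) => //.
  + by move=> n; exact: (mf_ n).1.
  + exact: mf.1.
  + by apply: (aeS ff) => x [].
  + by move=> n x; exact: le_trans (normr_Re _) (fg n x).
- apply: (rinteg_dominated (g := g)) => //.
  + by move=> n; exact: (mf_ n).2.
  + exact: mf.2.
  + by apply: (aeS ff) => x [].
  + by move=> n x; exact: le_trans (normr_Im _) (fg n x).
Qed.

Lemma ccvg_near_eq (z_ : nat -> R[i]) z N : (forall n, (N <= n)%N -> z_ n = z) -> ccvg z_ z.
Proof.
move=> zN; split; apply: cvg_near_cst; exists N => // n /= Nn; by rewrite zN.
Qed.

Lemma cvg_expRn (a y : R) : 0 < y -> expR (- ((a + n%:R) * y)) @[n --> \oo] --> (0 : R).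
Proof.
move=> y0.
have h : (((a + n%:R) * y) : R) @[n --> \oo] --> +oo.
  apply/cvgryPge => A; near=> n.
  rewrite -ler_pdivrMr// -lerBlDl; near: n; exact: nbhs_infty_ger.
exact: (@cvg_comp _ _ _ (fun n => (a + n%:R) * y) (fun x => expR (- x)) _ _ _ h (@cvgr_expR R)).
Unshelve. all: by end_near. Qed.

(** The limit of [cexp_int] over the segments [a, a + n]: the upper endpoint contributes exp(iz(a +
    n)), which decays, and the integrals converge by domination. *)
Lemma cexp_ray z a : 0 < Im z ->
  CI (fun t => (\1_(`[a, +oo[) t)%:C * cexp z t) = 'i * cexp z a / z.
Proof.
move=> y0; have z0 : z != 0 by apply: contraTneq y0 => ->; rewrite ltxx.
have iz0 : 'i * z != 0 by rewrite mulf_neq0// eq_complex /= oner_eq0 andbF.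
apply: (@ccvg_unique (fun n => CI (fun t => (\1_(`[a, a + n%:R]) t)%:C * cexp z t))).
  apply: (CI_dominated (g := fun t => \1_(`[a, +oo[) t * expR (- (t * Im z)))).
  - move=> n; apply: cmeasurableM; last exact: cmeasurable_cexp.
    by apply: cmeasurable_real; exact: measurable_indic.
  - by apply: cinteg_meas; exact: cinteg_ray.
  - exact: rinteg_expR_ray.
  - apply: aeW => t; apply: (ccvg_near_eq (N := (Num.truncn (t - a)).+1)) => n tn.
    have tan : t <= a + n%:R.
      by rewrite -lerBlDl; apply: ltW; apply: lt_le_trans (truncnS_gt _) _; rewrite ler_nat.
    by rewrite !indicE !mem_setE !in_itv /= tan.
  - move=> n t; rewrite ComplexField.Normc.normcM normc_cexp normc_real ger0_norm// ler_wpM2r ?expR_ge0//.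
    rewrite !indicE ler_nat; case: (boolP (t \in `[a, a + n%:R]%classic)) => //.
    by rewrite inE /= in_itv /= => /andP[at_ _]; rewrite mem_set//= in_itv/= at_.
rewrite (_ : (fun n => _) = (fun n => (cexp z (a + n%:R) - cexp z a) / ('i * z))); last first.
  by apply/funext => n; rewrite -cintegral_mkcond cexp_int// lerDl.
have -> : 'i * cexp z a / z = (0 - cexp z a) / ('i * z).
  have i2 : 'i * 'i = -1 :> R[i] by rewrite -expr2 sqr_i.
  have i0 : 'i != 0 :> R[i] by rewrite eq_complex /= oner_eq0 andbF.
  have iV : 'i^-1 = - 'i :> R[i] by apply: (mulfI i0); rewrite mulfV// mulrN i2 opprK.
  by rewrite sub0r invfM iV; ring.
apply: ccvgM; last exact: ccvg_cst.
apply: ccvgD; last exact: ccvg_cst.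
by apply: ccvg_normc0; under eq_fun do rewrite normc_cexp; exact: cvg_expRn.
Qed.

Lemma integral_opp_ray (G : R -> R) a : continuous G -> (forall x, 0 <= G x) ->
  (\int[mu]_(x in `]-oo, a]) (G x)%:E = \int[mu]_(x in `[(- a)%R, +oo[) (G (- x))%:E)%E.
Proof.
move=> cG G0; have := @ge0_integration_by_substitutionNy R G (- a).
rewrite opprK; apply; first exact: continuous_subspaceT.
by move=> x _; exact: G0.
Qed.

Lemma rinteg_expR_rayN (y a : R) : y < 0 -> rinteg (fun t => \1_(`]-oo, a]) t * expR (- (t * y))).
Proof.
move=> y0.
have cf : continuous (fun t : R => expR (- (t * y))).
  move=> t; apply: differentiable_continuous; apply/derivable1_diffP.
  by have : is_derive t 1 (fun t : R => expR (- (t * y))) (- y * expR (- (t * y))); [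
    apply: is_derive_eq; rewrite /GRing.scale /=; ring|case].
have Ny0 : 0 < - y by rewrite oppr_gt0.
have /integrableP[_] := rinteg_expR_ray (- a) Ny0.
rewrite (_ : (\int[mu]_x _ = \int[mu]_(x in `[(- a)%R, +oo[) (expR (- (- x * y)))%:E)%E); last first.
  rewrite [RHS]integral_mkcond; apply: eq_integral => t _ /=.
  rewrite ger0_norm ?mulr_ge0 ?expR_ge0// patchE indicE mulrN mulNr.
  by case: (t \in _); rewrite ?mul1r ?mul0r.
rewrite -(integral_opp_ray (G := fun t => expR (- (t * y))))//.
move=> foo; apply/integrableP; split.
  apply/measurable_EFinP; apply: measurable_funM; first exact: measurable_indic.
  exact: continuous_measurable_fun.
rewrite (_ : (\int[mu]_x _ = \int[mu]_(x in `]-oo, a]) (expR (- (x * y)))%:E)%E)//.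
rewrite [RHS]integral_mkcond; apply: eq_integral => t _ /=.
rewrite ger0_norm ?mulr_ge0 ?expR_ge0// patchE indicE.
by case: (t \in _); rewrite ?mul1r ?mul0r.
Qed.

Lemma cinteg_rayN z a : Im z < 0 -> cinteg (fun t => (\1_(`]-oo, a]) t)%:C * cexp z t).
Proof.
move=> z0; apply: (cinteg_dom (g := fun t => \1_(`]-oo, a]) t * expR (- (t * Im z)))).
- apply: cmeasurableM; last exact: cmeasurable_cexp.
  by apply: cmeasurable_real; exact: measurable_indic.
- exact: rinteg_expR_rayN.
- by move=> t; rewrite ComplexField.Normc.normcM normc_cexp normc_real ger0_norm.
Qed.

Lemma cexp_rayN z a : Im z < 0 ->
  CI (fun t => (\1_(`]-oo, a]) t)%:C * cexp z t) = - 'i * cexp z a / z.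
Proof.
move=> y0; have z0 : z != 0 by apply: contraTneq y0 => ->; rewrite ltxx.
have iz0 : 'i * z != 0 by rewrite mulf_neq0// eq_complex /= oner_eq0 andbF.
apply: (@ccvg_unique (fun n => CI (fun t => (\1_(`[a - n%:R, a]) t)%:C * cexp z t))).
  apply: (CI_dominated (g := fun t => \1_(`]-oo, a]) t * expR (- (t * Im z)))).
  - move=> n; apply: cmeasurableM; last exact: cmeasurable_cexp.
    by apply: cmeasurable_real; exact: measurable_indic.
  - by apply: cinteg_meas; exact: cinteg_rayN.
  - exact: rinteg_expR_rayN.
  - apply: aeW => t; apply: (ccvg_near_eq (N := (Num.truncn (a - t)).+1)) => n tn.
    have tan : a - n%:R <= t.
      by rewrite lerBlDl -lerBlDr; apply: ltW; apply: lt_le_trans (truncnS_gt _) _; rewrite ler_nat.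
    by rewrite !indicE !mem_setE !in_itv /= tan.
  - move=> n t; rewrite ComplexField.Normc.normcM normc_cexp normc_real ger0_norm// ler_wpM2r ?expR_ge0//.
    rewrite !indicE ler_nat; case: (boolP (t \in `[a - n%:R, a]%classic)) => //.
    by rewrite inE /= in_itv /= => /andP[_ at_]; rewrite mem_set//= in_itv/= at_.
rewrite (_ : (fun n => _) = (fun n => (cexp z a - cexp z (a - n%:R)) / ('i * z))); last first.
  by apply/funext => n; rewrite -cintegral_mkcond cexp_int// lerBlDl lerDr.
have -> : - 'i * cexp z a / z = (cexp z a + 0) / ('i * z).
  have i2 : 'i * 'i = -1 :> R[i] by rewrite -expr2 sqr_i.
  have i0 : 'i != 0 :> R[i] by rewrite eq_complex /= oner_eq0 andbF.
  have iV : 'i^-1 = - 'i :> R[i] by apply: (mulfI i0); rewrite mulfV// mulrN i2 opprK.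
  by rewrite addr0 invfM iV; ring.
apply: ccvgM; last exact: ccvg_cst.
apply: ccvgD; first exact: ccvg_cst.
apply: ccvg_normc0; under eq_fun do rewrite normcN normc_cexp.
have Ny0 : 0 < - Im z by rewrite oppr_gt0.
have := cvg_expRn (- a) Ny0.
by under eq_fun do rewrite mulrN -mulNr opprD opprK.
Qed.

(** * Resolvents and their square integrability *)

Definition resolvent w x : R[i] := (x%:C + w)^-1.

Lemma resolvent_denom w x : Im w != 0 -> x%:C + w != 0.
Proof. by case: w => a b /= b0; rewrite eq_complex /= add0r (negbTE b0) andbF. Qed.

Lemma resolvent_neq0 w x : Im w != 0 -> resolvent w x != 0.
Proof. by move=> w0; rewrite invr_eq0 resolvent_denom. Qed.

Lemma resolvent_conj w x : conjc (resolvent w x) = resolvent (conjc w) x.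
Proof. by rewrite /resolvent conjc_inv conjcD conjc_real. Qed.

Lemma sqnV z : sqn z^-1 = (sqn z)^-1.
Proof. by rewrite -sqr_normcE ComplexField.Normc.normcV exprVn sqr_normcE. Qed.

Lemma sqn_resolvent w x : sqn (resolvent w x) = ((x + Re w) ^+ 2 + Im w ^+ 2)^-1.
Proof. by rewrite /resolvent sqnV; case: w => a b; rewrite /sqn /= add0r. Qed.

Lemma sqn_resolvent_le w x : Im w != 0 -> sqn (resolvent w x) <= (Im w ^+ 2)^-1.
Proof.
move=> w0; have b0 : 0 < Im w ^+ 2 by rewrite exprn_even_gt0.
by rewrite sqn_resolvent lef_pV2 ?posrE ?ltr_wpDl ?sqr_ge0// lerDr sqr_ge0.
Qed.

Lemma normc_resolvent_le w x : Im w != 0 -> normc (resolvent w x) <= `|Im w|^-1.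
Proof.
move=> w0; rewrite -(@ler_pXn2r _ 2)// ?nnegrE ?normc_ge0 ?invr_ge0//.
by rewrite sqr_normcE exprVn real_normK ?num_real// sqn_resolvent_le.
Qed.

(** Measurability concerns real and imaginary parts, so the inverse is rewritten as conj(x + w)
    times a continuous real function. *)
Lemma cmeasurable_resolvent w : Im w != 0 -> cmeasurable (resolvent w).
Proof.
move=> w0; have E x : resolvent w x = conjc (x%:C + w) * (sqn (resolvent w x))%:C.
  have D0 := resolvent_denom x w0; have sD0 : sqn (x%:C + w) != 0 by rewrite sqn_eq0.
  rewrite {2}/resolvent sqnV fmorphV /= -mulJ_sqn invfM mulrCA mulfV ?mulr1//.
  by rewrite conjc_eq0.
have -> : resolvent w = (fun x => conjc (x%:C + w) * (sqn (resolvent w x))%:C) by apply/funext => x; exact: E.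
apply: cmeasurableM.
  apply: cmeasurable_conj; apply: cmeasurableD; last exact: cmeasurable_cst.
  by apply: cmeasurable_real.
apply: cmeasurable_real; under eq_fun do rewrite sqn_resolvent.
apply: continuous_measurable_fun => x; apply: cvgV.
  by rewrite gt_eqF// ltr_wpDl ?sqr_ge0// exprn_even_gt0.
apply: cvgD; last exact: cvg_cst.
by rewrite expr2; under eq_fun do rewrite expr2; apply: cvgM; (apply: cvgD; [exact: cvg_id|exact: cvg_cst]).
Qed.

Lemma integral_le_lim (f_ : nat -> R -> R) (f : R -> R) (C : R) :
  (forall n, measurable_fun setT (f_ n)) -> (forall n x, 0 <= f_ n x) ->
  (forall x, f_ n x @[n --> \oo] --> f x) ->
  (forall n, (\int[mu]_x (f_ n x)%:E <= C%:E)%E) ->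
  (\int[mu]_x (f x)%:E <= C%:E)%E.
Proof.
move=> mf f0 ff fC.
have -> : (\int[mu]_x (f x)%:E = \int[mu]_x limn_einf (fun n : nat => (f_ n x)%:E))%E.
  apply: eq_integral => x _; apply/esym.
  have cv : (fun n : nat => (f_ n x)%:E) @ \oo --> (f x)%:E.
    by apply: cvg_EFin; [exact: nearW|exact: ff].
  by rewrite (cvg_limn_einf_sup cv).1.
apply: le_trans (fatou _ _ _ _) _ => //.
- by move=> n; apply/measurable_EFinP; exact: mf.
- by move=> n x _; rewrite lee_fin.
by apply: (ge0_le_limn_einf (N := 0%N)) => n _; exact: fC.
Qed.

Lemma integral_le_exhaustion (f : R -> R) (C : R) : measurable_fun setT f ->
  (forall x, 0 <= f x) ->
  (forall n : nat, (\int[mu]_(x in `[(- n%:R)%R, (n%:R)%R]) (f x)%:E <= C%:E)%E) ->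
  (\int[mu]_x (f x)%:E <= C%:E)%E.
Proof.
move=> mf f0 fC.
apply: (@integral_le_lim (fun n x => \1_(`[- n%:R, n%:R]) x * f x)).
- by move=> n; apply: measurable_funM => //; exact: measurable_indic.
- by move=> n x; rewrite mulr_ge0.
- move=> x; apply: cvg_near_cst; exists (Num.truncn `|x|).+1 => // n /= xn.
  have xn' : `|x| <= n%:R by apply: ltW; apply: lt_le_trans (truncnS_gt _) _; rewrite ler_nat.
  by rewrite indicE mem_setE in_itv /= -ler_norml xn' mul1r.
move=> n; apply: le_trans (fC n); rewrite [leRHS]integral_mkcond le_eqVlt; apply/orP; left; apply/eqP.
apply: eq_integral => x _ /=; rewrite patchE indicE.
by case: (x \in _); rewrite ?mul1r ?mul0r.
Qed.

Lemma is_derive_atan_scaled (a y x : R) : 0 < y ->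
  is_derive x 1 (fun x => atan ((x + a) / y)) (y * ((x + a) ^+ 2 + y ^+ 2)^-1).
Proof.
move=> y0; apply: is_derive_eq; rewrite /GRing.scale /=; field.
by rewrite !gt_eqF// ltr_wpDl ?sqr_ge0// exprn_gt0.
Qed.

Lemma continuous_sqn_resolvent w : Im w != 0 -> continuous (fun x => ((x + Re w) ^+ 2 + Im w ^+ 2)^-1).
Proof.
move=> w0 x; apply: cvgV.
  by rewrite gt_eqF// ltr_wpDl ?sqr_ge0// exprn_even_gt0.
apply: cvgD; last exact: cvg_cst.
by rewrite expr2; under eq_fun do rewrite expr2; apply: cvgM; (apply: cvgD; [exact: cvg_id|exact: cvg_cst]).
Qed.

(** The function arctan((x + Re w) / Im w) is a primitive of Im w |u(x)|^2 and its range has length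
    pi. *)
Lemma integral_sqn_resolvent_le w : 0 < Im w ->
  (\int[mu]_x (sqn (resolvent w x))%:E <= (pi / Im w)%:E)%E.
Proof.
move=> y0; have w0 : Im w != 0 by rewrite gt_eqF.
apply: integral_le_exhaustion.
- by apply: measurable_sqn; exact: cmeasurable_resolvent.
- by move=> x; exact: sqn_ge0.
move=> n.
have cf : continuous (fun x => Im w * ((x + Re w) ^+ 2 + Im w ^+ 2)^-1).
  by move=> x; apply: cvgM; [exact: cvg_cst|exact: continuous_sqn_resolvent].
have nn : - n%:R <= n%:R :> R by rewrite lerNl (le_trans _ (ler0n _ _))// oppr_le0.
have := FTC2_is_derive nn (fun x => is_derive_atan_scaled (Re w) x y0) cf.
have ic : mu.-integrable `[(- n%:R : R), n%:R] (EFin \o (fun x => Im w * ((x + Re w) ^+ 2 + Im w ^+ 2)^-1)).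
  by apply: continuous_compact_integrable; [exact: segment_compact|exact: continuous_subspaceT].
move=> E.
have -> : (\int[mu]_(x in `[(- n%:R)%R, (n%:R)%R]) (sqn (resolvent w x))%:E = 
  ((Im w)^-1 * (\int[mu]_(x in `[(- n%:R)%R, (n%:R)%R]) (Im w * ((x + Re w) ^+ 2 + Im w ^+ 2)^-1))%R)%:E)%E.
  rewrite EFinM /Rintegral fineK; last exact: integrable_fin_num.
  rewrite -ge0_integralZl//; last 3 first.
  - by move: ic => /measurable_int.
  - move=> x _; rewrite lee_fin; apply: mulr_ge0; [exact: ltW|by rewrite invr_ge0 addr_ge0 ?sqr_ge0].
  - by rewrite lee_fin invr_ge0 ltW.
  by apply: eq_integral => x _; rewrite -EFinM mulKf// sqn_resolvent.
rewrite lee_fin E mulrC ler_pM2r ?invr_gt0//.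
have := atan_ltpi2 ((n%:R + Re w) / Im w); have := atan_gtNpi2 ((- n%:R + Re w) / Im w).
lra.
Qed.

Lemma L2_resolvent w : Im w != 0 -> L2 (resolvent w).
Proof.
have H v : 0 < Im v -> L2 (resolvent v).
  move=> y0; have v0 : Im v != 0 by rewrite gt_eqF.
  apply/L2P; split; first exact: cmeasurable_resolvent.
  apply/integrableP; split.
    by apply/measurable_EFinP; apply: measurable_sqn; exact: cmeasurable_resolvent.
  under eq_integral do rewrite /= ger0_norm ?sqn_ge0//.
  by apply: le_lt_trans (integral_sqn_resolvent_le y0) _; rewrite ltry.
rewrite neq_lt => /orP[w0|]; last exact: H.
have := L2_conj (H (conjc w) _); rewrite cImJ oppr_gt0 => /(_ w0).
by under eq_fun do rewrite resolvent_conj conjcK.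
Qed.

End Exponentials.

(** * Uniqueness of the Fourier transform *)

Section Uniqueness.
Context {R : realType}.
Implicit Types (f g h r p : R -> R[i]) (z w : R[i]) (a b x t s l : R).

Lemma measurable_expi_prod21 :
  measurable_fun setT (fun q : R * R => Re (expi (q.2 * q.1))) /\
  measurable_fun setT (fun q : R * R => Im (expi (q.2 * q.1))).
Proof.
have m : measurable_fun setT (fun q : R * R => q.2 * q.1).
  by apply: measurable_funM; [exact: measurable_snd|exact: measurable_fst].
split => /=; apply: measurableT_comp m; apply: continuous_measurable_fun.
- exact: continuous_cos.
- exact: continuous_sin.
Qed.

Lemma normc_expi_le1 x : normc (expi x) <= 1.
Proof. by rewrite normc_expi. Qed.

Lemma cinteg_expi r a : cinteg r -> cinteg (fun x => r x * expi (a * x)).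
Proof.
move=> ir; apply: (@cinteg_mulb _ _ _ 1) => //; last by move=> x; exact: normc_expi_le1.
by apply: cmeasurable_expi; exact: measurable_funM.
Qed.

Lemma cinteg_resolvent r w : cinteg r -> Im w != 0 -> cinteg (fun x => r x * resolvent w x).
Proof.
move=> ir w0; apply: (@cinteg_mulb _ _ _ (`|Im w|^-1)) => //; first exact: cmeasurable_resolvent.
by move=> x; exact: normc_resolvent_le.
Qed.

Lemma fubini_expi (A B : R -> R[i]) : cinteg A -> cinteg B ->
  CI (fun x => A x * CI (fun t => B t * expi (t * x))) =
  CI (fun t => B t * CI (fun x => A x * expi (t * x))).
Proof.
move=> iA iB.
exact: (@cfubini _ A B (fun q => expi (q.2 * q.1)) 1 iA iB measurable_expi_prod21.1
  measurable_expi_prod21.2 (fun q => normc_expi_le1 _)).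
Qed.

(** The substitute for contour integration: exp(ilx) u(x) is, up to a constant, an average of the
    exponentials exp(itx) over t >= l, with the weight exp(itw) that is integrable there because Im
    w > 0. *)
Lemma ray_transform w l x : 0 < Im w ->
  CI (fun t => (\1_(`[l, +oo[) t)%:C * cexp w t * expi (t * x)) =
  'i * cexp w l * (expi (l * x) * resolvent w x).
Proof.
move=> w0; have wx0 : 0 < Im (x%:C + w) by rewrite cImD /= add0r.
have := cexp_ray l wx0; rewrite cexpD cexp_real /resolvent.
under eq_fun do rewrite cexpD cexp_real (mulrC (expi _)) mulrA.
by move=> ->; ring.
Qed.

Lemma rayN_transform w l x : Im w < 0 ->
  CI (fun t => (\1_(`]-oo, l]) t)%:C * cexp w t * expi (t * x)) =
  - 'i * cexp w l * (expi (l * x) * resolvent w x).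
Proof.
move=> w0; have wx0 : Im (x%:C + w) < 0 by rewrite cImD /= add0r.
have := cexp_rayN l wx0; rewrite cexpD cexp_real /resolvent.
under eq_fun do rewrite cexpD cexp_real (mulrC (expi _)) mulrA.
by move=> ->; ring.
Qed.

(** On a finite segment the weight is integrable for a pole in either half-plane; the price is the
    endpoint term [resolvent w x]. *)
Lemma segment_transform w l x : Im w != 0 -> 0 <= l ->
  CI (fun t => (\1_(`[0, l]) t)%:C * cexp w t * expi (t * x)) =
  'i^-1 * (cexp w l * (expi (l * x) * resolvent w x) - resolvent w x).
Proof.
move=> w0 l0; have := cexp_int (resolvent_denom x w0) l0.
rewrite cintegral_mkcond cexp0 cexpD cexp_real /resolvent invfM.
under eq_fun do rewrite cexpD cexp_real (mulrC (expi _)) mulrA.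
by move=> ->; ring.
Qed.

Lemma im_neq0 : 'i != 0 :> R[i].
Proof. by rewrite eq_complex /= oner_eq0 andbF. Qed.

(** Multiplying r by u replaces its transform at l by an average over the frequencies above l, all
    of which are nonnegative. *)
Lemma CI_expi_resolvent_eq0 r w : cinteg r -> 0 < Im w ->
  (forall l, 0 <= l -> CI (fun x => r x * expi (l * x)) = 0) ->
  forall l, 0 <= l -> CI (fun x => r x * (expi (l * x) * resolvent w x)) = 0.
Proof.
move=> ir w0 r0 l l0.
have := fubini_expi ir (cinteg_ray l w0).
under eq_fun do rewrite ray_transform// mulrCA.
rewrite CIZ; last first.
  under eq_fun do rewrite mulrA; apply: cinteg_resolvent; last by rewrite gt_eqF.
  exact: cinteg_expi.
rewrite [RHS](_ : _ = 0); last first.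
  rewrite -(CI0 (R := R)); congr CI; apply/funext => t; rewrite indicE mem_setE in_itv /= andbT.
  have [lt_|_] := leP l t; last by rewrite !mul0r.
  by rewrite r0 ?mulr0// (le_trans l0).
by move/eqP; rewrite mulf_eq0 mulf_eq0 (negbTE im_neq0) (negbTE (cexp_neq0 _ _)) /= => /eqP.
Qed.

Lemma cinteg_segment w l : cinteg (fun t => (\1_(`[0, l]) t)%:C * cexp w t).
Proof.
have mC : cmeasurable (fun t => (\1_(`[0, l]) t)%:C * cexp w t).
  apply: cmeasurableM; last exact: cmeasurable_cexp.
  by apply: cmeasurable_real; exact: measurable_indic.
split.
- rewrite /rinteg (_ : _ \o _ = (EFin \o (fun t => Re (cexp w t))) \_ `[0, l]); last first.
    apply/funext => t; rewrite patchE /comp Re_realM indicE.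
    by case: (t \in _); rewrite ?mul1r ?mul0r.
  refine (proj1 (integrable_mkcond _ _) _); first exact: measurable_itv.
  apply: continuous_compact_integrable; first exact: segment_compact.
  by apply: continuous_subspaceT; exact: continuous_Re_cexp.
- rewrite /rinteg (_ : _ \o _ = (EFin \o (fun t => Im (cexp w t))) \_ `[0, l]); last first.
    apply/funext => t; rewrite patchE /comp Im_realM indicE.
    by case: (t \in _); rewrite ?mul1r ?mul0r.
  refine (proj1 (integrable_mkcond _ _) _); first exact: measurable_itv.
  apply: continuous_compact_integrable; first exact: segment_compact.
  by apply: continuous_subspaceT; exact: continuous_Im_cexp.
Qed.

(** Here the average runs over the frequencies between 0 and l; the endpoint term it leaves is the
    mean of r times the resolvent, which is assumed to vanish. This is the version that serves for a
    pole in the lower half-plane. *)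
Lemma CI_expi_resolvent_eq0_of0 r w : cinteg r -> Im w != 0 ->
  (forall l, 0 <= l -> CI (fun x => r x * expi (l * x)) = 0) ->
  CI (fun x => r x * resolvent w x) = 0 ->
  forall l, 0 <= l -> CI (fun x => r x * (expi (l * x) * resolvent w x)) = 0.
Proof.
move=> ir w0 r0 ru0 l l0.
have iru := cinteg_resolvent ir w0.
have ireu : cinteg (fun x => r x * (expi (l * x) * resolvent w x)).
  under eq_fun do rewrite mulrA; apply: cinteg_resolvent => //; exact: cinteg_expi.
have := fubini_expi ir (cinteg_segment w l).
under eq_fun do rewrite segment_transform// mulrCA mulrBr (mulrCA _ (cexp w l)).
rewrite CIZ; last by apply: cintegB => //; exact: cintegZ.
rewrite CIB//; last exact: cintegZ.
rewrite CIZ// ru0 subr0 [RHS](_ : _ = 0); last first.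
  rewrite -(CI0 (R := R)); congr CI; apply/funext => t; rewrite indicE mem_setE in_itv /=.
  have [lt_|_] := leP 0 t; last by rewrite !mul0r.
  by rewrite r0 ?mulr0.
by move/eqP; rewrite mulf_eq0 invr_eq0 (negbTE im_neq0) /= mulf_eq0 (negbTE (cexp_neq0 _ _)) /= => /eqP.
Qed.

(** The factor 2 comes from bounding the real and imaginary parts separately. *)
Lemma normc_CI_le f (g : R -> R) : cmeasurable f -> rinteg g -> (forall x, normc (f x) <= g x) ->
  normc (CI f) <= 2 * \int[mu]_x g x.
Proof.
move=> mf ig fg; have [fr fi] := cinteg_dom mf ig fg.
apply: le_trans (normc_le_ReIm _) _; rewrite mulrDl mul1r; apply: lerD.
- apply: le_trans (le_normr_Rintegral _ fr) _ => //; apply: le_Rintegral => //.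
    exact: rinteg_norm.
  by move=> x _; exact: le_trans (normr_Re _) (fg x).
- apply: le_trans (le_normr_Rintegral _ fi) _ => //; apply: le_Rintegral => //.
    exact: rinteg_norm.
  by move=> x _; exact: le_trans (normr_Im _) (fg x).
Qed.

(** * Functions with vanishing interval or Poisson integrals *)

Lemma ae_neq a : {ae mu, forall x : R, x != a}.
Proof.
exists [set a]; split => //; first exact: lebesgue_measure_set1.
by move=> x /= /negP; rewrite negbK => /eqP.
Qed.

(** The primitive of f based at -n vanishes identically, so Lebesgue's differentiation theorem gives
    f = 0 almost everywhere beyond -n; countably many n cover the line. *)
Lemma interval_integrals_eq0 (f : R -> R) : rinteg f ->
  (forall a b, a < b -> \int[mu]_(x in `[a, b]) f x = 0) ->
  {ae mu, forall x, f x = 0}.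
Proof.
move=> intf f0.
have F0 (n : nat) : {ae mu, forall x, - n%:R < x -> f x = 0}.
  have intn y : mu.-integrable [set` Interval (BLeft (- n%:R)) (BRight y)] (EFin \o f).
    by apply: integrableS intf.
  have locf : locally_integrable [set: R] f.
    have := integrable_locally measurableT intf.
    by rewrite (_ : f \_ setT = f)//; apply/funext => x; rewrite patchE in_setT.
  apply: (aeS (FTC1 intn locf)) => x h nx.
  have [_ <-] := h nx.
  rewrite derive1E.
  have -> : (fun x : R => \int[mu]_(t in [set` Interval (BLeft (- n%:R)) (BRight x)]) f t) = (fun=> 0).
    apply/funext => y; have [yn|yn|->] := ltgtP y (- n%:R).
    - by rewrite set_itv_ge ?Rintegral_set0// bnd_simp -ltNge.
    - exact: f0.
    - by rewrite set_itv1 Rintegral_set1.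
  exact: derive_cst.
have := ae_foralln F0.
move=> h; apply: (aeS h) => x hx.
apply: (hx (Num.truncn `|x|).+1).
rewrite ltrNl; apply: le_lt_trans (truncnS_gt _); rewrite -normrN; exact: ler_norm.
Qed.

Lemma cinterval_integrals_eq0 f : cinteg f ->
  (forall a b, a < b -> CI (fun x => (\1_(`[a, b]) x)%:C * f x) = 0) ->
  {ae mu, forall x, f x = 0}.
Proof.
move=> [fr fi] f0; apply: (@aeS2 _ (fun x => Re (f x) = 0) (fun x => Im (f x) = 0)).
- apply: interval_integrals_eq0 => // a b ab.
  by have := f0 a b ab; rewrite -cintegral_mkcond => /(congr1 (@complex.Re R)).
- apply: interval_integrals_eq0 => // a b ab.
  by have := f0 a b ab; rewrite -cintegral_mkcond => /(congr1 (@complex.Im R)).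
- by move=> x fr0 fi0; apply: complex_eqP; rewrite ?fr0 ?fi0.
Qed.

(** At w = -t + iy the function y |u|^2 is a Poisson kernel centred at t. Integrating the centre
    over [a, b] and exchanging the integrals produces the arctangents. *)
Lemma CI_poisson_segment r a b y : cinteg r -> 0 < y -> a <= b ->
  (forall w, 0 < Im w -> CI (fun x => r x * (sqn (resolvent w x))%:C) = 0) ->
  CI (fun x => r x * (atan ((b - x) / y) - atan ((a - x) / y))%:C) = 0.
Proof.
move=> ir y0 ab r0.
pose k (q : R * R) : R := y * ((q.2 - q.1) ^+ 2 + y ^+ 2)^-1.
have cy : continuous (fun s : R => y * (s ^+ 2 + y ^+ 2)^-1).
  move=> s; apply: cvgM; first exact: cvg_cst.
  have E : (fun x => ((x + Re (0 +i* y)) ^+ 2 + Im (0 +i* y) ^+ 2)^-1) = (fun x => (x ^+ 2 + y ^+ 2)^-1).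
    by apply/funext => x /=; rewrite addr0.
  by have := @continuous_sqn_resolvent _ (0 +i* y); rewrite E /= gt_eqF// => /(_ isT s).
have mk : measurable_fun setT k.
  apply: (measurableT_comp (continuous_measurable_fun cy)).
  by apply: measurable_funB; [exact: measurable_snd|exact: measurable_fst].
have k0 q : 0 <= k q.
  by apply: mulr_ge0; [exact: ltW|rewrite invr_ge0 addr_ge0 ?sqr_ge0].
have kle q : normc (k q)%:C <= y^-1.
  rewrite normc_real ger0_norm// /k ler_pdivrMr ?ltr_wpDl ?sqr_ge0 ?exprn_gt0//.
  by rewrite mulrDr expr2 mulKf ?gt_eqF// lerDr mulr_ge0 ?sqr_ge0// invr_ge0 ltW.
have i1 : cinteg (fun t : R => (\1_(`[a, b]) t)%:C).
  apply: cinteg_real; apply: integrable_indic_itv.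
have := @cfubini _ r (fun t => (\1_(`[a, b]) t)%:C) (fun q => (k q)%:C) y^-1 ir i1 mk
  (measurable_cst _) kle.
rewrite [X in _ = X -> _](_ : _ = 0); last first.
  rewrite -(CI0 (R := R)); congr CI; apply/funext => t.
  have := r0 ((- t) +i* y) y0.
  under eq_fun do rewrite sqn_resolvent /=.
  move=> E; rewrite [X in _ * X](_ : _ = 0) ?mulr0//.
  rewrite -[RHS](mulr0 y%:C) -E -CIZ.
    congr CI; apply/funext => x; rewrite /k /= mulrCA -rmorphM/= -(sqrrN (x - t)) opprB//.
  apply: (@cinteg_mulb _ _ _ (y ^+ 2)^-1) => //.
    apply: cmeasurable_real; apply: continuous_measurable_fun.
    by apply: (@continuous_sqn_resolvent _ ((- t) +i* y)); rewrite gt_eqF.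
  move=> x; have h : ((x - t) ^+ 2 + y ^+ 2)^-1 <= (y ^+ 2)^-1.
    by have := @sqn_resolvent_le _ ((- t) +i* y) x; rewrite sqn_resolvent /= gt_eqF//; apply.
  by rewrite normc_real ger0_norm// invr_ge0 addr_ge0 ?sqr_ge0.
move=> <-; congr CI; apply/funext => x; congr (_ * _).
have cf : continuous (fun t => y * ((t + (- x)) ^+ 2 + y ^+ 2)^-1).
  move=> t; apply: cvgM; first exact: cvg_cst.
  by apply: (@continuous_sqn_resolvent _ ((- x) +i* y)); rewrite gt_eqF.
have := FTC2_is_derive ab (fun t => is_derive_atan_scaled (- x) t y0) cf => <-.
rewrite -cintegral_mkcond /cintegral /=; apply: complex_eqP => //=.
by rewrite /Rintegral integral0.
Qed.

Lemma cvg_atan_sg (c : R) : atan (c * n.+1%:R) @[n --> \oo] --> pi / 2 * Num.sg c.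
Proof.
have H (d : R) : 0 < d -> atan (d * n.+1%:R) @[n --> \oo] --> pi / 2.
  move=> d0.
  have h : (d * n.+1%:R : R) @[n --> \oo] --> +oo.
    apply/cvgryPge => A; near=> n.
    rewrite -ler_pdivrMl//; apply: (@le_trans _ _ n%:R); last by rewrite ler_nat.
    near: n; exact: nbhs_infty_ger.
  exact: (@cvg_comp _ _ _ (fun n => d * n.+1%:R) (@atan R) _ _ _ h (@cvgy_atan R)).
have [c0|c0|->] := ltgtP c 0.
- rewrite ltr0_sg// mulrN1.
  have c0' : 0 < - c by rewrite oppr_gt0.
  rewrite (_ : (fun n => _) = (fun n => - atan (- c * n.+1%:R))); first exact: cvgN (H _ c0').
  by apply/funext => n; rewrite mulNr atanN opprK.
- by rewrite gtr0_sg// mulr1; exact: H.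
- by rewrite sgr0 mulr0; under eq_fun do rewrite mul0r atan0; exact: cvg_cst.
Unshelve. all: by end_near. Qed.

(** As y tends to 0 along 1/(n+1), the arctangent differences tend boundedly to pi times the
    indicator of [a, b] away from the endpoints, so r has vanishing integrals over intervals. *)
Lemma poisson_unique r : cinteg r ->
  (forall w, 0 < Im w -> CI (fun x => r x * (sqn (resolvent w x))%:C) = 0) ->
  {ae mu, forall x, r x = 0}.
Proof.
move=> ir r0; apply: cinterval_integrals_eq0 => // a b ab.
pose L (x : R) : R := pi / 2 * Num.sg (b - x) - pi / 2 * Num.sg (a - x).
pose K (n : nat) (x : R) : R := atan ((b - x) * n.+1%:R) - atan ((a - x) * n.+1%:R).
have mat (c : R) (n : nat) : measurable_fun setT (fun x : R => atan ((c - x) * n.+1%:R)).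
  apply: continuous_measurable_fun => x.
  apply: (@continuous_comp _ _ _ (fun x => (c - x) * n.+1%:R) (@atan R)); last exact: continuous_atan.
  by apply: cvgM; [apply: cvgB; [exact: cvg_cst|exact: cvg_id]|exact: cvg_cst].
have msg (c : R) : measurable_fun setT (fun x : R => pi / 2 * Num.sg (c - x)).
  apply: measurable_funM; first exact: measurable_cst.
  rewrite (_ : (fun x => _) = (fun x => \1_(`]-oo, c[) x - \1_(`]c, +oo[) x)).
    by apply: measurable_funB; exact: measurable_indic.
  apply/funext => x; rewrite !indicE !mem_setE !in_itv /= andbT.
  have [xc|xc|->] := ltgtP x c; last by rewrite subrr sgr0 subrr.
  - by rewrite gtr0_sg ?subr_gt0// subr0.
  - by rewrite ltr0_sg ?subr_lt0// sub0r.
have mK n : measurable_fun setT (K n) by apply: measurable_funB; exact: mat.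
have mL : measurable_fun setT L by apply: measurable_funB; exact: msg.
have Kpi n x : `|K n x| <= pi.
  have := atan_ltpi2 ((b - x) * n.+1%:R); have := atan_gtNpi2 ((b - x) * n.+1%:R).
  have := atan_ltpi2 ((a - x) * n.+1%:R); have := atan_gtNpi2 ((a - x) * n.+1%:R).
  by rewrite ler_norml /K; move=> *; apply/andP; split; lra.
have cv : ccvg (fun n => CI (fun x => r x * (K n x)%:C)) (CI (fun x => r x * (L x)%:C)).
  apply: (CI_dominated (g := fun x => pi * normc (r x))).
  - by move=> n; apply: cmeasurableM; [exact: cinteg_meas|exact: cmeasurable_real].
  - by apply: cmeasurableM; [exact: cinteg_meas|exact: cmeasurable_real].
  - by apply: rintegZ; exact: cinteg_norm.
  - apply: aeW => x; apply: ccvgM; first exact: ccvg_cst.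
    by apply: ccvg_real; apply: cvgB; exact: cvg_atan_sg.
  - by move=> n x; rewrite ComplexField.Normc.normcM normc_real mulrC ler_wpM2r ?normc_ge0.
have L0 : CI (fun x => r x * (L x)%:C) = 0.
  apply: ccvg_unique cv _.
  rewrite (_ : (fun n => _) = (fun=> 0)); first exact: ccvg_cst.
  apply/funext => n; have n0 : 0 < n.+1%:R^-1 :> R by rewrite invr_gt0.
  by have := CI_poisson_segment ir n0 (ltW ab) r0; rewrite invrK.
have pi0 : (pi : R)%:C != 0 by rewrite eq_complex /= gt_eqF ?pi_gt0.
have E : CI (fun x => r x * (L x)%:C) = pi%:C * CI (fun x => (\1_(`[a, b]) x)%:C * r x).
  rewrite -CIZ; last first.
    under eq_fun do rewrite mulrC; apply: (@cinteg_mulb _ _ _ 1) => //.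
      by apply: cmeasurable_real; exact: measurable_indic.
    by move=> x; rewrite normc_real ger0_norm// indicE; case: (_ \in _).
  apply: CI_ae.
  - by apply: cmeasurableM; [exact: cinteg_meas|exact: cmeasurable_real].
  - apply: cmeasurableM; first exact: cmeasurable_cst.
    apply: cmeasurableM; last exact: cinteg_meas.
    by apply: cmeasurable_real; exact: measurable_indic.
  apply: (aeS2 (ae_neq a) (ae_neq b)) => x xa xb.
  rewrite (mulrC (r x)) mulrA; congr (_ * _); rewrite -rmorphM; congr (_%:C).
  rewrite /L indicE mem_setE in_itv /=.
  have [xa'|xa'|xa'] := ltgtP x a; last by rewrite xa' eqxx in xa.
  - rewrite /= mulr0 !gtr0_sg ?subrr// subr_gt0//; exact: lt_trans ab.
  - rewrite (ltr0_sg (x := a - x)) ?subr_lt0//.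
    have [xb'|xb'|xb'] := ltgtP x b; last by rewrite xb' eqxx in xb.
    + by rewrite (gtr0_sg (x := b - x)) ?subr_gt0//=; field.
    + by rewrite (ltr0_sg (x := b - x)) ?subr_lt0//=; ring.
by move: L0; rewrite E => /eqP; rewrite mulf_eq0 (negbTE pi0) /= => /eqP.
Qed.

(** Partial fractions: the Poisson kernel is split into one pole in each half-plane. *)
Lemma resolvent_diff w x : 0 < Im w ->
  (sqn (resolvent w x))%:C = (w - conjc w)^-1 * (resolvent (conjc w) x - resolvent w x).
Proof.
move=> w0; have h1 : x%:C + w != 0 by apply: resolvent_denom; rewrite gt_eqF.
have h2 : x%:C + conjc w != 0 by apply: resolvent_denom; rewrite cImJ oppr_eq0 gt_eqF.
have h3 : w - conjc w != 0.
  by case: (w) w0 => u v /= v0; rewrite eq_complex /= negb_and opprK (gt_eqF (addr_gt0 v0 v0)) orbT.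
rewrite -mulJ_sqn resolvent_conj /resolvent; field; by rewrite h1 h2 h3.
Qed.

(** The pairing of p with a resolvent of the upper half-plane averages frequencies and vanishes;
    applying this to conj(p) gives the lower half-plane. The two poles together make the Poisson
    kernel. *)
Lemma fourier_unique p : cinteg p -> (forall l, CI (fun x => p x * expi (l * x)) = 0) ->
  {ae mu, forall x, p x = 0}.
Proof.
move=> ip p0.
have H q : cinteg q -> (forall l, CI (fun x => q x * expi (l * x)) = 0) ->
    forall w, 0 < Im w -> CI (fun x => q x * resolvent w x) = 0.
  move=> iq q0 w w0; have := CI_expi_resolvent_eq0 iq w0 (fun l _ => q0 l) (lexx 0).
  by under eq_fun do rewrite mul0r expi0 mul1r.
apply: poisson_unique => // w w0.
have wn0 : Im w != 0 by rewrite gt_eqF.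
have cwn0 : Im (conjc w) != 0 by rewrite cImJ oppr_eq0.
under eq_fun do rewrite resolvent_diff// mulrCA mulrBr.
rewrite CIZ; last by apply: cintegB; exact: cinteg_resolvent.
rewrite CIB; [|exact: cinteg_resolvent|exact: cinteg_resolvent].
rewrite (H p ip p0 w w0) subr0.
have ipc := cinteg_conj ip.
have : CI (fun x => conjc (p x) * resolvent w x) = 0.
  apply: H => // l; rewrite -(conjc0 R) -(p0 (- l)) -CI_conj; last exact: cinteg_expi.
  by congr CI; apply/funext => x; rewrite conjcM mulNr expiN conjcK.
move/(congr1 conjc); rewrite conjc0 -CI_conj; last exact: cinteg_resolvent.
under eq_fun do rewrite conjcM conjcK resolvent_conj.
by move=> ->; rewrite mulr0.
Qed.

(** * Exponential damping and the transform of a squared resolvent *)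

Lemma indic_ray a t : \1_(`[a, +oo[) t = (a <= t)%R%:R :> R.
Proof. by rewrite indicE mem_setE in_itv /= andbT. Qed.

Definition damp (e x : R) : R := expR (- (e * `|x|)).

Lemma continuous_damp e : continuous (damp e).
Proof.
move=> x; apply: (@continuous_comp _ _ _ (fun x => - (e * `|x|)) (@expR R)); last exact: continuous_expR.
by apply: cvgN; apply: cvgM; [exact: cvg_cst|exact: norm_continuous].
Qed.

Lemma damp_le1 e x : 0 <= e -> damp e x <= 1.
Proof. by move=> e0; rewrite -expR0 ler_expR oppr_le0 mulr_ge0. Qed.

Lemma damp_ge0 e x : 0 <= damp e x.
Proof. exact: expR_ge0. Qed.

(** Both rays contain 0, where the right-hand side takes the value 2 instead of 1; hence the
    excluded point. *)
Lemma damp_split e t x : x != 0 -> (damp e x)%:C * expi (t * x) =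
  (\1_(`[0, +oo[) x)%:C * cexp (t +i* e) x + (\1_(`]-oo, 0]) x)%:C * cexp (t +i* (- e)) x.
Proof.
move=> x0; rewrite !indicE !mem_setE !in_itv /= andbT /cexp /damp /= (mulrC t).
have [xlt|xlt|xE] := ltgtP x 0; last by rewrite xE eqxx in x0.
- rewrite ltr0_norm// mul0r add0r mul1r; congr ((expR _)%:C * _); ring.
- rewrite gtr0_norm// mul0r addr0 mul1r; congr ((expR _)%:C * _); ring.
Qed.

Lemma rinteg_damp e : 0 < e -> rinteg (damp e).
Proof.
move=> e0.
have h1 := @cinteg_ray _ (0 +i* e) 0 e0.
have h2 := @cinteg_rayN _ (0 +i* - e) 0 _; rewrite /= oppr_lt0 in h2.
have h := cintegD h1 (h2 e0).
have : cinteg (fun x => (damp e x)%:C).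
  apply: (cinteg_ae h).
    by apply: cmeasurable_real; apply: continuous_measurable_fun; exact: continuous_damp.
  apply: (aeS (ae_neq 0)) => x x0; rewrite -damp_split// mul0r expi0 mulr1 //.
by case.
Qed.

(** The two half-lines contribute i/(t + ie) and -i/(t - ie), whose sum is the Poisson kernel. *)
Lemma damp_transform e t : 0 < e ->
  CI (fun x => (damp e x)%:C * expi (t * x)) = (2 * e / (t ^+ 2 + e ^+ 2))%:C.
Proof.
move=> e0; have Ne0 : - e < 0 by rewrite oppr_lt0.
have h1 := @cinteg_ray _ (t +i* e) 0 e0.
have h2 := @cinteg_rayN _ (t +i* - e) 0 Ne0.
rewrite (CI_ae (g := fun x => (\1_(`[0, +oo[) x)%:C * cexp (t +i* e) x + (\1_(`]-oo, 0]) x)%:C * cexp (t +i* (- e)) x)).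
- rewrite CID// cexp_ray// cexp_rayN// !cexp0 !mulr1.
  have d0 : t ^+ 2 + e ^+ 2 != 0 by rewrite gt_eqF// ltr_wpDl ?sqr_ge0 ?exprn_gt0.
  by apply: complex_eqP => /=; rewrite ?sqrrN; field.
- apply: cmeasurableM.
    by apply: cmeasurable_real; apply: continuous_measurable_fun; exact: continuous_damp.
  by apply: cmeasurable_expi; exact: measurable_funM.
- by apply: cinteg_meas; exact: cintegD.
- by apply: (aeS (ae_neq 0)) => x x0; exact: damp_split.
Qed.

Lemma cinteg_damp e f (C : R) : 0 < e -> cmeasurable f -> (forall x, normc (f x) <= C) ->
  cinteg (fun x => (damp e x)%:C * f x).
Proof.
move=> e0 mf fC; apply: (@cinteg_mulb _ _ _ C) => //; apply: cinteg_real; exact: rinteg_damp.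
Qed.

Lemma ray_decomp w l x : 0 < Im w ->
  expi (l * x) * resolvent w x = ('i * cexp w l)^-1 *
    CI (fun t => (\1_(`[l, +oo[) t)%:C * cexp w t * expi (t * x)).
Proof.
move=> w0; rewrite ray_transform// mulKf// mulf_neq0 ?cexp_neq0//.
exact: im_neq0.
Qed.

(** A resolvent is square integrable but not integrable, so the damping is what allows Fubini.
    Writing u as an average of exp(itx) over t >= 0 turns the damped transform G(s) into an average
    of Poisson kernels at t + s, which stay below 2 e / l^2 as soon as s >= l. The other factor
    exp(ilx) u(x) then averages G over s >= l. *)
Lemma damped_resolvent_sqr w l : 0 < Im w -> 0 < l -> exists C : R, forall e, 0 < e ->
  normc (CI (fun x => (damp e x)%:C * resolvent w x * (expi (l * x) * resolvent w x))) <= C * e.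
Proof.
move=> w0 l0.
pose B (a t : R) := (\1_(`[a, +oo[) t)%:C * cexp w t.
have iB a : cinteg (B a) by exact: cinteg_ray.
pose N (a : R) := \int[mu]_t normc (B a t).
have N0 a : 0 <= N a by apply: Rintegral_ge0 => t _; exact: normc_ge0.
(* The two outer factors 2 come from the two uses of [normc_CI_le], and 2 / l ^+ 2 from the bound on
   the Poisson kernel. *)
exists (2 * (normc ('i * cexp w l)^-1 * (2 * (normc ('i * cexp w 0)^-1 * (2 / l ^+ 2) * N 0)) * N l)) => e e0.
have idu : cinteg (fun x => (damp e x)%:C * resolvent w x).
  apply: (cinteg_damp e0 (C := `|Im w|^-1)); first by apply: cmeasurable_resolvent; rewrite gt_eqF.
  by move=> x; apply: normc_resolvent_le; rewrite gt_eqF.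
have id : cinteg (fun x => (damp e x)%:C) by apply: cinteg_real; exact: rinteg_damp.
pose G s := CI (fun x => (damp e x)%:C * resolvent w x * expi (s * x)).
have GE s : G s = ('i * cexp w 0)^-1 * CI (fun t => B 0 t * (2 * e / ((t + s) ^+ 2 + e ^+ 2))%:C).
  rewrite /G.
  have ide := cinteg_expi s id.
  have := fubini_expi ide (iB 0).
  rewrite [RHS](_ : _ = CI (fun t => B 0 t * (2 * e / ((t + s) ^+ 2 + e ^+ 2))%:C)); last first.
    congr CI; apply/funext => t; congr (_ * _); rewrite -damp_transform//.
    by congr CI; apply/funext => x; rewrite -mulrA -expiD mulrDl addrC.
  move=> <-; under [in RHS]eq_fun do rewrite ray_transform// mulrCA mul0r expi0 mul1r.
  rewrite CIZ; last by apply: cinteg_resolvent => //; rewrite gt_eqF.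
  rewrite mulKf; last by rewrite mulf_neq0 ?cexp_neq0// im_neq0.
  by congr CI; apply/funext => x; rewrite mulrAC.
have Gle s : l <= s -> normc (G s) <= 2 * (normc ('i * cexp w 0)^-1 * (2 / l ^+ 2) * N 0) * e.
  move=> ls; rewrite GE ComplexField.Normc.normcM.
  have -> : 2 * (normc ('i * cexp w 0)^-1 * (2 / l ^+ 2) * N 0) * e =
      normc ('i * cexp w 0)^-1 * (2 * ((2 / l ^+ 2 * e) * N 0)) by ring.
  rewrite ler_wpM2l ?normc_ge0//.
  have -> : 2 / l ^+ 2 * e * N 0 = \int[mu]_t (2 / l ^+ 2 * e * normc (B 0 t)).
    by rewrite RintegralZl//; exact: cinteg_norm.
  have mk : measurable_fun setT (fun t : R => 2 * e / ((t + s) ^+ 2 + e ^+ 2)).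
    apply: continuous_measurable_fun => t; apply: cvgM; first exact: cvg_cst.
    by apply: (@continuous_sqn_resolvent _ (s +i* e)); rewrite gt_eqF.
  apply: normc_CI_le.
  - by apply: cmeasurableM; [exact: cinteg_meas|exact: cmeasurable_real].
  - by apply: rintegZ; exact: cinteg_norm.
  move=> t; rewrite ComplexField.Normc.normcM mulrC /B.
  rewrite indic_ray; have [t0|t0] := leP 0 t; last first.
    by rewrite mul0r ComplexField.Normc.normc0 !mulr0.
  rewrite ler_wpM2r ?normc_ge0// normc_real ger0_norm; last first.
    by rewrite !mulr_ge0 ?invr_ge0 ?addr_ge0 ?sqr_ge0// ltW.
  rewrite mulrAC ler_wpM2r ?(ltW e0)// ler_wpM2l//.
  rewrite lef_pV2 ?posrE ?exprn_gt0 ?ltr_wpDl ?sqr_ge0 ?exprn_gt0//.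
  apply: (@le_trans _ _ ((t + s) ^+ 2)); last by rewrite lerDl sqr_ge0.
  have lts : l <= t + s by apply: (le_trans ls); rewrite lerDr.
  by apply: lerXn2r => //; rewrite nnegrE ?(ltW l0)//; apply: le_trans lts; exact: ltW.
under eq_fun do rewrite ray_decomp// mulrCA.
have := fubini_expi idu (iB l) => fub.
rewrite CIZ; last first.
  have := cfubini_integ idu (iB l) measurable_expi_prod21.1 measurable_expi_prod21.2
    (fun q => normc_expi_le1 (q.2 * q.1)).
  by [].
rewrite fub ComplexField.Normc.normcM.
rewrite (_ : 2 * _ * e = normc ('i * cexp w l)^-1 * (2 * (2 * (normc ('i * cexp w 0)^-1 * (2 / l ^+ 2) * N 0) * e * N l))); last by ring.
apply: ler_wpM2l; first exact: normc_ge0.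
move: Gle; move: (2 * (normc _ * _ * N 0) * e) => K Gle.
have -> : K * N l = \int[mu]_t (K * normc (B l t)).
  by rewrite RintegralZl; [|exact: measurableT|exact: cinteg_norm].
apply: normc_CI_le.
- apply: cinteg_meas.
  have := @cfubini_integ _ (B l) (fun x => (damp e x)%:C * resolvent w x) (fun q => expi (q.1 * q.2)) 1 (iB l) idu.
  apply; last by move=> q; exact: normc_expi_le1.
  + have := measurable_expi_prod21.1; under eq_fun do rewrite mulrC; exact.
  + have := measurable_expi_prod21.2; under eq_fun do rewrite mulrC; exact.
- by apply: rintegZ; exact: cinteg_norm.
move=> t; rewrite ComplexField.Normc.normcM mulrC /B.
rewrite indic_ray; have [lt|tl] := leP l t; last first.
  by rewrite mul0r ComplexField.Normc.normc0 !mulr0.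
by apply: ler_wpM2r; [exact: normc_ge0|exact: Gle].
Qed.

Lemma cinteg_resolvent_sqr w l : Im w != 0 -> cinteg (fun x => resolvent w x * (expi (l * x) * resolvent w x)).
Proof.
move=> w0; have := cinteg_expi l (L2M_cinteg (L2_resolvent w0) (L2_resolvent w0)).
by under eq_fun do rewrite -mulrA (mulrC _ (expi _)).
Qed.

Lemma cvg_invS0 : n.+1%:R^-1 @[n --> \oo] --> (0 : R).
Proof. exact: cvg_harmonic. Qed.

Lemma cvg_damp x : damp n.+1%:R^-1 x @[n --> \oo] --> (1 : R).
Proof.
rewrite [X in _ --> X](_ : _ = expR (- (0 * `|x|))); last by rewrite mul0r oppr0 expR0.
have h : (fun n : nat => - (n.+1%:R^-1 * `|x|)) @ \oo --> - (0 * `|x|).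
  by apply: cvgN; apply: cvgM; [exact: cvg_invS0|exact: cvg_cst].
exact: (@cvg_comp _ _ _ (fun n : nat => - (n.+1%:R^-1 * `|x|)) (@expR R) _ _ _ h (@continuous_expR R _)).
Qed.

(** For l > 0 the damping is removed by dominated convergence. The bound of [damped_resolvent_sqr]
    blows up at l = 0, so this value is reached by continuity in l. *)
Lemma resolvent_sqr_transform w l : 0 < Im w -> 0 <= l ->
  CI (fun x => resolvent w x * (expi (l * x) * resolvent w x)) = 0.
Proof.
move=> w0; have wn0 : Im w != 0 by rewrite gt_eqF.
have muw := cmeasurable_resolvent wn0.
have main s : 0 < s -> CI (fun x => resolvent w x * (expi (s * x) * resolvent w x)) = 0.
  move=> s0; have [C HC] := damped_resolvent_sqr w0 s0.
  apply: (@ccvg_unique _ (fun n => CI (fun x => (damp n.+1%:R^-1 x)%:C * resolvent w x * (expi (s * x) * resolvent w x)))).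
    apply: (CI_dominated (g := fun x => sqn (resolvent w x))).
    - move=> n; under eq_fun do rewrite -mulrA; apply: cmeasurableM.
        by apply: cmeasurable_real; apply: continuous_measurable_fun; exact: continuous_damp.
      by apply: cinteg_meas; exact: cinteg_resolvent_sqr.
    - by apply: cinteg_meas; exact: cinteg_resolvent_sqr.
    - by apply: L2_sqn; exact: L2_resolvent.
    - apply: aeW => x; under eq_fun do rewrite -mulrA.
      rewrite -[X in ccvg _ X]mul1r; apply: ccvgM; last exact: ccvg_cst.
      by apply: ccvg_real; exact: cvg_damp.
    - move=> n x; rewrite !ComplexField.Normc.normcM normc_expi mul1r normc_real ger0_norm ?damp_ge0//.
      rewrite -mulrA -expr2 sqr_normcE ler_piMl ?sqn_ge0//; apply: damp_le1; by rewrite invr_ge0.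
  apply: ccvg_normc0; apply: (squeeze_cvgr _ (cvg_cst 0) (_ : (fun n : nat => C * n.+1%:R^-1) @ \oo --> (0:R))).
    apply: nearW => n; apply/andP; split; first exact: normc_ge0.
    by apply: HC; rewrite invr_gt0.
  by rewrite -(mulr0 C); apply: cvgM; [exact: cvg_cst|exact: cvg_invS0].
rewrite le_eqVlt => /predU1P[<-|]; last exact: main.
apply: (@ccvg_unique _ (fun n => CI (fun x => resolvent w x * (expi (n.+1%:R^-1 * x) * resolvent w x)))).
  apply: (CI_dominated (g := fun x => sqn (resolvent w x))).
  - by move=> n; apply: cinteg_meas; exact: cinteg_resolvent_sqr.
  - by apply: cinteg_meas; exact: cinteg_resolvent_sqr.
  - by apply: L2_sqn; exact: L2_resolvent.
  - apply: aeW => x; apply: ccvgM; first exact: ccvg_cst.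
    apply: ccvgM; last exact: ccvg_cst.
    have h : (fun n : nat => (n.+1%:R^-1 * x)) @ \oo --> (0 * x).
      by apply: cvgM; [exact: cvg_invS0|exact: cvg_cst].
    split => /=.
    + exact: (@cvg_comp _ _ _ (fun n : nat => n.+1%:R^-1 * x) (@cos R) _ _ _ h (@continuous_cos R _)).
    + exact: (@cvg_comp _ _ _ (fun n : nat => n.+1%:R^-1 * x) (@sin R) _ _ _ h (@continuous_sin R _)).
  - move=> n x; rewrite !ComplexField.Normc.normcM normc_expi mul1r.
    by rewrite -expr2 sqr_normcE.
rewrite (_ : (fun n => _) = (fun=> 0)); first exact: ccvg_cst.
by apply/funext => n; apply: main; rewrite invr_gt0.
Qed.

End Uniqueness.

(** * The Fourier transform on L^2 *)

Section Fourier.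
Context {R : realType}.
Implicit Types (f g h F : R -> R[i]) (z w : R[i]) (a b x t s l : R).

Definition trunc (n : nat) f (x : R) : R[i] := (\1_(`[- n%:R, n%:R]) x)%:C * f x.

Definition FT f (l : R) : R[i] := CI (fun x => f x * expi (- (l * x))).

Lemma truncated_fourierE n f : truncated_fourier n f = FT (trunc n f).
Proof.
apply/funext => l; rewrite /truncated_fourier cintegral_mkcond /FT /trunc.
by congr CI; apply/funext => x; rewrite mulrA.
Qed.

Lemma measurable_expiN_prod :
  measurable_fun setT (fun q : R * R => Re (expi (- (q.1 * q.2)))) /\
  measurable_fun setT (fun q : R * R => Im (expi (- (q.1 * q.2)))).
Proof.
have m : measurable_fun setT (fun q : R * R => - (q.1 * q.2)).
  by apply: measurableT_comp => //; apply: measurable_funM; [exact: measurable_fst|exact: measurable_snd].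
split => /=; apply: measurableT_comp m; apply: continuous_measurable_fun.
- exact: continuous_cos.
- exact: continuous_sin.
Qed.

Lemma fubini_FT (A B : R -> R[i]) : cinteg A -> cinteg B ->
  CI (fun l => A l * FT B l) = CI (fun x => B x * FT A x).
Proof.
move=> iA iB; rewrite /FT.
rewrite (@cfubini _ A B (fun q => expi (- (q.1 * q.2))) 1 iA iB measurable_expiN_prod.1
  measurable_expiN_prod.2 (fun q => normc_expi_le1 _)).
by congr CI; apply/funext => x; congr (_ * CI _); apply/funext => l; rewrite mulrC [x * l]mulrC mulrC.
Qed.

Lemma fubini_FT_cinteg (A B : R -> R[i]) : cinteg A -> cinteg B ->
  cinteg (fun l => A l * FT B l).
Proof.
move=> iA iB.
exact: (@cfubini_integ _ A B (fun q => expi (- (q.1 * q.2))) 1 iA iB measurable_expiN_prod.1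
  measurable_expiN_prod.2 (fun q => normc_expi_le1 _)).
Qed.

Lemma measurable_damp (e : R) : measurable_fun setT (damp e).
Proof. by apply: continuous_measurable_fun; exact: continuous_damp. Qed.

(** Fubini yields measurability of the transform times an integrable weight; the weight [damp 1] is
    then cancelled by its inverse [damp (-1)]. *)
Lemma cmeasurable_FT f : cinteg f -> cmeasurable (FT f).
Proof.
move=> iF; have id : cinteg (fun l : R => (damp 1 l)%:C) by apply: cinteg_real; exact: rinteg_damp.
have -> : FT f = (fun l => (damp (-1) l)%:C * ((damp 1 l)%:C * FT f l)).
  apply/funext => l; rewrite mulrA -rmorphM /= /damp -expRD mulN1r mul1r opprK subrr expR0.
  by rewrite mul1r.
apply: cmeasurableM; first by apply: cmeasurable_real; exact: measurable_damp.
by apply: cinteg_meas; exact: fubini_FT_cinteg.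
Qed.

Lemma cinteg_FT_damp f e : cinteg f -> 0 < e -> cinteg (fun l => (damp e l)%:C * FT f l).
Proof.
move=> iF e0; apply: fubini_FT_cinteg => //; apply: cinteg_real; exact: rinteg_damp.
Qed.

Lemma conj_FT f l : cinteg f -> conjc (FT f l) = FT (fun x => conjc (f x)) (- l).
Proof.
move=> iF; rewrite /FT -CI_conj; last first.
  by under eq_fun do rewrite -mulNr; exact: cinteg_expi.
by congr CI; apply/funext => x; rewrite conjcM -expiN mulNr.
Qed.

Lemma FT_bounded f : cinteg f -> exists C : R, forall l, normc (FT f l) <= C.
Proof.
move=> iF; exists (2 * \int[mu]_x normc (f x)) => l; apply: normc_CI_le.
- apply: cmeasurableM; first exact: cinteg_meas.
  by apply: cmeasurable_expi; apply: measurableT_comp => //; exact: measurable_funM.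
- exact: cinteg_norm.
- by move=> x; rewrite ComplexField.Normc.normcM normc_expi mulr1.
Qed.

(** * Plancherel's inequality for integrable functions in L^2 *)

Definition poisson_kernel (e t : R) : R := 2 * e / (t ^+ 2 + e ^+ 2).

Lemma poisson_kernel_ge0 e t : 0 < e -> 0 <= poisson_kernel e t.
Proof. by move=> e0; rewrite !mulr_ge0 ?invr_ge0 ?addr_ge0 ?sqr_ge0// ltW. Qed.

Lemma poisson_kernel_le e t : 0 < e -> poisson_kernel e t <= 2 / e.
Proof.
move=> e0; rewrite /poisson_kernel ler_pdivrMr ?ltr_wpDl ?sqr_ge0 ?exprn_gt0//.
rewrite mulrDr (_ : 2 / e * e ^+ 2 = 2 * e); last by field; rewrite gt_eqF.
by rewrite lerDr mulr_ge0 ?sqr_ge0// divr_ge0// ltW.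
Qed.

Lemma continuous_poisson_kernel e : 0 < e -> continuous (poisson_kernel e).
Proof.
move=> e0 t; apply: cvgM; first exact: cvg_cst.
have E : (fun x => ((x + Re (0 +i* e)) ^+ 2 + Im (0 +i* e) ^+ 2)^-1) = (fun x => (x ^+ 2 + e ^+ 2)^-1).
  by apply/funext => x /=; rewrite addr0.
by have := @continuous_sqn_resolvent _ (0 +i* e); rewrite E /= gt_eqF// => /(_ isT t).
Qed.

Lemma poisson_kernel_mass e x : 0 < e -> (\int[mu]_y (poisson_kernel e (y - x))%:E <= (2 * pi)%:E)%E.
Proof.
move=> e0; have := @integral_sqn_resolvent_le _ ((- x) +i* e) e0; rewrite /= => h.
have -> : (\int[mu]_y (poisson_kernel e (y - x))%:E = (2 * e)%:E * \int[mu]_y (sqn (resolvent ((- x) +i* e) y))%:E)%E.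
  rewrite -ge0_integralZl//.
  - by apply: eq_integral => y _; rewrite -EFinM sqn_resolvent.
  - by apply/measurable_EFinP; apply: measurable_sqn; apply: cmeasurable_resolvent; rewrite /= gt_eqF.
  - by move=> y _; rewrite lee_fin sqn_ge0.
  - by rewrite lee_fin mulr_ge0// ltW.
apply: (le_trans (lee_wpmul2l _ h)); first by rewrite lee_fin mulr_ge0// ltW.
by rewrite -EFinM lee_fin le_eqVlt; apply/orP; left; apply/eqP; field; rewrite gt_eqF.
Qed.

Lemma poisson_kernelN e t : poisson_kernel e (- t) = poisson_kernel e t.
Proof. by rewrite /poisson_kernel sqrrN. Qed.

Lemma measurable_poisson_kernel_prod e : 0 < e -> measurable_fun setT (fun q : R * R => poisson_kernel e (q.2 - q.1)).
Proof.
move=> e0; apply: (measurableT_comp (continuous_measurable_fun (continuous_poisson_kernel e0))).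
by apply: measurable_funB; [exact: measurable_snd|exact: measurable_fst].
Qed.

(* The damping makes Fubini applicable; its transform is the Poisson kernel, so
   that Plancherel's inequality reduces to the Schur test in [schur_bound]. *)
Lemma damped_energy f e : cinteg f -> 0 < e ->
  CI (fun l => (damp e l * sqn (FT f l))%:C) =
  CI (fun x => f x * CI (fun y => conjc (f y) * (poisson_kernel e (y - x))%:C)).
Proof.
move=> iF e0; have id := cinteg_FT_damp iF e0.
have idc : cinteg (fun l => (damp e l)%:C * conjc (FT f l)).
  have := cinteg_conj id; by under eq_fun do rewrite conjcM conjc_real.
have -> : CI (fun l => (damp e l * sqn (FT f l))%:C) = CI (fun l => ((damp e l)%:C * conjc (FT f l)) * FT f l).
  by congr CI; apply/funext => l; rewrite rmorphM /= -mulJ_sqn mulrAC -mulrA.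
rewrite (fubini_FT idc iF).
congr CI; apply/funext => x.
congr (f x * _).
rewrite /FT.
have iA : cinteg (fun l => (damp e l)%:C * expi (- (x * l))).
  under eq_fun do rewrite -mulNr; apply: cinteg_expi; apply: cinteg_real; exact: rinteg_damp.
transitivity (CI (fun l => ((damp e l)%:C * expi (- (x * l))) *
    CI (fun y => conjc (f y) * expi (y * l)))).
  congr CI; apply/funext => l; rewrite conj_FT// /FT mulrAC; congr (_ * CI _).
  by apply/funext => y; rewrite mulNr opprK mulrC [l * y]mulrC mulrC.
have iB := cinteg_conj iF.
rewrite (fubini_expi iA iB); congr CI; apply/funext => y; congr (_ * _).
rewrite -damp_transform//; congr CI; apply/funext => l.
by rewrite -mulrA -expiD mulrBl addrC.
Qed.

Lemma Rintegral_le_integral (c : R -> R) (H : R -> \bar R) : rinteg c -> measurable_fun setT H ->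
  (forall x, (0 <= H x)%E) -> (forall x, (`|c x|%:E <= H x)%E) ->
  ((\int[mu]_x c x)%:E <= \int[mu]_x H x)%E.
Proof.
move=> ic mH H0 cH; rewrite /Rintegral fineK; last exact: (integrable_fin_num measurableT ic).
have mc : measurable_fun setT (EFin \o c) by apply/measurable_EFinP; exact: rinteg_meas.
apply: (@le_trans _ _ (\int[mu]_x `|(EFin \o c) x|)%E).
  by have := le_abse_integral mu measurableT mc; apply: le_trans; exact: lee_abs.
have mac : measurable_fun setT (fun x => `|(EFin \o c) x|%E) by apply: measurableT_comp.
apply: ge0_le_integral; [exact: measurableT|by []|exact: mac|exact: mH|].
by move=> x _; exact: cH.
Qed.

Lemma ge0_integralZl_EFin (k : R) (h : R -> R) : 0 <= k -> measurable_fun setT h ->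
  (forall x, 0 <= h x) -> (\int[mu]_x (k * h x)%:E = k%:E * \int[mu]_x (h x)%:E)%E.
Proof.
move=> k0 mh h0; rewrite -ge0_integralZl//.
- by apply/measurable_EFinP.
- by move=> x _; rewrite lee_fin.
Qed.

(** The kernel has mass at most 2 pi in each variable, so each of the two terms contributes at most
    2 pi [nrm2 f]; Tonelli and the evenness of the kernel reduce the second term to the first. *)
Lemma schur_bound f e : L2 f -> 0 < e ->
  (\int[mu]_x \int[mu]_y ((sqn (f x) + sqn (f y)) * poisson_kernel e (y - x))%:E <= (4 * pi * nrm2 f)%:E)%E.
Proof.
move=> L2f e0; have ms := measurable_sqn (L2_meas L2f).
have mp := measurable_poisson_kernel_prod e0.
have m1 : measurable_fun setT (fun q : R * R => (sqn (f q.1) * poisson_kernel e (q.2 - q.1))%:E).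
  apply/measurable_EFinP; apply: measurable_funM => //.
  by apply: (measurableT_comp ms); exact: measurable_fst.
have m2 : measurable_fun setT (fun q : R * R => (sqn (f q.2) * poisson_kernel e (q.2 - q.1))%:E).
  apply/measurable_EFinP; apply: measurable_funM => //.
  by apply: (measurableT_comp ms); exact: measurable_snd.
have p1 q : (0 <= (sqn (f q.1) * poisson_kernel e (q.2 - q.1))%:E)%E by rewrite lee_fin mulr_ge0 ?sqn_ge0 ?poisson_kernel_ge0.
have p2 q : (0 <= (sqn (f q.2) * poisson_kernel e (q.2 - q.1))%:E)%E by rewrite lee_fin mulr_ge0 ?sqn_ge0 ?poisson_kernel_ge0.
have mpk x : measurable_fun setT (fun y : R => (poisson_kernel e (y - x))%:E).
  apply/measurable_EFinP; apply: (measurableT_comp (continuous_measurable_fun (continuous_poisson_kernel e0))).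
  by apply: measurable_funB.
have bound (k : R -> R -> R) (kE : forall x y, k x y = poisson_kernel e (y - x)) x :
    (\int[mu]_y (sqn (f x) * k x y)%:E <= (sqn (f x) * (2 * pi))%:E)%E.
  under eq_integral do rewrite kE.
  rewrite ge0_integralZl_EFin ?sqn_ge0//; [|by apply/measurable_EFinP; exact: mpk|by move=> y; exact: poisson_kernel_ge0].
  by rewrite EFinM lee_wpmul2l ?lee_fin ?sqn_ge0//; exact: poisson_kernel_mass.
have outer (H : R -> \bar R) : measurable_fun setT H -> (forall x, (0 <= H x)%E) ->
    (forall x, (H x <= (sqn (f x) * (2 * pi))%:E)%E) -> (\int[mu]_x H x <= (2 * pi * nrm2 f)%:E)%E.
  move=> mH H0 HB; apply: (@le_trans _ _ (\int[mu]_x (sqn (f x) * (2 * pi))%:E)%E).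
    apply: ge0_le_integral => //.
    - by apply/measurable_EFinP; apply: measurable_funM.
  under eq_integral do rewrite mulrC.
  rewrite ge0_integralZl_EFin; [|by rewrite mulr_ge0// pi_ge0|exact: ms|by move=> x; exact: sqn_ge0].
  by rewrite nrm2E// EFinM.
have -> : (\int[mu]_x \int[mu]_y ((sqn (f x) + sqn (f y)) * poisson_kernel e (y - x))%:E =
   \int[mu]_x \int[mu]_y (sqn (f x) * poisson_kernel e (y - x))%:E +
   \int[mu]_x \int[mu]_y (sqn (f y) * poisson_kernel e (y - x))%:E)%E.
  rewrite -ge0_integralD//; last 4 first.
  - by move=> x _; apply: integral_ge0 => y _; exact: (p1 (x, y)).
  - exact: (@measurable_fun_fubini_tonelli_F _ _ _ _ R mu _ m1 p1).
  - by move=> x _; apply: integral_ge0 => y _; exact: (p2 (x, y)).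
  - exact: (@measurable_fun_fubini_tonelli_F _ _ _ _ R mu _ m2 p2).
  apply: eq_integral => x _; rewrite -ge0_integralD//; last 4 first.
  - by move=> y _; exact: (p1 (x, y)).
  - apply/measurable_EFinP; apply: measurable_funM; first exact: measurable_cst.
    by apply/measurable_EFinP; exact: mpk.
  - by move=> y _; exact: (p2 (x, y)).
  - apply/measurable_EFinP; apply: measurable_funM; first exact: ms.
    by apply/measurable_EFinP; exact: mpk.
  by apply: eq_integral => y _; rewrite -EFinD mulrDl.
have -> : (\int[mu]_x \int[mu]_y (sqn (f y) * poisson_kernel e (y - x))%:E =
  \int[mu]_y \int[mu]_x (sqn (f y) * poisson_kernel e (y - x))%:E)%E.
  exact: (@fubini_tonelli _ _ _ _ R mu mu _ m2 p2).
have -> : 4 * pi * nrm2 f = 2 * pi * nrm2 f + 2 * pi * nrm2 f by ring.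
rewrite EFinD; apply: leeD; apply: outer.
- exact: (@measurable_fun_fubini_tonelli_F _ _ _ _ R mu _ m1 p1).
- by move=> x; apply: integral_ge0 => y _; exact: (p1 (x, y)).
- by move=> x; exact: (bound (fun x y => poisson_kernel e (y - x))).
- exact: (@measurable_fun_fubini_tonelli_G _ _ _ _ R mu _ m2 p2).
- by move=> y; apply: integral_ge0 => x _; exact: (p2 (x, y)).
- move=> y; apply: (bound (fun y x => poisson_kernel e (y - x))) => u v.
  by rewrite -poisson_kernelN opprB.
Qed.

Lemma damped_energy_le f e : cinteg f -> L2 f -> 0 < e ->
  (\int[mu]_l (damp e l * sqn (FT f l))%:E <= (4 * pi * nrm2 f)%:E)%E.
Proof.
move=> iF L2f e0; have := damped_energy iF e0; rewrite CI_real => /(congr1 (@complex.Re R)).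
have [C HC] := FT_bounded iF.
have mFT := cmeasurable_FT iF.
have irr : rinteg (fun l => damp e l * sqn (FT f l)).
  apply: (@rinteg_le _ _ (fun l => C ^+ 2 * damp e l)).
  - by apply: measurable_funM; [exact: measurable_damp|exact: measurable_sqn].
  - by apply: rintegZ; exact: rinteg_damp.
  - move=> l; rewrite ger0_norm ?mulr_ge0 ?sqn_ge0 ?damp_ge0// mulrC ler_wpM2r ?damp_ge0//.
    by rewrite -sqr_normcE; apply: lerXn2r => //; rewrite nnegrE ?normc_ge0// (le_trans (normc_ge0 _) (HC 0)).
have -> : (\int[mu]_l (damp e l * sqn (FT f l))%:E = (\int[mu]_l (damp e l * sqn (FT f l)))%:E)%E.
  by rewrite /Rintegral fineK//; exact: (integrable_fin_num measurableT irr).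
rewrite [Re _]/= => ->; apply: le_trans (schur_bound L2f e0).
have mpk x : measurable_fun setT (fun y : R => poisson_kernel e (y - x)).
  apply: (measurableT_comp (continuous_measurable_fun (continuous_poisson_kernel e0))).
  by apply: measurable_funB.
have ifc := cinteg_conj iF.
have mp := measurable_poisson_kernel_prod e0.
have pb (q : R * R) : normc (poisson_kernel e (q.2 - q.1))%:C <= 2 / e.
  by rewrite normc_real ger0_norm ?poisson_kernel_ge0// poisson_kernel_le.
have iint := @cfubini_integ _ f _ (fun q => (poisson_kernel e (q.2 - q.1))%:C) _ iF ifc mp (measurable_cst _) pb.
apply: Rintegral_le_integral.
- exact: iint.1.
- have m0 : measurable_fun setT (fun q : R * R => ((sqn (f q.1) + sqn (f q.2)) * poisson_kernel e (q.2 - q.1))%:E).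
    have ms := measurable_sqn (L2_meas L2f).
    apply/measurable_EFinP; apply: measurable_funM => //; apply: measurable_funD.
      by apply: (measurableT_comp ms); exact: measurable_fst.
    by apply: (measurableT_comp ms); exact: measurable_snd.
  have q0 (q : R * R) : (0 <= ((sqn (f q.1) + sqn (f q.2)) * poisson_kernel e (q.2 - q.1))%:E)%E.
    by rewrite lee_fin; apply: mulr_ge0; [rewrite addr_ge0 ?sqn_ge0|exact: poisson_kernel_ge0].
  exact: (@measurable_fun_fubini_tonelli_F _ _ _ _ R mu _ m0 q0).
- by move=> x; apply: integral_ge0 => y _; rewrite lee_fin; apply: mulr_ge0; [rewrite addr_ge0 ?sqn_ge0|exact: poisson_kernel_ge0].
move=> x; rewrite -CIZ; last first.
  by apply: (@cinteg_mulb _ _ _ (2 / e)) => //; [exact: cmeasurable_real|move=> y; exact: (pb (x, y))].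
have ix : cinteg (fun y => f x * (conjc (f y) * (poisson_kernel e (y - x))%:C)).
  apply: cintegZ; apply: (@cinteg_mulb _ _ _ (2 / e)) => //; [exact: cmeasurable_real|move=> y; exact: (pb (x, y))].
apply: (@le_trans _ _ (\int[mu]_y `|Re (f x * (conjc (f y) * (poisson_kernel e (y - x))%:C))|)%:E).
  by rewrite lee_fin; exact: (le_normr_Rintegral measurableT ix.1).
apply: Rintegral_le_integral.
- by apply: rinteg_norm; exact: ix.1.
- apply/measurable_EFinP; apply: measurable_funM => //; apply: measurable_funD; first exact: measurable_cst.
  by apply: measurable_sqn; exact: L2_meas.
- by move=> y; rewrite lee_fin; apply: mulr_ge0; [rewrite addr_ge0 ?sqn_ge0|exact: poisson_kernel_ge0].
move=> y; rewrite lee_fin normr_id; apply: le_trans (normr_Re _) _.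
rewrite !ComplexField.Normc.normcM normc_conj normc_real (ger0_norm (poisson_kernel_ge0 _ e0)) mulrA.
rewrite ler_wpM2r ?poisson_kernel_ge0// -!sqr_normcE.
have := sqr_ge0 (normc (f x) - normc (f y)).
have := normc_ge0 (f x); have := normc_ge0 (f y); nra.
Qed.

(** Fatou's lemma removes the damping. The constant is twice the sharp value 2 pi because |f(x)
    f(y)| was bounded by the sum of the squares rather than by half of it. *)
Lemma FT_L2 f : cinteg f -> L2 f -> L2 (FT f) /\ nrm2 (FT f) <= 4 * pi * nrm2 f.
Proof.
move=> iF L2f; have mFT := cmeasurable_FT iF; have ms := measurable_sqn mFT.
have h : (\int[mu]_l (sqn (FT f l))%:E <= (4 * pi * nrm2 f)%:E)%E.
  apply: (@integral_le_lim _ (fun n l => damp n.+1%:R^-1 l * sqn (FT f l))).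
  - by move=> n; apply: measurable_funM => //; exact: measurable_damp.
  - by move=> n l; rewrite mulr_ge0 ?damp_ge0 ?sqn_ge0.
  - by move=> l; rewrite -[X in _ --> X]mul1r; apply: cvgM; [exact: cvg_damp|exact: cvg_cst].
  - by move=> n; apply: damped_energy_le => //; rewrite invr_gt0.
have L2F : L2 (FT f).
  apply/L2P; split => //; apply/integrableP; split; first exact/measurable_EFinP.
  under eq_integral do rewrite /= ger0_norm ?sqn_ge0//.
  by apply: le_lt_trans h _; rewrite ltry.
by split => //; rewrite -lee_fin -nrm2E.
Qed.

(** * The transform of an L^2 function as a limit of truncations *)

Lemma L2_indic_segment a b : L2 (fun x : R => (\1_(`[a, b]) x)%:C).
Proof.
apply/L2P; split; first by apply: cmeasurable_real; exact: measurable_indic.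
rewrite (_ : (fun x => _) = \1_(`[a, b])); last first.
  by apply/funext => x; rewrite /sqn /= expr0n addr0 indicE; case: (_ \in _); rewrite ?expr1n ?expr0n.
exact: integrable_indic_itv.
Qed.

Lemma trunc_L2 n f : L2 f -> L2 (trunc n f).
Proof.
move=> L2f; apply: (L2_mulb (C := 1)) => //.
  by apply: cmeasurable_real; exact: measurable_indic.
apply: aeW => x; rewrite /sqn /= expr0n addr0 indicE.
by case: (_ \in _); rewrite ?expr1n ?expr0n.
Qed.

Lemma trunc_cinteg n f : L2 f -> cinteg (trunc n f).
Proof. by move=> L2f; apply: L2M_cinteg => //; exact: L2_indic_segment. Qed.

Lemma trunc_cvg f : L2 f -> nrm2 (fun x => trunc n f x - f x) @[n --> \oo] --> (0 : R).
Proof.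
move=> L2f; have ms := measurable_sqn (L2_meas L2f).
rewrite [X in _ --> X](_ : _ = \int[mu]_x (0 : R)); last by rewrite /Rintegral integral0.
apply: (rinteg_dominated (g := fun x => sqn (f x))).
- by move=> n; apply: measurable_sqn; apply: cmeasurableB; apply: L2_meas => //; exact: trunc_L2.
- exact: measurable_cst.
- exact: L2_sqn.
- apply: aeW => x; apply: cvg_near_cst; exists (Num.truncn `|x|).+1 => // n /= xn.
  have xn' : `|x| <= n%:R by apply: ltW; apply: lt_le_trans (truncnS_gt _) _; rewrite ler_nat.
  rewrite /trunc indicE mem_setE in_itv /= -ler_norml xn' mul1r subrr.
  by rewrite /sqn /= expr0n addr0.
- move=> n x; rewrite ger0_norm ?sqn_ge0// /trunc indicE.
  case: (_ \in _); first by rewrite mul1r subrr /sqn /= expr0n addr0 sqn_ge0.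
  by rewrite mul0r sub0r -mulN1r sqnM /sqn /= oppr0 expr0n addr0 sqrrN expr1n mul1r.
Qed.

Lemma FTB f g l : cinteg f -> cinteg g -> FT (fun x => f x - g x) l = FT f l - FT g l.
Proof.
move=> iF ig; rewrite /FT -CIB.
- by congr CI; apply/funext => x; rewrite mulrBl.
- by under eq_fun do rewrite -mulNr; exact: cinteg_expi.
- by under eq_fun do rewrite -mulNr; exact: cinteg_expi.
Qed.

Lemma is_fourierP f F : L2 f -> L2 F ->
  is_fourier f F <-> nrm2 (fun l => FT (trunc n f) l - F l) @[n --> \oo] --> (0 : R).
Proof.
move=> L2f L2F.
have L2d n : L2 (fun l => FT (trunc n f) l - F l).
  by apply: L2B => //; apply: (FT_L2 _ _).1; [exact: trunc_cinteg|exact: trunc_L2].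
have E n : Lpnorm 2%:E (truncated_fourier n f \- F) = (Num.sqrt (nrm2 (fun l => FT (trunc n f) l - F l)))%:E.
  by rewrite truncated_fourierE; exact: (Lpnorm_nrm2 (L2d n)).
split=> [[_]|h].
- under eq_fun do rewrite E.
  move=> h; have h' : (fun n => Num.sqrt (nrm2 (fun l => FT (trunc n f) l - F l))) @ \oo --> (0 : R).
    exact: (fine_cvg h).
  rewrite (_ : (fun n => nrm2 _) = (fun n => Num.sqrt (nrm2 (fun l => FT (trunc n f) l - F l)) *
      Num.sqrt (nrm2 (fun l => FT (trunc n f) l - F l)))); last first.
    by apply/funext => n; rewrite -expr2 sqr_sqrtr ?nrm2_ge0.
  by have := cvgM h' h'; rewrite mulr0; apply.
- split => //; under eq_fun do rewrite E.
  apply: cvg_EFin; first exact: nearW.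
  rewrite -sqrtr0.
  exact: (@cvg_comp _ _ _ (fun n => nrm2 (fun l => FT (trunc n f) l - F l)) (@Num.sqrt R) _ _ _ h (@sqrt_continuous R 0)).
Qed.

Lemma fourier_exists f : L2 f -> exists F, is_fourier f F.
Proof.
move=> L2f; have C0 : 0 < 4 * pi :> R by rewrite mulr_gt0// pi_gt0.
have [||F L2F HF] := @L2_complete R (fun n => FT (trunc n f)).
- by move=> n; apply: (FT_L2 _ _).1; [exact: trunc_cinteg|exact: trunc_L2].
(* If both truncations are within e / (16 pi) of f in squared norm, the parallelogram identity puts
   them within e / (4 pi) of each other, and the transform multiplies this by at most 4 pi. *)
- move=> e e0; have e' : 0 < e / (4 * pi) / 4 by rewrite !divr_gt0.
  have [N _ HN] := cvgr_le _ (trunc_cvg L2f) _ e'.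
  exists N => m n Nm Nn.
  have iT k : cinteg (trunc k f) by exact: trunc_cinteg.
  have L2T k : L2 (trunc k f) by exact: trunc_L2.
  rewrite (_ : (fun x => _) = FT (fun x => trunc m f x - trunc n f x)); last first.
    by apply/funext => l; rewrite FTB.
  apply: le_trans (FT_L2 _ _).2 _; [exact: cintegB|exact: L2B|].
  rewrite -ler_pdivlMl//.
  have -> : (fun x => trunc m f x - trunc n f x) = (fun x => (trunc m f x - f x) - (trunc n f x - f x)).
    by apply/funext => x; ring.
  rewrite parallelogram; [|exact: L2B|exact: L2B].
  have := HN m Nm; have := HN n Nn; rewrite /=.
  have := nrm2_ge0 (fun x => trunc m f x - f x + (trunc n f x - f x)).
  rewrite (mulrC _ e); move: (e / (4 * pi)) (nrm2 _) (nrm2 _) (nrm2 _) => r1 r2 r3 r4; lra.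
exists F; apply/is_fourierP => //.
apply/cvgr0Pnorm_le => e e0; have [N HN] := HF e e0; exists N => // n /= Nn.
by rewrite ger0_norm ?nrm2_ge0//; exact: HN.
Qed.

Lemma CI_L2_cvg (u : nat -> R -> R[i]) f g : (forall n, L2 (u n)) -> L2 f -> L2 g ->
  nrm2 (fun x => u n x - f x) @[n --> \oo] --> (0 : R) ->
  ccvg (fun n => CI (fun x => u n x * g x)) (CI (fun x => f x * g x)).
Proof.
move=> L2u L2f L2g uf.
rewrite (_ : (fun n => _) = (fun n => CI (fun x => f x * g x) + CI (fun x => (u n x - f x) * g x))); last first.
  apply/funext => n; rewrite -CID; [|exact: L2M_cinteg|by apply: L2M_cinteg => //; exact: L2B].
  by congr CI; apply/funext => x; ring.
rewrite -[X in ccvg _ X]addr0; apply: ccvgD; first exact: ccvg_cst.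
apply: ccvg_normc0.
have h : Num.sqrt (nrm2 (fun x => u n x - f x) * nrm2 g) @[n --> \oo] --> (0 : R).
  rewrite -sqrtr0 -(mul0r (nrm2 g)).
  have h0 : nrm2 (fun x => u n x - f x) * nrm2 g @[n --> \oo] --> 0 * nrm2 g.
    by apply: cvgM => //; exact: cvg_cst.
  exact: (@cvg_comp _ _ _ _ (@Num.sqrt R) _ _ _ h0 (@sqrt_continuous R _)).
apply: (squeeze_cvgr _ (cvg_cst 0) h); apply: nearW => n; apply/andP; split; first exact: normc_ge0.
have := cauchy_schwarz (L2B (L2u n) L2f) (L2_conj L2g).
rewrite /cinner; under eq_fun do rewrite conjcK.
rewrite normcE => cs; rewrite ler_wsqrtr//; apply: le_trans cs _.
rewrite ler_wpM2l ?nrm2_ge0// le_eqVlt; apply/orP; left; apply/eqP.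
by congr Rintegral; apply/funext => x; rewrite sqn_conj.
Qed.

(** For truncations of f this is Fubini; both sides then pass to the limit, on the left by the
    definition of [F] and on the right by convergence of the truncations. It converts conditions on
    F, known only as an L^2 limit, into integrals against f. *)
Lemma multiplication_formula f F g : L2 f -> is_fourier f F -> cinteg g -> L2 g ->
  CI (fun l => F l * g l) = CI (fun x => f x * FT g x).
Proof.
move=> L2f Ff ig L2g; have L2F : L2 F by case: Ff.
have iT k : cinteg (trunc k f) by exact: trunc_cinteg.
have L2T k : L2 (trunc k f) by exact: trunc_L2.
have h1 := CI_L2_cvg (fun n => (FT_L2 (iT n) (L2T n)).1) L2F L2g ((is_fourierP L2f L2F).1 Ff).
have h2 := CI_L2_cvg L2T L2f (FT_L2 ig L2g).1 (trunc_cvg L2f).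
apply: (ccvg_unique h1); move: h2; congr ccvg; apply/funext => n.
rewrite -fubini_FT//; congr CI; apply/funext => x; exact: mulrC.
Qed.

Lemma sqn_cexp z t : sqn (cexp z t) = expR (- (t * Im (2 * z))).
Proof.
rewrite -sqr_normcE normc_cexp expr2 -expRD; congr expR.
by case: z => a b /=; ring.
Qed.

(** The function exp(-itw) cut off to (-oo, -l], where it decays when Im w > 0. Its transform is a
    multiple of exp(ilx) u(x), so pairing with that function sees only frequencies up to -l. *)
Definition rayN_exp w (l t : R) : R[i] := (\1_(`]-oo, (- l)]) t)%:C * cexp (- w) t.

Lemma rayN_exp_cinteg w l : 0 < Im w -> cinteg (rayN_exp w l).
Proof. by move=> w0; apply: cinteg_rayN; rewrite cImN oppr_lt0. Qed.

Lemma rayN_exp_L2 w l : 0 < Im w -> L2 (rayN_exp w l).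
Proof.
move=> w0; apply/L2P; split; first by apply: cinteg_meas; exact: rayN_exp_cinteg.
have w2 : Im (2 * - w) < 0.
  have -> : Im (2 * - w) = - (2 * Im w) by case: (w) => a b /=; ring.
  by rewrite oppr_lt0 mulr_gt0.
have := rinteg_expR_rayN (- l) w2; congr rinteg; apply/funext => t.
rewrite sqnM sqn_cexp; congr (_ * _).
by rewrite /sqn /= expr0n addr0 indicE; case: (_ \in _); rewrite ?expr1n ?expr0n.
Qed.

Lemma resolventN w x : resolvent (- w) (- x) = - resolvent w x.
Proof. by rewrite /resolvent rmorphN /= -opprD invrN. Qed.

Lemma FT_rayN_exp w l x : 0 < Im w -> FT (rayN_exp w l) x = 'i * cexp w l * (expi (l * x) * resolvent w x).
Proof.
move=> w0; have Nw0 : Im (- w) < 0 by rewrite cImN oppr_lt0.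
have := rayN_transform (- l) (- x) Nw0.
rewrite resolventN cexp_oppt opprK mulrNN !mulrN !mulNr opprK => <-.
by rewrite /FT; congr CI; apply/funext => t; rewrite /rayN_exp mulrN mulrC [x * t]mulrC mulrC.
Qed.

End Fourier.

(** * Invariant subspaces of L^2 *)

Section Hardy.
Context {R : realType}.
Implicit Types (f g h F : R -> R[i]) (z w : R[i]) (a b x t s l : R) (M N A : set (R -> R[i])).

Lemma indic_rayN a t : \1_(`]-oo, a]) t = (t <= a)%R%:R :> R.
Proof. by rewrite indicE mem_setE in_itv. Qed.

(** Conversely, the vanishing integrals say that F(t) exp(-itw) has integral 0 over every ray ending
    at -l <= 0; differences of rays give intervals, and the exponential has no zeros. A single point
    w suffices, which leaves its choice to each application. *)
Lemma H2P w f : 0 < Im w ->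
  H2 f <-> L2 f /\ forall l, 0 <= l -> CI (fun x => f x * (expi (l * x) * resolvent w x)) = 0.
Proof.
move=> w0; have wn0 : Im w != 0 by rewrite gt_eqF.
have rayN_exp_CI F l : L2 f -> is_fourier f F -> CI (fun t => F t * rayN_exp w l t) =
    'i * cexp w l * CI (fun x => f x * (expi (l * x) * resolvent w x)).
  move=> L2f Ff; rewrite (multiplication_formula L2f Ff (rayN_exp_cinteg l w0) (rayN_exp_L2 l w0)).
  rewrite -CIZ; last first.
    have := cinteg_expi l (L2M_cinteg L2f (L2_resolvent wn0)).
    by under eq_fun do rewrite -mulrA (mulrC (resolvent w _)).
  by congr CI; apply/funext => x; rewrite FT_rayN_exp// mulrCA.
have c0 l : 'i * cexp w l != 0 by rewrite mulf_neq0 ?cexp_neq0// im_neq0.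
split=> [[L2f [F Ff F0]]|[L2f f0]].
- split => // l l0; apply: (mulfI (c0 l)); rewrite mulr0 -(rayN_exp_CI F)//.
  rewrite -(CI0 (R := R)); apply: CI_ae.
  + apply: cinteg_meas; apply: L2M_cinteg; [by case: Ff|exact: rayN_exp_L2].
  + exact: cmeasurable_cst.
  apply: (aeS2 F0 (ae_neq 0)) => t Ft0 t0; rewrite /rayN_exp indic_rayN.
  have [tl|tl] := leP t (- l); last by rewrite mul0r mulr0.
  rewrite Ft0 ?mul0r// lt_neqAle t0 /=; apply: (le_trans tl); by rewrite oppr_le0.
- split => //; have [F Ff] := fourier_exists L2f; exists F => //.
  have L2F : L2 F by case: Ff.
  pose G t := F t * rayN_exp w 0 t.
  have iG : cinteg G by apply: L2M_cinteg => //; exact: rayN_exp_L2.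
  have ray s : s <= 0 -> CI (fun t => (\1_(`]-oo, s]) t)%:C * G t) = 0.
    move=> s0; have Ns0 : 0 <= - s by rewrite oppr_ge0.
    have := rayN_exp_CI F (- s) L2f Ff; rewrite f0// mulr0 => <-.
    congr CI; apply/funext => t; rewrite /G /rayN_exp mulrCA; congr (_ * _); rewrite mulrA -rmorphM /=.
    congr (_%:C * _); rewrite !indic_rayN opprK oppr0.
    have [ts|ts] := leP t s; last by rewrite mul0r.
    by rewrite mul1r (le_trans ts s0).
  have iray s : cinteg (fun t => (\1_(`]-oo, s]) t)%:C * G t).
    under eq_fun do rewrite mulrC; apply: (@cinteg_mulb _ _ _ 1) => //.
      by apply: cmeasurable_real; exact: measurable_indic.
    by move=> t; rewrite normc_real indic_rayN ger0_norm//; case: (t <= s).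
  (* The cut-off at 0 built into G makes every longer ray equivalent to the one ending at 0. *)
  have rayT s : CI (fun t => (\1_(`]-oo, s]) t)%:C * G t) = 0.
    have [s0|s0] := leP s 0; first exact: ray.
    rewrite -[RHS](ray 0 (lexx _)); congr CI; apply/funext => t.
    rewrite /G /rayN_exp oppr0 mulrCA [RHS]mulrCA; congr (_ * _).
    have h : (\1_(`]-oo, s]) t)%:C * (\1_(`]-oo, 0]) t)%:C = (\1_(`]-oo, 0]) t)%:C * (\1_(`]-oo, 0]) t)%:C :> R[i].
      rewrite !indic_rayN; have [t0|t0] := leP t 0; first by rewrite (le_trans t0 (ltW s0)).
      by rewrite (_ : (false%:R : R)%:C = 0)// !mulr0.
    by rewrite mulrA h -mulrA.
  have G0 : {ae mu, forall t, G t = 0}.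
    apply: cinterval_integrals_eq0 => // a b ab.
    have -> : 0 = CI (fun t => (\1_(`]-oo, b]) t)%:C * G t - (\1_(`]-oo, a]) t)%:C * G t).
      by rewrite CIB// !rayT subrr.
    apply: CI_ae.
    + apply: cmeasurableM; last exact: cinteg_meas.
      by apply: cmeasurable_real; exact: measurable_indic.
    + by apply: cmeasurableB; apply: cinteg_meas; exact: iray.
    apply: (aeS (ae_neq a)) => t ta; rewrite -mulrBl -rmorphB /=; congr (_%:C * _).
    rewrite !indic_rayN indicE mem_setE in_itv /=.
    have [ta'|ta'|ta'] := ltgtP t a; last by rewrite ta' eqxx in ta.
    * by rewrite (le_trans (ltW ta') (ltW ab)) subrr.
    * by rewrite /= subr0.
  apply: (aeS G0) => t; rewrite /G /rayN_exp indic_rayN oppr0 => + t0.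
  rewrite (ltW t0) mul1r => /eqP; rewrite mulf_eq0 (negbTE (cexp_neq0 _ _)) orbF => /eqP //.
Qed.

Lemma H2_L2 f : H2 f -> L2 f.
Proof. by case. Qed.

(** As an orthogonal complement, H^2 is a closed subspace at once, by Cauchy-Schwarz rather than by
    limits of transforms. *)
Lemma H2_perp w : 0 < Im w ->
  H2 = perp [set g | exists2 l : R, 0 <= l & g = (fun x => conjc (expi (l * x) * resolvent w x))].
Proof.
move=> w0; apply/seteqP; split => f.
- move=> /(H2P _ w0)[L2f f0]; split => // g [l l0 ->].
  by rewrite /cinner; under eq_fun do rewrite conjcK; exact: f0.
- move=> [L2f f0]; apply/(H2P _ w0); split => // l l0.
  have := f0 _ (ex_intro2 _ _ l l0 erefl).
  by rewrite /cinner; under eq_fun do rewrite conjcK.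
Qed.

Lemma L2_expi_resolvent w l : Im w != 0 -> L2 (fun x => expi (l * x) * resolvent w x).
Proof.
move=> w0; apply: (L2_mulb (C := 1)); first exact: L2_resolvent.
- by apply: cmeasurable_expi; exact: measurable_funM.
- by apply: aeW => x; rewrite sqn_expi.
Qed.

Lemma L2_expi f l : L2 f -> L2 (fun x => expi (l * x) * f x).
Proof.
move=> L2f; apply: (L2_mulb (C := 1)) => //.
- by apply: cmeasurable_expi; exact: measurable_funM.
- by apply: aeW => x; rewrite sqn_expi.
Qed.

Lemma H2_closed : L2_closed_subspace (@H2 R).
Proof.
have i0 : 0 < Im (0 +i* 1 : R[i]) by rewrite /= ltr01.
rewrite (H2_perp i0); apply: perp_closed => g [l _ ->].
by apply: L2_conj; apply: L2_expi_resolvent; rewrite gt_eqF.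
Qed.

(** The quotient (x + conj w) / (x + w) in additive form: multiplication by it combines the identity
    with one resolvent, to which the frequency lemmas apply. *)
Definition blaschke w x : R[i] := 1 + (conjc w - w) * resolvent w x.

Lemma sub_conj_neq0 w : 0 < Im w -> w - conjc w != 0.
Proof.
by case: w => u v /= v0; rewrite eq_complex /= negb_and opprK (gt_eqF (addr_gt0 v0 v0)) orbT.
Qed.

Lemma conj_blaschke w x : conjc (blaschke w x) = 1 + (w - conjc w) * resolvent (conjc w) x.
Proof. by rewrite /blaschke conjcD conjcM conjcB conjcK resolvent_conj conjc1. Qed.

Lemma conj_blaschke_resolvent w x : 0 < Im w -> conjc (blaschke w x) * resolvent w x = resolvent (conjc w) x.
Proof.
move=> w0; have h1 : x%:C + w != 0 by apply: resolvent_denom; rewrite gt_eqF.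
have h2 : x%:C + conjc w != 0 by apply: resolvent_denom; rewrite cImJ oppr_eq0 gt_eqF.
by rewrite conj_blaschke /resolvent; field; rewrite h1 h2.
Qed.

Lemma blaschkeJ w x : 0 < Im w -> blaschke w x * conjc (blaschke w x) = 1.
Proof.
move=> w0; have h1 : x%:C + w != 0 by apply: resolvent_denom; rewrite gt_eqF.
have h2 : x%:C + conjc w != 0 by apply: resolvent_denom; rewrite cImJ oppr_eq0 gt_eqF.
by rewrite conj_blaschke /blaschke /resolvent; field; rewrite h1 h2.
Qed.

Lemma blaschke_resolvent_conj w x : 0 < Im w -> blaschke w x * resolvent (conjc w) x = resolvent w x.
Proof.
move=> w0; have h1 : x%:C + w != 0 by apply: resolvent_denom; rewrite gt_eqF.
have h2 : x%:C + conjc w != 0 by apply: resolvent_denom; rewrite cImJ oppr_eq0 gt_eqF.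
by rewrite /blaschke /resolvent; field; rewrite h1 h2.
Qed.

Lemma sqn_blaschke w x : 0 < Im w -> sqn (blaschke w x) = 1.
Proof. by move=> w0; apply: (@complexI R); rewrite -mulJ_sqn blaschkeJ. Qed.

Lemma normc_blaschke w x : 0 < Im w -> normc (blaschke w x) = 1.
Proof. by move=> w0; rewrite normcE sqn_blaschke// sqrtr1. Qed.

Lemma cmeasurable_blaschke w : 0 < Im w -> cmeasurable (blaschke w).
Proof.
move=> w0; apply: cmeasurableD; first exact: cmeasurable_cst.
by apply: cmeasurableM; [exact: cmeasurable_cst|apply: cmeasurable_resolvent; rewrite gt_eqF].
Qed.

(* Multiplying by the conjugate of the Blaschke factor moves one pole to the
   other half-plane; the vanishing mean is what prevents it from creating
   nonnegative frequencies. *)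
Lemma CI_conj_blaschke_eq0 r w : 0 < Im w -> cinteg r ->
  (forall l, 0 <= l -> CI (fun x => r x * expi (l * x)) = 0) ->
  CI (fun x => r x * conjc (blaschke w x)) = 0 ->
  forall l, 0 <= l -> CI (fun x => r x * conjc (blaschke w x) * expi (l * x)) = 0.
Proof.
move=> w0 ir r1 rb0 l l0.
have cwn0 : Im (conjc w) != 0 by rewrite cImJ oppr_eq0 gt_eqF.
have i3 := cinteg_resolvent ir cwn0.
have rE x : r x * conjc (blaschke w x) = r x + (w - conjc w) * (r x * resolvent (conjc w) x).
  by rewrite conj_blaschke; ring.
have e0 : CI (fun x => r x * resolvent (conjc w) x) = 0.
  move: rb0; under eq_fun do rewrite rE.
  rewrite CID// ?CIZ//; last exact: cintegZ.
  have := r1 0 (lexx _); under eq_fun do rewrite mul0r expi0 mulr1; move=> ->.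
  by move/eqP; rewrite add0r mulf_eq0 (negbTE (sub_conj_neq0 w0)) /= => /eqP.
have h := CI_expi_resolvent_eq0_of0 ir cwn0 r1 e0 l0.
have -> : (fun x => r x * conjc (blaschke w x) * expi (l * x)) = (fun x => r x * expi (l * x) +
      (w - conjc w) * (r x * (expi (l * x) * resolvent (conjc w) x))).
  by apply/funext => x; rewrite rE; ring.
have ih : cinteg (fun x => r x * (expi (l * x) * resolvent (conjc w) x)).
  by under eq_fun do rewrite mulrA; apply: cinteg_resolvent => //; exact: cinteg_expi.
rewrite CID; [|exact: cinteg_expi|exact: cintegZ].
by rewrite CIZ// h r1// mulr0 addr0.
Qed.

(** Both conditions are moved to the integrable function g conj(u). The second gives its frequencies
    l <= 0 directly. The first reaches l >= 0 because conj(b) u = conj(u), where the vanishing mean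
    required is the case l = 0 of the second. *)
Lemma expi_resolvent_total g w : 0 < Im w -> L2 g ->
  (forall l, 0 <= l -> CI (fun x => g x * (expi (l * x) * resolvent w x)) = 0) ->
  (forall l, 0 <= l -> CI (fun x => g x * (expi (- l * x) * resolvent (conjc w) x)) = 0) ->
  {ae mu, forall x, g x = 0}.
Proof.
move=> w0 L2g g1 g2; have wn0 : Im w != 0 by rewrite gt_eqF.
have cwn0 : Im (conjc w) != 0 by rewrite cImJ oppr_eq0.
have i1 : cinteg (fun x => g x * resolvent w x) by apply: L2M_cinteg => //; exact: L2_resolvent.
have i2 : cinteg (fun x => g x * resolvent (conjc w) x) by apply: L2M_cinteg => //; exact: L2_resolvent.
have gE x : g x * resolvent w x * conjc (blaschke w x) = g x * resolvent (conjc w) x.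
  by rewrite -conj_blaschke_resolvent//; ring.
have p0 l : CI (fun x => g x * resolvent (conjc w) x * expi (l * x)) = 0.
  have [l0|l0] := leP 0 l.
    under eq_fun do rewrite -gE; apply: CI_conj_blaschke_eq0 => //.
      by move=> s s0; rewrite -[RHS](g1 s s0); congr CI; apply/funext => x; ring.
    under eq_fun do rewrite gE; rewrite -[RHS](g2 0 (lexx _)); congr CI; apply/funext => x.
    by rewrite oppr0 mul0r expi0 mul1r.
  have Nl0 : 0 <= - l by rewrite oppr_ge0 ltW.
  rewrite -[RHS](g2 _ Nl0); congr CI; apply/funext => x; rewrite opprK; ring.
apply: (aeS (fourier_unique i2 p0)) => x /eqP.
by rewrite mulf_eq0 (negbTE (resolvent_neq0 x cwn0)) orbF => /eqP.
Qed.

(** * Shift-invariant subspaces *)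

Definition shift_invariant N : Prop :=
  forall l, 0 <= l -> forall f, N f -> N (fun x => expi (l * x) * f x).

Lemma closed_L2 N f : L2_closed_subspace N -> N f -> L2 f.
Proof. by move=> [[NL2 _ _ _] _]; exact: NL2. Qed.

Lemma perp_L2 A f : perp A f -> L2 f.
Proof. by case. Qed.

Lemma invariant_CI N f g : L2_closed_subspace N -> shift_invariant N -> N f -> perp N g ->
  forall l, 0 <= l -> CI (fun x => f x * conjc (g x) * expi (l * x)) = 0.
Proof.
move=> cN iN Nf [L2g gN] l l0; have Nef := iN l l0 f Nf.
have := cinnerC L2g (closed_L2 cN Nef); rewrite gN// conjc0 => h; rewrite -[RHS]h.
by rewrite /cinner; congr CI; apply/funext => x; ring.
Qed.

(** Since u averages the exponentials with t >= 0, u f should lie in their closed span applied to f;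
    testing against the orthogonal complement replaces the vector-valued integral by a scalar
    one. *)
Lemma invariant_resolvent N f w : L2_closed_subspace N -> shift_invariant N -> 0 < Im w -> N f ->
  N (fun x => resolvent w x * f x).
Proof.
move=> cN iN w0 Nf; have L2f := closed_L2 cN Nf; have wn0 : Im w != 0 by rewrite gt_eqF.
have L2uf : L2 (fun x => resolvent w x * f x).
  apply: (L2_mulb (C := (Im w ^+ 2)^-1)) => //; first exact: cmeasurable_resolvent.
  by apply: aeW => x; exact: sqn_resolvent_le.
apply: perpK => // g gN; have L2g := perp_L2 gN.
have := CI_expi_resolvent_eq0 (cinner_cinteg L2f L2g) w0 (invariant_CI cN iN Nf gN) (lexx 0).
move=> h; rewrite -[RHS]h /cinner; congr CI; apply/funext => x.
rewrite mul0r expi0; ring.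
Qed.

Lemma i_upper : 0 < Im (0 +i* 1 : R[i]).
Proof. by rewrite /= ltr01. Qed.

Lemma doubly_invariant N : L2_closed_subspace N -> shift_invariant N ->
  (forall w f, 0 < Im w -> N f -> N (fun x => resolvent (conjc w) x * f x)) ->
  exists2 E : set R, measurable E & N = mulset (fun x => (\1_E x)%:C) L2.
Proof.
move=> cN iN iuN.
have prod0 f g : N f -> perp N g -> {ae mu, forall x, f x * conjc (g x) = 0}.
  move=> Nf gN; have L2f := closed_L2 cN Nf; have L2g := perp_L2 gN.
  have ir := cinner_cinteg L2f L2g.
  apply: poisson_unique => // w w0; have wn0 : Im w != 0 by rewrite gt_eqF.
  have cwn0 : Im (conjc w) != 0 by rewrite cImJ oppr_eq0.
  under eq_fun do rewrite resolvent_diff// mulrCA mulrBr.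
  rewrite CIZ; last by apply: cintegB; exact: cinteg_resolvent.
  rewrite CIB; [|exact: cinteg_resolvent|exact: cinteg_resolvent].
  have h v : N (fun x => resolvent v x * f x) -> CI (fun x => f x * conjc (g x) * resolvent v x) = 0.
    move=> Nv; have := cinnerC L2g (closed_L2 cN Nv); rewrite gN.2// conjc0 => h; rewrite -[RHS]h.
    by rewrite /cinner; congr CI; apply/funext => x; ring.
  rewrite !h ?subrr ?mulr0//; [exact: invariant_resolvent|exact: iuN].
have un0 : Im (0 +i* 1 : R[i]) != 0 by rewrite gt_eqF ?i_upper.
pose u : R -> R[i] := resolvent (0 +i* 1).
have L2u : L2 u by exact: L2_resolvent.
(* The projection v of the nowhere vanishing u will be chi_E u. Where v = 0, the element u - v of
   the complement does not vanish, so every f in N does; where v is nonzero, every element of the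
   complement vanishes. *)
have [v Nv vN] := L2_projection cN L2u.
have L2v := closed_L2 cN Nv.
have vu := prod0 _ _ Nv vN.
pose E := [set x | v x != 0].
have mE : measurable E.
  have -> : E = (fun x => sqn (v x)) @^-1` [set r | r != 0].
    by apply/seteqP; split => x /=; rewrite /E /= sqn_eq0.
  rewrite -[X in measurable X]setTI; apply: (measurable_sqn (L2_meas L2v)) => //.
  rewrite (_ : [set r | r != 0] = ~` [set 0]); first by apply: measurableC; exact: measurable_set1.
  by apply/seteqP; split => r /= /eqP.
exists E => //; have E1 x : x \in E -> v x != 0 by rewrite inE.
have E0 x : x \notin E -> v x = 0 by move=> /negP; rewrite inE => /negP; rewrite negbK => /eqP.
apply/seteqP; split => f.
- move=> Nf; have L2f := closed_L2 cN Nf; split => //; exists f => //.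
  apply: (aeS2 (prod0 _ _ Nf vN) vu) => x h1 h2; rewrite indicE.
  have [xE|xE] := boolP (x \in E); first by rewrite mul1r.
  move: h1; rewrite E0// subr0 => /eqP; rewrite mulf_eq0 conjc_eq0.
  by rewrite (negbTE (resolvent_neq0 x un0)) orbF mul0r => /eqP.
- move=> [L2f [g L2g fg]]; apply: perpK => // k kN; have L2k := perp_L2 kN.
  rewrite /cinner -(CI0 (R := R)); apply: CI_ae.
  + by apply: cinteg_meas; exact: cinner_cinteg.
  + exact: cmeasurable_cst.
  apply: (aeS2 fg (prod0 _ _ Nv kN)) => x -> h; rewrite indicE.
  have [xE|xE] := boolP (x \in E); last by rewrite !mul0r.
  move: h => /eqP; rewrite mulf_eq0 (negbTE (E1 _ xE)) /= => /eqP ->.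
  by rewrite mulr0.
Qed.

Lemma unimodularP (q : R -> R[i]) : unimodular q <-> {ae mu, forall x, sqn (q x) = 1}.
Proof.
split=> h; apply: (aeS h) => x; rewrite normrE.
- by move=> [] e; rewrite -sqr_normcE e expr1n.
- by rewrite normcE => ->; rewrite sqrtr1.
Qed.

Lemma L2_unimodular (q : R -> R[i]) f : cmeasurable q -> unimodular q -> L2 f -> L2 (fun x => q x * f x).
Proof.
move=> mq /unimodularP q1 L2f; apply: (L2_mulb (C := 1)) => //.
by apply: (aeS q1) => x ->.
Qed.

Lemma unimodular_conj (q : R -> R[i]) : unimodular q -> unimodular (fun x => conjc (q x)).
Proof.
by move=> /unimodularP q1; apply/unimodularP; apply: (aeS q1) => x; rewrite sqn_conj.
Qed.

Lemma unimodularM (q1 q2 : R -> R[i]) : unimodular q1 -> unimodular q2 ->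
  unimodular (fun x => q1 x * q2 x).
Proof.
move=> /unimodularP h1 /unimodularP h2; apply/unimodularP.
by apply: (aeS2 h1 h2) => x; rewrite sqnM => -> ->; rewrite mulr1.
Qed.

Lemma unimodular_conjM (q : R -> R[i]) : unimodular q -> {ae mu, forall x, conjc (q x) * q x = 1}.
Proof. by move=> /unimodularP q1; apply: (aeS q1) => x h; rewrite mulrC mulJ_sqn h. Qed.

Lemma closed_ae N f g : L2_closed_subspace N -> N f -> L2 g -> {ae mu, forall x, f x = g x} -> N g.
Proof. by move=> [[_ _ _ h] _]; exact: h. Qed.

Lemma closed_0 N : L2_closed_subspace N -> N (fun=> 0).
Proof. by move=> [[_ h _ _] _]. Qed.

Lemma closed_lin N z f g : L2_closed_subspace N -> N f -> N g -> N (fun x => z * f x + g x).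
Proof. by move=> [[_ _ h _] _]; exact: h. Qed.

Lemma ae_exists (P : R -> Prop) : {ae mu, forall x, P x} -> exists x, P x.
Proof.
move=> [A [mA A0 PA]]; apply: contrapT => /forallNP nP.
have : (mu (`[0%R, 1%R]%classic : set R) <= mu A)%E.
  by apply: le_measure; rewrite ?inE// => x _; apply: PA; exact: nP.
by rewrite A0 lebesgue_measure_itv /= lte_fin ltr01 oppr0 adde0 lee_fin ler10.
Qed.

Lemma nrm2_resolvent_neq0 w : Im w != 0 -> nrm2 (resolvent w) != 0.
Proof.
move=> w0; apply/eqP => /(nrm2_eq0 (L2_resolvent w0))/ae_exists[x] /eqP.
by rewrite (negbTE (resolvent_neq0 x w0)).
Qed.

Lemma invariant_blaschke N f w : L2_closed_subspace N -> shift_invariant N -> 0 < Im w -> N f ->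
  N (fun x => blaschke w x * f x).
Proof.
move=> cN iN w0 Nf; have := closed_lin (conjc w - w) cN (invariant_resolvent cN iN w0 Nf) Nf.
by congr N; apply/funext => x; rewrite /blaschke; ring.
Qed.

(* With [u = 1 / (x + w)] and [b] the Blaschke factor, [b |psi|^2] has no
   nonnegative frequencies, and neither has [b |u|^2 = u^2]. Subtracting the
   multiple of the latter that makes the mean of [|psi|^2 - c |u|^2] vanish, [b]
   may be removed; a real function without nonnegative frequencies is zero. *)
Lemma wandering_modulus N (psi : R -> R[i]) w : L2_closed_subspace N -> shift_invariant N ->
  0 < Im w -> perp N psi -> N (fun x => blaschke w x * psi x) ->
  {ae mu, forall x, sqn (psi x) = nrm2 psi / nrm2 (resolvent w) * sqn (resolvent w x)}.
Proof.
move=> cN iN w0 psiN Nphi; have wn0 : Im w != 0 by rewrite gt_eqF.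
have L2psi := perp_L2 psiN; have L2u := L2_resolvent wn0.
set c := nrm2 psi / nrm2 (resolvent w).
have nu0 := nrm2_resolvent_neq0 wn0.
pose p x : R := sqn (psi x) - c * sqn (resolvent w x).
pose r x : R[i] := blaschke w x * (p x)%:C.
have ip : cinteg (fun x => (p x)%:C).
  apply: cinteg_real; rewrite /p; under eq_fun do rewrite -mulNr.
  by apply: rintegD; [exact: L2_sqn|apply: rintegZ; exact: L2_sqn].
have ir : cinteg r.
  rewrite /r; under eq_fun do rewrite mulrC; apply: (@cinteg_mulb _ _ _ 1) => //.
    exact: cmeasurable_blaschke.
  by move=> x; rewrite normc_blaschke.
have rp x : r x * conjc (blaschke w x) = (p x)%:C.
  by rewrite /r mulrAC blaschkeJ// mul1r.
have r1 l : 0 <= l -> CI (fun x => r x * expi (l * x)) = 0.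
  move=> l0; have h1 := invariant_CI cN iN Nphi psiN l0.
  have h2 := resolvent_sqr_transform w0 l0.
  have i1 := cinner_cinteg (closed_L2 cN Nphi) L2psi.
  have -> : (fun x => r x * expi (l * x)) = (fun x => blaschke w x * psi x * conjc (psi x) * expi (l * x)
     - c%:C * (resolvent w x * (expi (l * x) * resolvent w x))).
    apply/funext => x; rewrite /r /p rmorphB rmorphM /= -!mulJ_sqn resolvent_conj.
    have h : blaschke w x * (resolvent w x * resolvent (conjc w) x) = resolvent w x * resolvent w x.
      by rewrite mulrCA blaschke_resolvent_conj.
    rewrite (_ : blaschke w x * _ * _ = blaschke w x * psi x * conjc (psi x) * expi (l * x) -
      c%:C * (blaschke w x * (resolvent w x * resolvent (conjc w) x)) * expi (l * x)); last by ring.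
    by rewrite h; ring.
  rewrite CIB; [|exact: cinteg_expi|by apply: cintegZ; exact: cinteg_resolvent_sqr].
  by rewrite h1 CIZ ?h2 ?mulr0 ?subr0//; exact: cinteg_resolvent_sqr.
have p0 : CI (fun x => (p x)%:C) = 0.
  rewrite CI_real /p; under eq_Rintegral do rewrite -mulNr.
  rewrite RintegralD//; [|exact: L2_sqn|by apply: rintegZ; exact: L2_sqn].
  rewrite RintegralZl//; last exact: L2_sqn.
  by rewrite -/(nrm2 psi) -/(nrm2 (resolvent w)) /c mulNr mulfVK// subrr.
have pl l : CI (fun x => (p x)%:C * expi (l * x)) = 0.
  have H s : 0 <= s -> CI (fun x => (p x)%:C * expi (s * x)) = 0.
    move=> s0; under eq_fun do rewrite -rp; apply: CI_conj_blaschke_eq0 => //.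
    by under eq_fun do rewrite rp.
  have [l0|l0] := leP 0 l; first exact: H.
  have Nl0 : 0 <= - l by rewrite oppr_ge0 ltW.
  rewrite -(conjc0 R) -(H _ Nl0) -CI_conj; last exact: cinteg_expi.
  by congr CI; apply/funext => x; rewrite conjcM conjc_real mulNr expiN conjcK.
apply: (aeS (fourier_unique ip pl)) => x [] /eqP.
by rewrite /p subr_eq0 => /eqP.
Qed.

Lemma simply_invariant N w f0 : L2_closed_subspace N -> shift_invariant N -> 0 < Im w -> N f0 ->
  ~ N (fun x => resolvent (conjc w) x * f0 x) ->
  exists q : R -> R[i], [/\ cmeasurable q, unimodular q &
    forall f, L2 f -> (N f <-> H2 (fun x => conjc (q x) * f x))].
Proof.
move=> cN iN w0 Nf0 nN; have wn0 : Im w != 0 by rewrite gt_eqF.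
have L2f0 := closed_L2 cN Nf0; have L2u := L2_resolvent wn0.
have mb := cmeasurable_blaschke w0.
have ub : unimodular (blaschke w) by apply/unimodularP; apply: aeW => x; exact: sqn_blaschke.
pose f1 x := conjc (blaschke w x) * f0 x.
have L2f1 : L2 f1 by apply: L2_unimodular => //; [exact: cmeasurable_conj|exact: unimodular_conj].
(* The difference conj(b) f0 - f0 is a nonzero multiple of conj(u) f0, so conj(b) f0 cannot lie in N
   either. *)
have nf1 : ~ N f1.
  move=> Nf1; apply: nN.
  have h1 := closed_lin (-1) cN Nf0 Nf1.
  have := closed_lin (w - conjc w)^-1 cN h1 (closed_0 cN).
  congr N; apply/funext => x; rewrite addr0 /f1 conj_blaschke; field.
  exact: sub_conj_neq0.
have [n Nn psiN] := L2_projection cN L2f1.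
set psi := (fun x => _) in psiN; have L2psi := perp_L2 psiN.
have L2n := closed_L2 cN Nn.
pose phi x := blaschke w x * psi x.
(* Multiplying psi = conj(b) f0 - n by b gives f0 - b n, and N is stable under b. *)
have Nphi : N phi.
  have := closed_lin (-1) cN (invariant_blaschke cN iN w0 Nn) Nf0.
  congr N; apply/funext => x; rewrite /phi /psi /f1.
  rewrite (_ : blaschke w x * (_ - _) = blaschke w x * conjc (blaschke w x) * f0 x - blaschke w x * n x); last by ring.
  by rewrite blaschkeJ//; ring.
have npsi : nrm2 psi != 0.
  apply/eqP => /(nrm2_eq0 L2psi) psi0; apply: nf1; apply: (closed_ae cN Nn) => //.
  by apply: (aeS psi0) => x /eqP; rewrite /psi subr_eq0 => /eqP.
have mod := wandering_modulus cN iN w0 psiN Nphi.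
have nu0 := nrm2_resolvent_neq0 wn0.
set c := nrm2 psi / nrm2 (resolvent w) in mod.
have c0 : 0 < c by rewrite divr_gt0// lt_neqAle eq_sym ?npsi ?nu0 nrm2_ge0.
pose k : R := Num.sqrt c.
have k0 : k != 0 by rewrite gt_eqF// sqrtr_gt0.
have kc0 : k%:C != 0 by rewrite eq_complex /= (negbTE k0).
(* This is phi / (k u), defined everywhere because x + w has no real zero; the modulus identity
   makes it unimodular. *)
pose q x := (k^-1)%:C * phi x * (x%:C + w).
have mq : cmeasurable q.
  apply: cmeasurableM; first by apply: cmeasurableM; [exact: cmeasurable_cst|exact: L2_meas (closed_L2 cN Nphi)].
  by apply: cmeasurableD; [exact: cmeasurable_real|exact: cmeasurable_cst].
have phiE x : phi x = k%:C * (q x * resolvent w x).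
  have h := resolvent_denom x wn0; have kV : k%:C * (k^-1)%:C = 1 by rewrite -rmorphM mulfV//.
  by rewrite /q /resolvent mulfK// mulrA kV mul1r.
have psiE x : conjc (psi x) = k%:C * (conjc (q x) * resolvent w x).
  have -> : psi x = conjc (blaschke w x) * phi x by rewrite /phi mulrA (mulrC (conjc _)) blaschkeJ// mul1r.
  rewrite phiE !conjcM conjcK conjc_real resolvent_conj -[in RHS](blaschke_resolvent_conj x w0); ring.
have uq : unimodular q.
  apply/unimodularP; apply: (aeS mod) => x h.
  have h2 : sqn (phi x) = sqn (psi x) by rewrite /phi sqnM sqn_blaschke// mul1r.
  have s0 : sqn (resolvent w x) != 0 by rewrite sqn_eq0 resolvent_neq0.
  have : sqn (phi x) = c * sqn (q x) * sqn (resolvent w x).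
    by rewrite phiE !sqnM /sqn /= expr0n addr0 sqr_sqrtr ?ltW// mulrA.
  rewrite h2 h -[LHS]mulr1 mulrAC => /(mulIf s0).
  by rewrite mulr1 -[LHS]mulr1 => /(mulfI (lt0r_neq0 c0)).
(* Since conj(psi) = k conj(q) u, the integrals testing conj(q) f for H^2 are, up to k, the
   nonnegative frequencies of f conj(psi), which vanish by orthogonality. *)
have fwd f : N f -> H2 (fun x => conjc (q x) * f x).
  move=> Nf; have L2f := closed_L2 cN Nf; apply/(H2P _ w0); split.
    by apply: L2_unimodular => //; [exact: cmeasurable_conj|exact: unimodular_conj].
  move=> l l0; have := invariant_CI cN iN Nf psiN l0.
  have L2qf : L2 (fun x => conjc (q x) * f x).
    by apply: L2_unimodular => //; [exact: cmeasurable_conj|exact: unimodular_conj].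
  have iq := L2M_cinteg L2qf (L2_expi_resolvent l wn0).
  have -> : (fun x => f x * conjc (psi x) * expi (l * x)) =
      (fun x => k%:C * (conjc (q x) * f x * (expi (l * x) * resolvent w x))).
    by apply/funext => x; rewrite psiE; ring.
  by rewrite CIZ// => /eqP; rewrite mulf_eq0 (negbTE kc0) /= => /eqP.
exists q; split => // f L2f; split; first exact: fwd.
move=> Hf; have [n1 Nn1 gN] := L2_projection cN L2f.
set g := (fun x => _) in gN; have L2g := perp_L2 gN.
have L2qg : L2 (fun x => conjc (q x) * g x).
  by apply: L2_unimodular => //; [exact: cmeasurable_conj|exact: unimodular_conj].
have Hn := fwd _ Nn1.
(* The residual g of f is killed by both families of [expi_resolvent_total]: by the first because
   conj(q) f and conj(q) n1 both lie in H^2, by the second because g is orthogonal to every exp(ilx)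
   phi = k exp(ilx) q u. *)
have qg0 : {ae mu, forall x, conjc (q x) * g x = 0}.
  apply: (expi_resolvent_total w0) => // l l0.
  - have -> : (fun x => conjc (q x) * g x * (expi (l * x) * resolvent w x)) =
       (fun x => conjc (q x) * f x * (expi (l * x) * resolvent w x) - conjc (q x) * n1 x * (expi (l * x) * resolvent w x)).
      by apply/funext => x; rewrite /g; ring.
    rewrite CIB; [|by apply: L2M_cinteg; [exact: H2_L2|exact: L2_expi_resolvent]..].
    by rewrite ((H2P _ w0).1 Hf).2// ((H2P _ w0).1 Hn).2// subrr.
  - have := gN.2 _ (iN l l0 _ Nphi); rewrite /cinner.
    have -> : (fun x => g x * conjc (expi (l * x) * phi x)) =
        (fun x => k%:C * (conjc (q x) * g x * (expi (- l * x) * resolvent (conjc w) x))).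
      by apply/funext => x; rewrite phiE !conjcM conjc_real resolvent_conj mulNr expiN; ring.
    rewrite CIZ; last first.
      apply: L2M_cinteg => //; apply: L2_expi_resolvent; by rewrite cImJ oppr_eq0.
    by move/eqP; rewrite mulf_eq0 (negbTE kc0) /= => /eqP.
apply: (closed_ae cN Nn1) => //; move: uq => /unimodularP uq.
apply: (aeS2 qg0 uq) => x /eqP; rewrite mulf_eq0 conjc_eq0 => /orP[/eqP ->|/eqP + _].
  by rewrite /sqn /= expr0n addr0 => /esym/eqP; rewrite oner_eq0.
by move/eqP; rewrite /g subr_eq0 => /eqP.
Qed.

(** The second alternative means N = q H^2; as a membership test it avoids choosing representatives
    of the quotient by q. The zero subspace falls under the first alternative. *)
Lemma beurling_helson N : L2_closed_subspace N -> shift_invariant N ->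
  (exists2 E : set R, measurable E & N = mulset (fun x => (\1_E x)%:C) L2) \/
  (exists q : R -> R[i], [/\ cmeasurable q, unimodular q &
    forall f, L2 f -> (N f <-> H2 (fun x => conjc (q x) * f x))]).
Proof.
move=> cN iN.
have [h|] := pselect (forall w f, 0 < Im w -> N f -> N (fun x => resolvent (conjc w) x * f x)).
  by left; exact: doubly_invariant.
move=> /existsNP[w /existsNP[f /not_implyP[w0 /not_implyP[Nf nN]]]]; right.
exact: simply_invariant nN.
Qed.

End Hardy.

(** * Subspaces invariant under inner multiples *)

Section InnerMultiples.
Context {R : realType}.
Implicit Types (f g h q : R -> R[i]) (M : set (R -> R[i])).

Definition spectral_orbit I M : set (R -> R[i]) :=
  [set g | exists l f, [/\ 0 <= l :> R, M f & g = (fun x => expi (l * x) * I x * f x)]].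

Lemma perpW A B : A `<=` B -> @perp R B `<=` perp A.
Proof. by move=> AB f [L2f fB]; split => // g /AB; exact: fB. Qed.

Lemma sub_perp_perp A : A `<=` L2 -> A `<=` perp (@perp R A).
Proof.
move=> AL2 f Af; split; first exact: AL2.
by move=> g [L2g gA]; rewrite (cinnerC L2g (AL2 _ Af)) gA// conjc0.
Qed.

Lemma perp_perp_sub A M : L2_closed_subspace M -> A `<=` M -> perp (@perp R A) `<=` M.
Proof.
move=> cM AM f [L2f fA]; apply: perpK => // g gM; apply: fA.
exact: perpW gM.
Qed.

(** The adjoint of multiplication by exp(ilx) is multiplication by exp(-ilx), which preserves the
    complement of the orbit because adding l >= 0 to a frequency stays in the orbit. *)
Lemma spectral_orbit_invariant I M : spectral_orbit I M `<=` L2 ->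
  shift_invariant (perp (perp (spectral_orbit I M))).
Proof.
move=> SL2 l l0 f [L2f fS]; split; first exact: L2_expi.
move=> g [L2g gS].
have L2eg : L2 (fun x => expi (- l * x) * g x) by exact: L2_expi.
rewrite -[RHS](fS (fun x => expi (- l * x) * g x)).
  by congr CI; apply/funext => x; rewrite conjcM mulNr expiN conjcK; ring.
split => // s [l' [m [l'0 Mm ->]]].
rewrite -[RHS](gS (fun x => expi ((l + l') * x) * I x * m x)).
  by congr CI; apply/funext => x; rewrite mulrDl expiD !conjcM mulNr expiN; ring.
by exists (l + l'), m; split => //; rewrite addr_ge0.
Qed.

Lemma mulset_L2 q A f : @mulset R q A f -> L2 f.
Proof. by case. Qed.

End InnerMultiples.

Theorem theorem5p1 (R : realType) (M : set (R -> R[i])) (I : R -> R[i])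
    (M_closed : L2_closed_subspace M) (I_inner : inner_function I)
    (M_invariant : forall l : R, 0 <= l -> forall f, M f ->
       M (fun x => expi (l * x) * I x * f x)) :
  (exists2 E : set R, measurable E & M = mulset (fun x => (\1_E x)%:C) L2) \/
  (exists (q : R -> R[i]) (W : set (R -> R[i])),
     [/\ cmeasurable q, unimodular q, L2_subspace W,
         W `<=` ominus H2 (mulset I H2) &
         M = mulset q (addset W (mulset I H2))]).
Proof.
have [[[mI _] _] uI] := I_inner.
have [[ML2 M0 Mlin Mae] _] := M_closed.
pose S := spectral_orbit I M.
have SM : S `<=` M by move=> _ [l [f [l0 Mf ->]]]; exact: M_invariant.
have SL2 : S `<=` L2 by move=> f /SM; exact: ML2.
(* The double orthogonal complement plays the role of the closed linear span; it stays inside [M]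
   because [M] is closed. *)
pose N := perp (perp S).
have cN : L2_closed_subspace N by apply: perp_closed => f; exact: perp_L2.
have NM : N `<=` M by exact: perp_perp_sub.
have IN f : M f -> N (fun x => I x * f x).
  move=> Mf; have : N (fun x => expi (0 * x) * I x * f x).
    by apply: sub_perp_perp => //; exists 0, f; split.
  by under eq_fun do rewrite mul0r expi0 mul1r.
have uIJ := unimodular_conjM uI.
have [[E mE NE]|[q' [mq' uq' Nq']]] := beurling_helson cN (spectral_orbit_invariant SL2).
  left; exists E => //; apply/seteqP; split => f; last by rewrite -NE; exact: NM.
  move=> Mf; have := IN f Mf; rewrite NE => -[_ [g L2g Ifg]]; split; first exact: ML2.
  exists f; first exact: ML2.
  (* Off E the product I f vanishes, and multiplying by conj(I) recovers f = 0 there. *)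
  apply: (aeS2 Ifg uIJ) => x; rewrite indicE; case: (x \in E) => [_ _|]; first by rewrite mul1r.
  rewrite !mul0r => Ifx Ix; by rewrite -[f x]mul1r -Ix -mulrA Ifx mulr0.
right; have uIc := unimodular_conj uI; have mIc := cmeasurable_conj mI.
pose q x := conjc (I x) * q' x.
have mq : cmeasurable q by exact: cmeasurableM.
have uq : unimodular q by exact: unimodularM.
have uqc := unimodular_conj uq; have mqc := cmeasurable_conj mq.
have uqJ := unimodular_conjM uq; have uqJ' := unimodular_conjM uq'.
have H2cl := @H2_closed R.
have Nq h : H2 h -> N (fun x => q' x * h x).
  move=> Hh; have L2h := H2_L2 Hh.
  have L2qh : L2 (fun x => q' x * h x) by exact: L2_unimodular.
  apply/(Nq' _ L2qh); apply: (closed_ae H2cl Hh).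
    by apply: L2_unimodular => //; [exact: cmeasurable_conj|exact: unimodular_conj].
  by apply: (aeS uqJ') => x e; rewrite mulrA e mul1r.
pose W : set (R -> R[i]) := [set h | [/\ L2 h, M (fun x => q x * h x) &
  forall g, mulset I H2 g -> cinner h g = 0]].
exists q, W; split => //.
- split.
  + by move=> f [].
  + split; first exact: L2_0.
      by under eq_fun do rewrite mulr0.
    by move=> g _; rewrite /cinner; under eq_fun do rewrite mul0r; exact: CI0.
  + move=> a f g [L2f Mf fH] [L2g Mg gH]; split.
    * by apply: L2D => //; exact: L2Z.
    * by have := Mlin a _ _ Mf Mg; congr M; apply/funext => x; ring.
    * move=> h Hh; rewrite cinner_lin ?fH ?gH ?mulr0 ?addr0//; exact: mulset_L2 Hh.
  + move=> f g [L2f Mf fH] L2g fg; split => //.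
    * by apply: (Mae _ _ Mf); [exact: L2_unimodular|apply: (aeS fg) => x ->].
    * move=> h Hh; have L2h := mulset_L2 Hh; rewrite -(fH h Hh); apply: CI_ae.
      - by apply: cinteg_meas; exact: cinner_cinteg.
      - by apply: cinteg_meas; exact: cinner_cinteg.
      - by apply: (aeS fg) => x ->.
(* Membership of h in H^2 is not part of the definition of [W]: it follows because I q h lies in N
   and conj(q') I q = 1 almost everywhere. *)
- move=> h [L2h Mh hH]; split => //.
  have L2Iqh := ML2 _ Mh.
  have L2IIqh : L2 (fun x => I x * (q x * h x)) by exact: L2_unimodular.
  have := (Nq' _ L2IIqh).1 (IN _ Mh) => Hq; apply: (closed_ae H2cl Hq) => //.
  apply: (aeS2 uIJ uqJ') => x e1 e2.
  rewrite /q (_ : _ * _ = (conjc (q' x) * q' x) * (conjc (I x) * I x) * h x); last by ring.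
  by rewrite e1 e2 !mul1r.
- apply/seteqP; split => f.
  + move=> Mf; have L2f := ML2 _ Mf; split => //.
    have L2p : L2 (fun x => conjc (q x) * f x) by exact: L2_unimodular.
    exists (fun x => conjc (q x) * f x); last first.
      by apply: (aeS uqJ) => x e; rewrite mulrA (mulrC (q x)) e mul1r.
    (* Multiplication by [I] is unitary on L^2, so projecting conj(I) conj(q) f onto H^2 amounts to
       projecting conj(q) f onto I H^2, and the closedness of H^2 is enough. *)
    have L2k : L2 (fun x => conjc (I x) * (conjc (q x) * f x)) by exact: L2_unimodular.
    have [h Hh gH] := L2_projection H2cl L2k.
    set g := (fun x => _) in gH; have L2g := perp_L2 gH; have L2h := H2_L2 Hh.
    have L2Ig : L2 (fun x => I x * g x) by exact: L2_unimodular.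
    have L2Ih : L2 (fun x => I x * h x) by exact: L2_unimodular.
    split => //; exists (fun x => I x * g x), (fun x => I x * h x); split.
    * split => //.
      (* Up to null sets q I g = f - q' h, and q' h lies in N, hence in [M]. *)
      - have Mqh : M (fun x => -1 * (q' x * h x) + f x) by apply: Mlin => //; apply: NM; exact: Nq.
        apply: (Mae _ _ Mqh); first exact: L2_unimodular.
        apply: (aeS2 uIJ uqJ) => x e1 e2; rewrite /g.
        rewrite (_ : q x * _ = (conjc (I x) * I x) * (conjc (q x) * q x) * f x - q x * I x * h x); last by ring.
        rewrite e1 e2 /q (_ : conjc (I x) * q' x * I x * h x = (conjc (I x) * I x) * (q' x * h x)); last by ring.
        by rewrite e1; ring.
      (* The factors [I] and conj(I) cancel in the inner product of I g with I h1, leaving that of g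
         with an element of H^2. *)
      - move=> k [L2k' [h1 Hh1 kE]]; have L2h1 := H2_L2 Hh1.
        rewrite -(gH.2 h1 Hh1); apply: CI_ae.
        + by apply: cinteg_meas; exact: cinner_cinteg.
        + by apply: cinteg_meas; exact: cinner_cinteg.
        apply: (aeS2 kE uIJ) => x -> e; rewrite conjcM.
        by rewrite (_ : _ * _ = (conjc (I x) * I x) * (g x * conjc (h1 x))); [rewrite e mul1r|ring].
    * by split => //; exists h => //; apply: aeW.
    * by apply: (aeS uIJ) => x e; rewrite -mulrDr /g subrK mulrA (mulrC (I x)) e mul1r.
  + move=> [L2f [g0 [L2g0 [w0 [h0 [[L2w0 Mw0 _] [L2h0 [h1 Hh1 h0E]] g0E]]]] fE]].
    have Mqh : M (fun x => 1 * (q x * w0 x) + q' x * h1 x) by apply: Mlin => //; apply: NM; exact: Nq.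
    apply: (Mae _ _ Mqh) => //.
    apply: (aeS2 fE (aeS2 g0E (aeS2 h0E uIJ (fun x a b => conj a b)) (fun x a b => conj a b))) => x -> [-> [-> e]].
    rewrite /q mul1r mulrDr; congr (_ + _).
    by rewrite (_ : _ * (I x * _) = (conjc (I x) * I x) * (q' x * h1 x)); [rewrite e mul1r|ring].
Qed.
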